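(* There is a randomized combinatorial algorithm and an absolute constant $c>0$ with the following guarantee. Let $G$ be an undirected, unweighted graph with $n$ vertices, and let $k$ be a parameter such that $\log k \ge 1$ is an integer. The algorithm computes values $est(s,t)$ for all vertex pairs $(s,t)$ with $|st| \le est(s,t)$ for every pair, and, with high probability, $est(s,t) \le 2|st|$ for every pair $(s,t)$ with $|st| \ge c\log k$ (i.e. it finds $2$-approximate shortest path lengths for all vertex pairs at least $O(\log k)$ apart). Its running time is $\widetilde{O}(n^{2+\frac{1}{k}})$.
   Context: $|st|$ denotes the shortest-path distance between $s$ and $t$ in $G$. $\widetilde{O}(\cdot)$ hides $\mathrm{poly}\log n$ factors. ''With high probability'' means with probability at least $1-1/n^{c'}$ for a constant $c'>0$. In particular, for $k=\log n$ the running time is $\widetilde{O}(n^2)$ and the guarantee holds for all pairs at distance at least $O(\log\log n)$. *)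

(* Defs.v *)
From mathcomp Require Import all_boot all_order all_algebra.
From mathcomp Require Import all_classical all_reals all_analysis.
From mathcomp Require Import zify.

Set Implicit Arguments.
Unset Strict Implicit.
Unset Printing Implicit Defensive.

Import Order.TTheory GRing.Theory Num.Theory.
Local Open Scope ring_scope.

(** * Randomized RAM

  Algorithms are programs of a structured random access machine with coin
  flips.  A program is a finite piece of syntax, so one program serves all
  inputs.  It manipulates natural numbers held in registers and in finitely
  many unbounded arrays.  The arithmetic instructions are those of the
  Cook-Reckhow RAM (addition, subtraction and comparison, no multiplication),
  and time is measured by the logarithmic cost criterion: every value that is
  read or computed is charged its number of bits.  Hence nothing can be gained
  by packing data into large integers, and the cost agrees up to polylog n
  factors with that of a word RAM with words of O(log n) bits. *)

Inductive expr : Type :=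
| Cst of nat
| Reg of nat
| Arr of nat & expr
| Add of expr & expr
| Sub of expr & expr
| Leq of expr & expr.

Inductive cmd : Type :=
| Skip
| Assign of nat & expr          (* register := expression *)
| Store of nat & expr & expr    (* array[index] := expression *)
| Flip of nat                   (* register := fair coin *)
| Seq of cmd & cmd
| If of expr & cmd & cmd
| While of expr & cmd.

(* [pos] is the number of coins flipped so far. *)
Record state : Type := State {
  reg : nat -> nat;
  arr : nat -> nat -> nat;
  pos : nat }.

Definition upd (T : Type) (f : nat -> T) (x : nat) (v : T) : nat -> T :=
  fun y => if y == x then v else f y.

Definition set_reg (st : state) (x v : nat) : state :=
  State (upd (reg st) x v) (arr st) (pos st).

Definition set_arr (st : state) (a i v : nat) : state :=
  State (reg st) (upd (arr st) a (upd (arr st a) i v)) (pos st).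

Definition next_coin (st : state) : state :=
  State (reg st) (arr st) (pos st).+1.

(* Number of bits of [m]; zero occupies one bit. *)
Definition bits (m : nat) : nat := (trunc_log 2 m).+1.

Fixpoint eval (st : state) (e : expr) : nat :=
  match e with
  | Cst m => m
  | Reg x => reg st x
  | Arr a e1 => arr st a (eval st e1)
  | Add e1 e2 => (eval st e1 + eval st e2)%N
  | Sub e1 e2 => (eval st e1 - eval st e2)%N
  | Leq e1 e2 => (eval st e1 <= eval st e2)%N : nat
  end.

Fixpoint ecost (st : state) (e : expr) : nat :=
  (bits (eval st e) +
   match e with
   | Cst _ | Reg _ => 0
   | Arr _ e1 => ecost st e1
   | Add e1 e2 | Sub e1 e2 | Leq e1 e2 => ecost st e1 + ecost st e2
   end)%N.

(* [exec w p st st' t]: with coin sequence [w], the program [p] started in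
   [st] halts in [st'] at cost [t]; a guard is true when it is nonzero. *)
Inductive exec (w : nat -> bool) : cmd -> state -> state -> nat -> Prop :=
| ExecSkip st : exec w Skip st st 1
| ExecAssign st x e :
    exec w (Assign x e) st (set_reg st x (eval st e)) (ecost st e).+1
| ExecStore st a e1 e2 :
    exec w (Store a e1 e2) st (set_arr st a (eval st e1) (eval st e2))
      (ecost st e1 + ecost st e2).+1
| ExecFlip st x :
    exec w (Flip x) st (next_coin (set_reg st x (w (pos st)))) 1
| ExecSeq p q st st1 st2 t1 t2 :
    exec w p st st1 t1 -> exec w q st1 st2 t2 ->
    exec w (Seq p q) st st2 (t1 + t2)
| ExecIfTrue e p q st st1 t1 :
    eval st e != 0%N -> exec w p st st1 t1 ->
    exec w (If e p q) st st1 (ecost st e + t1).+1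
| ExecIfFalse e p q st st1 t1 :
    eval st e = 0%N -> exec w q st st1 t1 ->
    exec w (If e p q) st st1 (ecost st e + t1).+1
| ExecWhileFalse e p st :
    eval st e = 0%N -> exec w (While e p) st st (ecost st e).+1
| ExecWhileTrue e p st st1 st2 t1 t2 :
    eval st e != 0%N -> exec w p st st1 t1 -> exec w (While e p) st1 st2 t2 ->
    exec w (While e p) st st2 (ecost st e + t1 + t2).+1.

(* For a fixed coin sequence a program has at most one outcome. *)
Lemma exec_det w p st st1 st2 t1 t2 :
  exec w p st st1 t1 -> exec w p st st2 t2 -> st1 = st2 /\ t1 = t2.
Proof.
move=> H; elim: H st2 t2 => {p st st1 t1};
  intros; match goal with H : exec _ _ _ ?x ?y |- _ = ?x /\ _ = ?y =>
    inversion H; subst; clear H end;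
  repeat match goal with
  | N : is_true (?a != 0%N), Z : ?a = 0%N |- _ => by rewrite Z in N
  | IH : forall _ _, exec _ ?p ?s _ _ -> _, H : exec _ ?p ?s _ _ |- _ =>
      case: (IH _ _ H) => ? ?; subst; clear IH
  end; by [].
Qed.

(* A run of cost [t] flips at most [t] coins. *)
Lemma exec_pos w p st st' t :
  exec w p st st' t -> (pos st <= pos st' <= pos st + t)%N.
Proof.
elim=> {p st st' t} /=; lia.
Qed.

(* Only the first [T] coins matter to runs of cost at most [T], so for events
   determined by such runs this is the probability under independent fair
   coins. *)
Definition prob (R : realType) (T : nat) (P : (nat -> bool) -> Prop) : R :=
  #|[set u : T.-tuple bool | `[< P (nth false u) >]]|%:R / 2 ^+ T.

(** * Graphs, input and output *)

(* Infinite when no path joins [s] to [t]. *)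
Definition dist (R : realType) (n : nat) (E : rel 'I_n) (s t : 'I_n) : \bar R :=
  ereal_inf [set ((size q)%:R : R)%:E
            | q in [set q : seq 'I_n | path E s q /\ last s q = t]]%classic.

(* Register 0 holds [n]; array 0 holds the adjacency matrix, row by row; array 1
   holds the binary digits of [k], least significant first, one per cell (so
   that a very large [k] need not be read in full).  All else is zero. *)
Definition input (n : nat) (E : rel 'I_n) (k : nat) : state :=
  {| reg := upd (fun=> 0%N) 0 n;
     arr := fun a x =>
       match a with
       | 0 => [exists i : 'I_n, exists j : 'I_n,
                 (x == i * n + j)%N && E i j] : nat
       | 1 => odd (k %/ 2 ^ x)%N : nat
       | _ => 0%N
       end;
     pos := 0 |}.

(* The estimates are read off array 2, row by row; [0] encodes infinity and
   [v.+1] encodes [v]. *)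
Definition est (R : realType) (n : nat) (st : state) (s t : 'I_n) : \bar R :=
  if arr st 2 (s * n + t)%N is v.+1 then (v%:R : R)%:E else +oo%E.

(* Main.v *)
(* The algorithm is deterministic.  Let [l] be the binary length of [n] and let [q]
   be [l / k] rounded up.  Each vertex [u] receives a level [lev u < l] such that
   the sum of [2 ^ lev u] is O(n l).  For every [x < l], a greedy packing of disjoint
   neighbourhoods of vertices of degree at least [2 ^ x] yields at most [n / 2 ^ x]
   centers; they get level at least [x], and every vertex of degree at least [2 ^ x]
   is within distance 2 of one of them.  Around each center a ball of radius [rho] is
   explored until [2 ^ zlev l x] vertices are found.  Either the whole ball is found
   and its search tree is linked on level [x], or the center is near a vertex of level
   [zlev l x], because such full balls are again packed greedily.  Moreover, for every
   [x] a breadth-first search forest from the vertices of level at least [x] is linked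
   on level 0.  The estimates are found by a breadth-first search on pairs: from [(u, v)]
   it moves to [(u, b)] and [(b, u)] if the edge [vb] is linked on a level at most
   [lev u] or [deg v < 2 ^ (lev u + q)].  A vertex of level [y] uses O(n 2 ^ y (2 ^ q + l))
   edges, so that the time is O(n ^ 2 2 ^ q) up to logarithms, and [2 ^ q <= 2 n ^ (1 / k)].

   Suppose that the estimate for the ends of a walk of length [d] exceeds [2 d].  A vertex
   of largest degree on the walk must then be close to the midpoint.  If some vertex at
   least [i] steps beyond the midpoint has degree at least [2 ^ x], then the detour
   through a pivot of level [x] near the other end is cheap enough unless there is a vertex
   of degree at least [2 ^ (x + q)] at least [i - O(1)] steps from the midpoint on the
   other side.  Going back and forth, [x] can be raised to the maximum of [x + q] and
   [zlev l x] at the cost of O(1) in [i].  Since [x] doubles up to [l / 3] and then [l - x]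
   is halved, O(log k) rounds reach [x = l], although all degrees are below [2 ^ l]. *)

From mathcomp Require Import all_boot all_order all_algebra.
From mathcomp Require Import all_classical all_reals all_analysis.
From mathcomp Require Import zify ring lra.
Require Import Defs.

Set Implicit Arguments.
Unset Strict Implicit.
Unset Printing Implicit Defensive.

(** * Programs with time bounds *)

(** A root [u] of low level near [v 0] is blocked by the heavy vertices around the midpoint. What
    helps is the peak: its root has a level that admits every edge of the walk and, as estimates are
    symmetric, it can carry the pair with [u] across the first half. Ending at position [h + i] then
    costs about [3 * i] beyond the midpoint instead of [i]. The loss of [2 * i] is repaid if the
    pivot comes from a vertex [i + O(1)] steps before the midpoint, so only degrees beyond [h + i]
    can still stop [u]. The minimum in [zlev] reflects two budgets. The bound [2 * x] limits an
    explored ball to [2 ^ x * 2 ^ x] vertices, hence to a number of links that the at least [2 ^ x]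
    marked neighbours of the center can pay for at [O(2 ^ x)] each. The bound [(l + x) / 2] limits
    the time, which is quadratic in the size of the ball. Since cost is logarithmic, a time bound
    needs a bound on all stored values. Every triple therefore preserves a bound [V], cubic in [n],
    and [k] itself, which may be huge, is never computed. *)

Fixpoint esize (e : expr) : nat :=
  match e with
  | Cst _ | Reg _ => 1
  | Arr _ e1 => (esize e1).+1
  | Add e1 e2 | Sub e1 e2 | Leq e1 e2 => (esize e1 + esize e2).+1
  end.

Fixpoint emax (e : expr) : nat :=
  match e with
  | Cst m => m
  | Reg _ => 0
  | Arr _ e1 => emax e1
  | Add e1 e2 | Sub e1 e2 | Leq e1 e2 => maxn (emax e1) (emax e2)
  end.

(** Values of such expressions are at most [32 * V], so that one instruction costs a constant times
    [bits (32 * V)]. The number 32 is just a generous bound for the programs below. *)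
Definition small (e : expr) : bool := (esize e <= 32) && (emax e <= 32).

Fixpoint rw (c : cmd) : seq nat :=
  match c with
  | Skip | Store _ _ _ => [::]
  | Assign x _ | Flip x => [:: x]
  | Seq p q | If _ p q => rw p ++ rw q
  | While _ p => rw p
  end.

Fixpoint aw (c : cmd) : seq nat :=
  match c with
  | Skip | Assign _ _ | Flip _ => [::]
  | Store a _ _ => [:: a]
  | Seq p q | If _ p q => aw p ++ aw q
  | While _ p => aw p
  end.

(** This is read off the syntax of [c], so that invariants and postconditions only speak of what a
    program really changes. *)
Definition frame (c : cmd) (st st' : state) : Prop :=
  (forall r, r \notin rw c -> reg st' r = reg st r) /\
  (forall a, a \notin aw c -> arr st' a = arr st a).

Lemma frame_refl c st : frame c st st.
Proof. by []. Qed.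

Lemma frame_trans c st1 st2 st3 :
  frame c st1 st2 -> frame c st2 st3 -> frame c st1 st3.
Proof.
by move=> [h1 h2] [h3 h4]; split=> i hi; rewrite ?h3 ?h4 ?h1 ?h2.
Qed.

Lemma exec_frame w c st st' t : exec w c st st' t -> frame c st st'.
Proof.
elim=> {c st st' t} //.
- move=> st x e; split=> // r /=; rewrite inE /upd => /negPf h.
  by rewrite h.
- move=> st a e1 e2; split=> // r /=; rewrite inE /upd => /negPf h.
  by rewrite h.
- move=> st x; split=> // r /=; rewrite inE /upd => /negPf h.
  by rewrite h.
- move=> p q st st1 st2 t1 t2 _ [h1 h2] _ [h3 h4].
  split=> i /=; rewrite mem_cat negb_or => /andP[a b].
    by rewrite h3 // h1.
  by rewrite h4 // h2.
- move=> e p q st st1 t1 _ _ [h1 h2].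
  by split=> i /=; rewrite mem_cat negb_or => /andP[a b]; rewrite ?h1 ?h2.
- move=> e p q st st1 t1 _ _ [h1 h2].
  by split=> i /=; rewrite mem_cat negb_or => /andP[a b]; rewrite ?h1 ?h2.
- move=> e p st st1 st2 t1 t2 _ _ [h1 h2] _ [h3 h4].
  by split=> i /= hi; rewrite ?h3 ?h4 ?h1 ?h2.
Qed.

Definition bnd (V : nat) (st : state) : Prop :=
  (forall r, reg st r <= V) /\ (forall a i, arr st a i <= V).

Lemma eval_le V st e : 32 <= V -> emax e <= 32 -> bnd V st ->
  eval st e <= esize e * V.
Proof.
move=> hV + [hr ha]; elim: e => [m|x|a e IH|e1 IH1 e2 IH2|e1 IH1 e2 IH2|e1 IH1 e2 IH2] /=.
- lia.
- by move=> _; rewrite mul1n.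
- by move=> _; apply: leq_trans (ha _ _) _; rewrite leq_pmull.
- by rewrite geq_max => /andP[/IH1 h1 /IH2 h2]; rewrite mulSn mulnDl; lia.
- by rewrite geq_max => /andP[/IH1 h1 /IH2 h2]; rewrite mulSn mulnDl; lia.
- by rewrite geq_max => /andP[/IH1 h1 /IH2 h2]; rewrite mulSn mulnDl; case: (eval st e1 <= _); lia.
Qed.

Lemma bits_le m p : m <= p -> bits m <= bits p.
Proof. by move=> h; rewrite /bits ltnS leq_trunc_log. Qed.

Lemma ecost_le V st e : 32 <= V -> emax e <= 32 -> bnd V st ->
  forall S, esize e <= S -> ecost st e <= esize e * bits (S * V).
Proof.
move=> hV he hb S hS.
have key e' : emax e' <= 32 -> esize e' <= S -> bits (eval st e') <= bits (S * V).
  move=> h1 h2; apply: bits_le; apply: leq_trans (eval_le hV h1 hb) _.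
  by rewrite leq_mul2r h2 orbT.
elim: e he hS => [m|x|a e IH|e1 IH1 e2 IH2|e1 IH1 e2 IH2|e1 IH1 e2 IH2] /= he hS.
- by rewrite mul1n addn0 (key (Cst m)).
- by rewrite mul1n addn0 (key (Reg x)).
- by rewrite mulSn leq_add ?(key (Arr a e)) // IH // ltnW.
- move: (he); rewrite geq_max => /andP[h1 h2].
  rewrite mulSn mulnDl !leq_add ?(key (Add e1 e2)) ?IH1 ?IH2 //; lia.
- move: (he); rewrite geq_max => /andP[h1 h2].
  rewrite mulSn mulnDl !leq_add ?(key (Sub e1 e2)) ?IH1 ?IH2 //; lia.
- move: (he); rewrite geq_max => /andP[h1 h2].
  rewrite mulSn mulnDl !leq_add ?(key (Leq e1 e2)) ?IH1 ?IH2 //; lia.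
Qed.

(* Bounds the cost of one instruction whose expressions are [small], as long as
   all stored values are at most [V]. *)
Definition ucost (V : nat) : nat := (64 * bits (32 * V)).+1.

Lemma small_cost V st e : 32 <= V -> small e -> bnd V st ->
  ecost st e <= 32 * bits (32 * V).
Proof.
move=> hV /andP[h1 h2] hb; apply: leq_trans (ecost_le hV h2 hb h1) _.
by rewrite leq_mul2r h1 orbT.
Qed.

(* Total-correctness triple for runs of cost at most [k] units that keep all
   stored values at most [V]; no program below flips coins, so the coin
   sequence is irrelevant. *)
Definition tri (V : nat) (c : cmd) (k : nat) (R : state -> Prop) (st : state) :=
  bnd V st -> exists st' t,
    [/\ forall w, exec w c st st' t, t <= k * ucost V, bnd V st' & R st'].

Section Rules.
Variables (V : nat) (hV : 32 <= V).
Local Notation tri := (tri V).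

Lemma tri_weak c k k' (R R' : state -> Prop) st :
  tri c k R st -> k <= k' ->
  (forall st', frame c st st' -> R st' -> R' st') -> tri c k' R' st.
Proof.
move=> h hk hR hb; have [st' [t [h1 h2 h3 h4]]] := h hb.
exists st', t; split=> //; first by apply: leq_trans h2 _; rewrite leq_mul2r hk orbT.
by apply: hR => //; apply: exec_frame (h1 xpred0).
Qed.

Lemma tri_skip k (R : state -> Prop) st : 0 < k -> R st -> tri Skip k R st.
Proof.
move=> hk hR hb; exists st, 1; split=> //; first by move=> w; constructor.
by rewrite muln_gt0 hk.
Qed.

Lemma bnd_set_reg st x v : bnd V st -> v <= V -> bnd V (set_reg st x v).
Proof. by move=> [h1 h2] hv; split=> //= r; rewrite /upd; case: ifP. Qed.

Lemma bnd_set_arr st a i v : bnd V st -> v <= V -> bnd V (set_arr st a i v).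
Proof.
move=> [h1 h2] hv; split=> //= b j; rewrite /upd.
by case: eqP => // _; case: ifP.
Qed.

Lemma tri_assign x e k (R : state -> Prop) st : small e -> 0 < k ->
  (bnd V st -> eval st e <= V) ->
  (bnd V st -> R (set_reg st x (eval st e))) -> tri (Assign x e) k R st.
Proof.
move=> he hk hv hR hb; exists (set_reg st x (eval st e)), (ecost st e).+1; split=> //.
- by move=> w; constructor.
- by have := small_cost hV he hb; rewrite /ucost; nia.
- by apply: bnd_set_reg => //; apply: hv.
- exact: hR.
Qed.

Lemma tri_store a e1 e2 k (R : state -> Prop) st : small e1 -> small e2 -> 0 < k ->
  (bnd V st -> eval st e2 <= V) ->
  (bnd V st -> R (set_arr st a (eval st e1) (eval st e2))) ->
  tri (Store a e1 e2) k R st.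
Proof.
move=> h1 h2 hk hv hR hb.
exists (set_arr st a (eval st e1) (eval st e2)), (ecost st e1 + ecost st e2).+1; split=> //.
- by move=> w; constructor.
- by have := small_cost hV h1 hb; have := small_cost hV h2 hb; rewrite /ucost; nia.
- by apply: bnd_set_arr => //; apply: hv.
- exact: hR.
Qed.

Lemma tri_seq p q k1 k2 k (R : state -> Prop) st :
  tri p k1 (fun st1 => frame p st st1 -> tri q k2 R st1) st -> k1 + k2 <= k ->
  tri (Seq p q) k R st.
Proof.
move=> hp hk hb; have [st1 [t1 [h1 h2 h3 h4]]] := hp hb.
have [st2 [t2 [h5 h6 h7 h8]]] := h4 (exec_frame (h1 xpred0)) h3.
exists st2, (t1 + t2); split=> //; first by move=> w; apply: ExecSeq (h1 w) (h5 w).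
by apply: leq_trans (leq_add h2 h6) _; rewrite -mulnDl leq_mul2r hk orbT.
Qed.

Lemma tri_if e p q k (R : state -> Prop) st : small e -> 0 < k ->
  (eval st e <> 0 -> tri p k.-1 R st) -> (eval st e = 0 -> tri q k.-1 R st) ->
  tri (If e p q) k R st.
Proof.
case: k => // k he _ hp hq hb /=.
have hc := small_cost hV he hb.
case: (eqVneq (eval st e) 0) => h.
  have [st1 [t1 [h1 h2 h3 h4]]] := hq h hb.
  exists st1, (ecost st e + t1).+1; split=> //; first by move=> w; apply: ExecIfFalse.
  by move: h2 hc; rewrite /= /ucost; nia.
have [st1 [t1 [h1 h2 h3 h4]]] := hp (elimN eqP h) hb.
exists st1, (ecost st e + t1).+1; split=> //; first by move=> w; apply: ExecIfTrue.
by move: h2 hc; rewrite /= /ucost; nia.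
Qed.

(** The potential bounds the remaining cost and so proves termination as well. Its strict decrease
    pays one unit for each successful test, and the strict bound [phi st < k] pays for the last
    one. *)
Lemma tri_while e p (I : state -> Prop) (phi : state -> nat) k (R : state -> Prop) st :
  small e -> I st -> phi st < k ->
  (forall st1, frame p st st1 -> bnd V st1 -> I st1 -> eval st1 e <> 0 ->
    exists k1, tri p k1 (fun st2 => frame p st st2 -> I st2 /\ k1 + phi st2 < phi st1) st1) ->
  (forall st1, frame p st st1 -> bnd V st1 -> I st1 -> eval st1 e = 0 -> R st1) ->
  tri (While e p) k R st.
Proof.
move=> he hI hk hb hR hbnd.
suff: forall m st1, phi st1 <= m -> I st1 -> frame p st st1 -> bnd V st1 ->
    exists st2 t, [/\ forall w, exec w (While e p) st1 st2 t,
      t <= (phi st1).+1 * ucost V, bnd V st2 & R st2].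
  move=> /(_ _ st (leqnn _) hI (frame_refl _ _) hbnd) [st2 [t [h1 h2 h3 h4]]].
  by exists st2, t; split=> //; apply: leq_trans h2 _; rewrite leq_mul2r hk orbT.
elim=> [|m IH] st1 hm hI1 hf hb1; have hc := small_cost hV he hb1.
  case: (eqVneq (eval st1 e) 0) => h.
    exists st1, (ecost st1 e).+1; split=> //; last exact: hR.
      by move=> w; constructor.
    by move: hc; rewrite /ucost; nia.
  have [k1 hk1] := hb _ hf hb1 hI1 (elimN eqP h).
  have [st2 [t [h1 h2 h3 h4]]] := hk1 hb1.
  by case: (h4 (frame_trans hf (exec_frame (h1 xpred0)))) => _; rewrite leqn0 in hm; rewrite (eqP hm).
case: (eqVneq (eval st1 e) 0) => h.
  exists st1, (ecost st1 e).+1; split=> //; last exact: hR.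
    by move=> w; constructor.
  by move: hc; rewrite /ucost; nia.
have [k1 hk1] := hb _ hf hb1 hI1 (elimN eqP h).
have [st2 [t [h1 h2 h3 h4]]] := hk1 hb1.
have hf2 := frame_trans hf (exec_frame (h1 xpred0)).
have [hI2 hlt] := h4 hf2.
have [|st3 [t3 [h5 h6 h7 h8]]] := IH st2 _ hI2 hf2 h3.
  by rewrite -ltnS; apply: leq_trans hm; apply: leq_trans hlt; rewrite ltnS leq_addl.
exists st3, (ecost st1 e + t + t3).+1; split=> //.
  by move=> w; apply: ExecWhileTrue (h1 w) (h5 w).
by move: h2 h6 hc hlt; rewrite /ucost; nia.
Qed.

End Rules.

(** * Counted loops with amortized cost *)

Definition For (x : nat) (e : expr) (p : cmd) : cmd :=
  Seq (Assign x (Cst 0))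
    (While (Leq (Add (Reg x) (Cst 1)) e) (Seq p (Assign x (Add (Reg x) (Cst 1))))).

Section ForRules.
Variables (V : nat) (hV : 32 <= V).
Local Notation tri := (tri V).

(** A pass may cost more than [K] if it lowers [phi] accordingly. The frame of
    [Seq p (Assign x (Cst 0))] merely names what the loop may write. As the counter is incremented
    after the body, [I] and [phi] must not depend on the register [x]; the index is passed to [I]
    explicitly. *)
Lemma tri_for_pot x e p N K (I : nat -> state -> Prop) (phi : state -> nat) k
    (R : state -> Prop) st :
  small (Leq (Add (Reg x) (Cst 1)) e) -> N <= V ->
  (forall st1, frame (Seq p (Assign x (Cst 0))) st st1 -> eval st1 e = N) ->
  x \notin rw p ->
  I 0 (set_reg st x 0) ->
  N * (K + 2) + phi (set_reg st x 0) + 1 < k ->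
  (forall st1 st2, arr st1 = arr st2 -> (forall r, r != x -> reg st1 r = reg st2 r) ->
     phi st1 = phi st2 /\ forall i, I i st1 -> I i st2) ->
  (forall i st1, i < N -> frame (Seq p (Assign x (Cst 0))) st st1 -> bnd V st1 ->
     reg st1 x = i -> I i st1 ->
     exists k1, tri p k1 (fun st2 => frame p st1 st2 ->
       I i.+1 st2 /\ k1 + phi st2 <= K + phi st1) st1) ->
  (forall st1, frame (For x e p) st st1 -> bnd V st1 -> reg st1 x = N -> I N st1 -> R st1) ->
  tri (For x e p) k R st.
Proof.
move=> hs hNV hN hx hI0 hk hphi hbody hR.
have hfr0 : frame (Seq p (Assign x (Cst 0))) st (set_reg st x 0).
  split=> //= r; rewrite mem_cat negb_or inE => /andP[_ /negPf h].
  by rewrite /upd h.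
apply: (tri_seq (k1 := 1) (k2 := k.-1)); last lia.
apply: tri_assign => // _ _ /=.
set b := Seq p _.
apply: (@tri_while V hV _ _ (fun st1 => [/\ reg st1 x <= N & I (reg st1 x) st1])
  (fun st1 => (N - reg st1 x) * (K + 2) + phi st1)) => //=.
- by rewrite /upd eqxx.
- by rewrite /upd eqxx subn0; lia.
- move=> st1 hf hb1 [h1 h2].
  have hf' : frame (Seq p (Assign x (Cst 0))) st st1.
    by apply: frame_trans hfr0 _.
  rewrite hN // addn1; case: ltnP => // hlt _.
  have [k1 hk1] := hbody _ _ hlt hf' hb1 erefl h2.
  exists k1.+1; apply: (tri_seq (k1 := k1) (k2 := 1)); last lia.
  apply: tri_weak hk1 _ _ => // st2 hf2 hR2 _.
  have hxx : reg st2 x = reg st1 x by apply: hf2.1.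
  apply: tri_assign => //=; first by move=> _; rewrite hxx; lia.
  move=> _ _; rewrite hxx addn1.
  have [h3 h4] := hR2 hf2.
  have [||h5 h6] := hphi st2 (set_reg st2 x (reg st1 x).+1).
    by [].
    by move=> r /= /negPf hr; rewrite /upd hr.
  rewrite /upd eqxx; split; first by split=> //; apply: h6.
  by rewrite -h5; nia.
- move=> st1 hf hb1 [h1 h2].
  have hf' : frame (Seq p (Assign x (Cst 0))) st st1 by apply: frame_trans hfr0 _.
  rewrite hN // addn1; case: ltnP => // hge _.
  have hxN : reg st1 x = N by lia.
  rewrite -{1}hxN in hR; apply: hR => //; last by rewrite -hxN.
  split=> r hr.
    by apply: hf'.1; move: hr; rewrite /= !inE !mem_cat !inE; do 3 case: (_ == _) => //=; case: (_ \in _).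
  by apply: hf'.2; move: hr; rewrite /= !mem_cat.
Qed.

Lemma tri_for x e p N K (I : nat -> state -> Prop) k (R : state -> Prop) st :
  small (Leq (Add (Reg x) (Cst 1)) e) -> N <= V ->
  (forall st1, frame (Seq p (Assign x (Cst 0))) st st1 -> eval st1 e = N) ->
  x \notin rw p ->
  I 0 (set_reg st x 0) ->
  N * (K + 2) + 1 < k ->
  (forall st1 st2, arr st1 = arr st2 -> (forall r, r != x -> reg st1 r = reg st2 r) ->
     forall i, I i st1 -> I i st2) ->
  (forall i st1, i < N -> frame (Seq p (Assign x (Cst 0))) st st1 -> bnd V st1 ->
     reg st1 x = i -> I i st1 ->
     tri p K (fun st2 => frame p st1 st2 -> I i.+1 st2) st1) ->
  (forall st1, frame (For x e p) st st1 -> bnd V st1 -> reg st1 x = N -> I N st1 -> R st1) ->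
  tri (For x e p) k R st.
Proof.
move=> hs hNV hN hx hI0 hk hI hbody hR.
apply: (tri_for_pot (N := N) (K := K) (I := I) (phi := fun=> 0)) => //.
- by rewrite addn0.
- by move=> *; split=> // i; apply: hI.
- move=> i st1 h1 h2 h3 h4 h5; exists K.
  by apply: tri_weak (hbody i st1 h1 h2 h3 h4 h5) _ _ => // st2 hf h _; rewrite addn0; split=> //; apply: h.
Qed.

End ForRules.

(** * Stretch of the estimates *)

(** The left alternative allows shorter walks, so [wlk e m] is the relation of being at distance at
    most [m]. *)
Fixpoint wlk (e : rel nat) (m x y : nat) : Prop :=
  match m with
  | 0 => x = y
  | m'.+1 => wlk e m' x y \/ exists2 z, wlk e m' x z & e z y
  end.

Lemma wlk_mono e m m' x y : m <= m' -> wlk e m x y -> wlk e m' x y.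
Proof.
elim: m' => [|m' IH]; first by rewrite leqn0 => /eqP ->.
by rewrite leq_eqVlt => /orP[/eqP -> //|h1 h2]; left; apply: IH.
Qed.

Lemma wlkxx e m x : wlk e m x x.
Proof. exact: (@wlk_mono e 0). Qed.

Lemma wlk_trans e m1 m2 x y z : wlk e m1 x y -> wlk e m2 y z -> wlk e (m1 + m2) x z.
Proof.
move=> h; elim: m2 z => [|m2 IH] z /=; first by rewrite addn0 => <-.
rewrite addnS /= => -[/IH|[u /IH hu hz]]; first by left.
by right; exists u.
Qed.

Lemma wlk1 (e : rel nat) x y : e x y -> wlk e 1 x y.
Proof. by move=> h; right; exists x. Qed.

Lemma wlk_sym (e : rel nat) m x y : symmetric e -> wlk e m x y -> wlk e m y x.
Proof.
move=> he; elim: m y => [|m IH] y //= [/IH|[z /IH hz ezy]]; first by left.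
by apply: (@wlk_trans e 1 m y z x) => //; apply: wlk1; rewrite he.
Qed.

Lemma wlk_sub (e e' : rel nat) m x y : (forall x y, e x y -> e' x y) ->
  wlk e m x y -> wlk e' m x y.
Proof.
move=> he; elim: m y => //= m IH y [/IH|[z /IH hz /he ezy]]; first by left.
by right; exists z.
Qed.

Definition deg (n : nat) (e : rel nat) (v : nat) : nat := count (e v) (iota 0 n).

(* Thresholds of the form [2 ^ zlev l x] satisfy [2 ^ (2 * zlev l x) <= 2 ^ (l + x)],
   which pays for exploring balls of that size around the [n / 2 ^ x] centers. *)
Definition zlev (l x : nat) : nat := minn (2 * x) ((l + x) %/ 2).

(** The last estimate in [climb] closes when [35 <= 2 * rho], and 18 is the least such radius. The
    50 steps lost in a round are [2 * rho + 14]. *)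
Definition rho := 18.

(* The closure properties of the estimates computed by the algorithm:
   [TT m u v] means that the estimate of the pair [(u, v)] is at most [m]. *)
Record closed (n l q : nat) (e : rel nat) (lev : nat -> nat)
    (W : nat -> rel nat) (TT : nat -> nat -> nat -> Prop) : Prop := Closed {
  cl_refl : forall a, a < n -> TT 0 a a;
  cl_sym : forall m u v, TT m u v -> TT m v u;
  cl_mono : forall m m' u v, m <= m' -> TT m u v -> TT m' u v;
  cl_step : forall m u b b', TT m u b -> W (lev u) b b' -> TT m.+1 u b';
  cl_Wmono : forall x y b b', x <= y -> W x b b' -> W y b b';
  cl_Wlight : forall x b b', e b b' -> deg n e b < 2 ^ (x + q) -> W x b b';
  cl_Wforest : forall x s a r, a < n -> x <= lev a -> wlk e r s a ->
    exists p, [/\ x <= lev p, wlk (W 0) r s p & wlk (W 0) r p s];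
  cl_pivot : forall x v, v < n -> 2 ^ x <= deg n e v ->
    exists w, [/\ w < n, x <= lev w, wlk e 2 v w &
      (exists w', [/\ w' < n, zlev l x <= lev w' & wlk e (2 * rho) w w']) \/
      (forall m v', m <= rho -> wlk e m w v' -> wlk (W x) m w v' /\ wlk (W x) m v' w)] }.

Section Core.

Variables (n l q : nat) (e : rel nat) (lev : nat -> nat).
Variables (W : nat -> rel nat) (TT : nat -> nat -> nat -> Prop).
Hypothesis (C : closed n l q e lev W TT) (q_gt0 : 0 < q) (esym : symmetric e).
Hypothesis (elt : forall i j, e i j -> i < n /\ j < n) (nl : n < 2 ^ l).

Lemma TT_wlk m r u b b' x : x <= lev u -> TT m u b -> wlk (W x) r b b' -> TT (m + r) u b'.
Proof.
move=> hx hm; elim: r b' => [|r IH] b' /=; first by rewrite addn0 => <-.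
rewrite addnS => -[/IH|[z /IH hz hw]]; first by apply: (cl_mono C).
by apply: (cl_step C) hz _; apply: (cl_Wmono C) hw.
Qed.

Lemma deg_lt v : deg n e v < 2 ^ l.
Proof. by apply: leq_ltn_trans nl; rewrite -[X in _ <= X](size_iota 0) count_size. Qed.

(* [h] is a midpoint of the walk [v]; the statement is symmetric under reversal. *)
Definition walk (d h : nat) (v : nat -> nat) :=
  [/\ 0 < d, forall i, i < d -> e (v i) (v i.+1), d <= 2 * h + 1, 2 * h <= d + 1 & h <= d].

Definition hR (d h : nat) (v : nat -> nat) (i x : nat) :=
  exists j, [/\ h + i <= j, j <= d & 2 ^ x <= deg n e (v j)].
Definition hL (h : nat) (v : nat -> nat) (i x : nat) :=
  exists j, j + i <= h /\ 2 ^ x <= deg n e (v j).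
Definition far (d : nat) (v : nat -> nat) := ~ TT (2 * d) (v 0) (v d).

Definition rv (d : nat) (v : nat -> nat) (i : nat) := v (d - i).

Lemma walk_rv d h v : walk d h v -> walk d (d - h) (rv d v).
Proof.
move=> [h0 h1 h2 h3 h4]; split=> //; try lia.
move=> i hi; rewrite /rv esym (_ : d - i = (d - i.+1).+1); last lia.
by apply: h1; lia.
Qed.

Lemma far_rv d v : far d v -> far d (rv d v).
Proof. by move=> h h'; apply: h; apply: (cl_sym C); move: h'; rewrite /rv subn0 subnn. Qed.

Lemma hR_rv d h v i x : h <= d -> hR d (d - h) (rv d v) i x -> hL h v i x.
Proof. by move=> hh [j [h1 h1' h2]]; exists (d - j); split=> //; lia. Qed.

Lemma rR_hv d h v i x : h <= d -> hR d h v i x -> hL (d - h) (rv d v) i x.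
Proof.
move=> hh [j [h1 h1' h2]]; exists (d - j); split=> //; try lia.
by rewrite /rv subKn //; lia.
Qed.

Lemma hR_mono d h v i i' x x' : hR d h v i x -> i' <= i -> x' <= x -> hR d h v i' x'.
Proof.
move=> [j [h1 h2 h3]] hi hx; exists j; split=> //; try lia.
by apply: leq_trans h3; rewrite leq_exp2l.
Qed.

(** * Detours through a pivot on a fixed walk *)

Section Walk.
Variables (d h : nat) (v : nat -> nat).
Hypothesis (Hw : walk d h v).

Lemma walk_lt i : i <= d -> v i < n.
Proof.
case: Hw => h0 h1 _ _ _; rewrite leq_eqVlt => /orP[/eqP -> {i}|/h1/elt[]//].
by have /elt[] := h1 d.-1 ltac:(lia); rewrite prednK.
Qed.

Lemma walk_fwd i j : i <= j -> j <= d -> wlk e (j - i) (v i) (v j).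
Proof.
case: Hw => _ h1 _ _ _ hij; elim: j hij => [|j IH] hij hj.
  by move: hij; rewrite leqn0 => /eqP ->; rewrite subnn.
move: hij; rewrite leq_eqVlt => /orP[/eqP ->|hij]; first by rewrite subnn.
rewrite subSn //; right; exists (v j); last exact: h1.
by apply: IH => //; lia.
Qed.

Lemma walk_W x i j : i <= j -> j <= d ->
  (forall t, i <= t -> t < j -> deg n e (v t) < 2 ^ (x + q)) -> wlk (W x) (j - i) (v i) (v j).
Proof.
case: Hw => _ h1 _ _ _ hij; elim: j hij => [|j IH] hij hj hd.
  by move: hij; rewrite leqn0 => /eqP ->; rewrite subnn.
move: hij; rewrite leq_eqVlt => /orP[/eqP ->|hij]; first by rewrite subnn.
rewrite subSn //; right; exists (v j).
  by apply: IH => [||t]; [lia|lia|move=> ? ?; apply: hd; lia].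
by apply: (cl_Wlight C); [apply: h1|apply: hd; lia].
Qed.

Lemma walk_Wback x i j : i <= j -> j <= d ->
  (forall t, i < t -> t <= j -> deg n e (v t) < 2 ^ (x + q)) -> wlk (W x) (j - i) (v j) (v i).
Proof.
case: Hw => _ h1 _ _ _ hij hj.
have [m hm] : {m | m = j - i} by exists (j - i).
elim: m i hm hij => [|m IH] i hm hij hd.
  have -> : i = j by lia.
  by rewrite subnn.
rewrite -hm; right; exists (v i.+1).
  by rewrite (_ : m = j - i.+1); [apply: IH; [lia|lia|move=> t ? ?; apply: hd; lia]|lia].
by apply: (cl_Wlight C); [rewrite esym; apply: h1; lia|apply: hd; lia].
Qed.

(* A pivot near the start extends an estimate by twice its distance. *)
Lemma via_pivot x r a : a < n -> x <= lev a -> wlk e r (v 0) a ->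
  exists u, [/\ x <= lev u, TT r u (v 0), wlk (W 0) r (v 0) u &
    forall m t, TT m u t -> TT (m + r) (v 0) t].
Proof.
move=> ha hx hr; have [u [h1 h2 h3]] := cl_Wforest C ha hx hr.
exists u; split=> //.
  apply: (cl_sym C); rewrite -[r]add0n.
  apply: (TT_wlk (x := 0)) h2 => //; apply: (cl_refl C); exact: walk_lt.
by move=> m t ht; apply: (cl_sym C); apply: (TT_wlk (x := 0)) h3 => //; apply: (cl_sym C).
Qed.

Variables (X m : nat).
Hypothesis (HX : forall j, j <= d -> deg n e (v j) < 2 ^ X.+1).
Hypothesis (Hm : m <= d) (HXm : 2 ^ X <= deg n e (v m)).

Lemma light_max j : j <= d -> deg n e (v j) < 2 ^ (X + q).
Proof.
move=> /HX hj; apply: leq_trans hj _; rewrite leq_exp2l //; lia.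
Qed.

(** The root found for the peak's pivot can follow the whole walk, and it is at most [m + 2] steps
    from [v 0]. This distance is paid twice, which gives an estimate of at most [d + 2 * m + 4]. *)
Lemma peak_far_left : far d v -> d < 2 * m + 4.
Proof.
move=> hf; rewrite ltnNge; apply/negP => hle; apply: hf.
have [w [hw h1 h2 _]] := cl_pivot C (walk_lt Hm) HXm.
have hs : wlk e (m + 2) (v 0) w.
  by apply: wlk_trans h2; rewrite -[X in wlk e X]subn0; apply: walk_fwd.
have [u [h3 h4 h5 h6]] := via_pivot hw h1 hs.
have h7 : TT (m + 2 + (d - 0)) u (v d).
  by apply: TT_wlk h3 h4 _; apply: walk_W => // t _ /ltnW; apply: light_max.
by apply: (cl_mono C) (h6 _ _ h7); lia.
Qed.

Hypothesis (Hc : d < 2 * m + 4 /\ 2 * m < d + 4).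

(** The level of [u] is arbitrary here. From [v (h + i)] the search moves to the root [y] of the
    peak; with [y] fixed it returns from [v (h + i)] to [v 0] and goes on to [u]; with [u] fixed it
    moves from [y] back to [v (h + i)]. The bound adds up two trips of [i + 4], one of [h + i] and
    one of [r]. *)
Lemma base_cross u r i : wlk (W 0) r (v 0) u -> h + i <= d ->
  TT (r + h + 3 * i + 8) u (v (h + i)).
Proof.
move=> hu hi; have [_ _ h1 h2 _] := Hw.
have [w [hw hX hvw _]] := cl_pivot C (walk_lt Hm) HXm.
(* The peak is at most 2 steps from the midpoint, and its pivot is at most 2 further steps away. *)
have hs : wlk e (i + 4) (v (h + i)) w.
  apply: (@wlk_mono _ (maxn m (h + i) - minn m (h + i) + 2)); first lia.
  apply: wlk_trans hvw.
  case: (leqP m (h + i)) => hmi; last by apply: walk_fwd; lia.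
  by apply: wlk_sym => //; apply: walk_fwd.
have [y [h3 h4 h5]] := cl_Wforest C hw hX hs.
have t1 : TT (0 + (i + 4)) (v (h + i)) y.
  by apply: (TT_wlk (x := 0)) h4 => //; apply: (cl_refl C); apply: walk_lt.
have t2 : TT (0 + (i + 4) + (h + i - 0)) y (v 0).
  apply: TT_wlk h3 ((cl_sym C) _ _ _ t1) _; apply: walk_Wback => // t _ ht.
  by apply: light_max; lia.
have t3 := TT_wlk (leq0n _) t2 hu.
have t4 := TT_wlk (leq0n _) (cl_sym C t3) h5.
by apply: (cl_mono C) t4; lia.
Qed.

(** If all vertices beyond [h + i] were light for level [x], then [u] could finish the walk itself
    after [base_cross], and the total [d + 2 * r + 2 * i + 8] would be at most [2 * d]. *)
Lemma pivot_left x r a i : a < n -> x <= lev a -> wlk e r (v 0) a ->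
  2 * r + 2 * i + 8 <= d -> far d v -> hR d h v i (x + q).
Proof.
move=> ha hx hr hd hf; have [_ _ h1 h2 _] := Hw.
apply: boolp.contrapT => hn; apply: hf.
have hl t : h + i <= t -> t <= d -> deg n e (v t) < 2 ^ (x + q).
  by move=> h3 h4; rewrite ltnNge; apply/negP => h5; apply: hn; exists t.
have [u [h3 h4 h5 h6]] := via_pivot ha hx hr.
have hi : h + i <= d by lia.
have t1 := base_cross h5 hi.
have t2 : TT (r + h + 3 * i + 8 + (d - (h + i))) u (v d).
  by apply: TT_wlk h3 t1 _; apply: walk_W => // t h7 h8; apply: hl => //; lia.
by apply: (cl_mono C) (h6 _ _ t2); lia.
Qed.

(** The shift by 7 is what [pivot_left] needs for [r = j + 2]: from [j + i + 7 <= h] and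
    [2 * h <= d + 1] it follows that [2 * r + 2 * i + 8 <= d]. *)
Lemma heavy_left x i : hL h v (i + 7) x -> far d v -> hR d h v i (x + q).
Proof.
move=> [j [h1 h2]] hf; have [_ _ h3 h4 _] := Hw.
have hj : j <= d by lia.
have [w [hw hX hvw _]] := cl_pivot C (walk_lt hj) h2.
apply: (pivot_left (r := j + 2) hw hX) => //; last lia.
by apply: wlk_trans hvw; rewrite -[X in wlk e X]subn0; apply: walk_fwd.
Qed.

End Walk.

Section Mirror.
Variables (d h : nat) (v : nat -> nat).
Hypothesis (Hw : walk d h v) (Hf : far d v).

Lemma peak : exists X m, [/\ forall j, j <= d -> deg n e (v j) < 2 ^ X.+1, m <= d,
  2 ^ X <= deg n e (v m) & d < 2 * m + 4 /\ 2 * m < d + 4].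
Proof.
have [d0 he _ _ hd] := Hw.
pose P X := has (fun j => 2 ^ X <= deg n e (v j)) (iota 0 d.+1).
have [X /hasP[m hm1 hm2] hX] : exists2 X, P X & forall j, P j -> j <= X.
  have P0 : exists X, P X.
    exists 0; apply/hasP; exists 0; first by rewrite mem_iota.
    rewrite expn0 -has_count; apply/hasP; exists (v 1); last exact: he.
    by rewrite mem_iota; have /elt[] := he _ d0.
  have Pb X : P X -> X <= l.
    move=> /hasP[j _ hj]; rewrite -(leq_exp2l (m := 2)) //.
    by apply: leq_trans hj _; apply/ltnW/deg_lt.
  by exists (ex_maxn P0 Pb); case: ex_maxnP.
have {}hm1 : m <= d by move: hm1; rewrite mem_iota; lia.
have HX j : j <= d -> deg n e (v j) < 2 ^ X.+1.
  move=> hj; rewrite ltnNge; apply/negP => h1.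
  have /hX : P X.+1 by apply/hasP; exists j => //; rewrite mem_iota; lia.
  by rewrite ltnn.
exists X, m; split=> //; split; first exact: (peak_far_left Hw HX hm1 hm2 Hf).
have Hw' := walk_rv Hw.
have := peak_far_left (X := X) (m := d - m) Hw' _ _ _ (far_rv Hf).
rewrite /rv subKn // => /(_ _ _ hm2); move=> h1.
have : d < 2 * (d - m) + 4 by apply: h1; [move=> j hj; apply: HX; lia|lia].
lia.
Qed.

Lemma pivot_leftW x r a i : a < n -> x <= lev a -> wlk e r (v 0) a ->
  2 * r + 2 * i + 8 <= d -> hR d h v i (x + q).
Proof.
have [X [m [h1 h2 h3 h4]]] := peak; move=> h5 h6 h7 h8.
exact: (pivot_left Hw h1 h2 h3 h4 h5 h6 h7).
Qed.

Lemma heavy_leftW x i : hL h v (i + 7) x -> hR d h v i (x + q).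
Proof.
have [X [m [h1 h2 h3 h4]]] := peak; move=> h5.
exact: (heavy_left Hw h1 h2 h3 h4 h5).
Qed.

End Mirror.

(** * One round of the climb through the degree classes *)

Section Climb.
Variables (d h : nat) (v : nat -> nat).
Hypothesis (Hw : walk d h v) (Hf : far d v).

Lemma hd : h <= d. Proof. by case: Hw. Qed.

Lemma pivot_right x r a i : a < n -> x <= lev a -> wlk e r (v d) a ->
  2 * r + 2 * i + 8 <= d -> hL h v i (x + q).
Proof.
move=> h1 h2 h3 h4; apply: (hR_rv hd).
by apply: (pivot_leftW (walk_rv Hw) (far_rv Hf) h1 h2) h4; rewrite /rv subn0.
Qed.

Lemma heavy_right x i : hR d h v (i + 7) x -> hL h v i (x + q).
Proof.
move=> h1; apply: (hR_rv hd); apply: (heavy_leftW (walk_rv Hw) (far_rv Hf)).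
by apply: rR_hv => //; apply: hd.
Qed.

Lemma climb_light x i : 14 <= i -> hR d h v i x -> hR d h v (i - 14) (x + q).
Proof.
move=> hi h1.
have {}h1 : hR d h v (i - 7 + 7) x by apply: hR_mono h1 _ _; lia.
have := heavy_right h1; have -> : i - 7 = i - 14 + 7 by lia.
by move=> /(heavy_leftW Hw Hf) h3; apply: hR_mono h3 _ _; lia.
Qed.

Lemma climb x i : 50 <= i -> hR d h v i x ->
  hR d h v (i - 50) (maxn (x + q) (zlev l x)).
Proof.
move=> hi hx; have [d0 he hd1 hd2 hd3] := Hw.
case: (leqP (zlev l x) (x + q)) => hxz.
  by apply: hR_mono (climb_light _ hx) _ _; lia.
(* The argument is run with the top degree class [y] of the right part instead of [x]. Then the
   whole right part is light for level [y], and nothing is lost because [zlev l] is monotone. *)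
pose P y := has (fun j => 2 ^ y <= deg n e (v j)) (iota (h + i) (d + 1 - (h + i))).
have [y [hxy hy hymax]] : exists y, [/\ x <= y, P y & forall y', P y' -> y' <= y].
  have P0 : exists y, P y.
    exists x; case: hx => j [h1 h2 h3]; apply/hasP; exists j => //.
    by rewrite mem_iota; lia.
  have Pb y : P y -> y <= l.
    move=> /hasP[j _ hj]; rewrite -(leq_exp2l (m := 2)) //.
    by apply: leq_trans hj _; apply/ltnW/deg_lt.
  exists (ex_maxn P0 Pb); case: ex_maxnP => y hy hmax; split=> //; apply: hmax.
  case: hx => j [h1 h2 h3]; apply/hasP; exists j => //; rewrite mem_iota; lia.
have hz : zlev l x <= zlev l y by rewrite /zlev; lia.
move/hasP: hy => [j hj1 hj2].
have {hj1} [hj0 hj1] : h + i <= j /\ j <= d by move: hj1; rewrite mem_iota; lia.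
have hlight t : h + i <= t -> t <= d -> deg n e (v t) < 2 ^ (y + q).
  move=> h1 h2; apply: (@leq_trans (2 ^ y.+1)); last by rewrite leq_exp2l //; lia.
  rewrite ltnNge; apply/negP => h3.
  have /hymax : P y.+1 by apply/hasP; exists t => //; rewrite mem_iota; lia.
  by rewrite ltnn.
pose i1 := j - h.
have [w [hw hwy hvw [[w' [hw' hwz hww']]|hsmall]]] := cl_pivot C (walk_lt Hw hj1) hj2.
  (* Near a vertex of level [zlev l y] two crossings suffice: one to the left, losing [2 * rho + 7]
     steps, and one back to the right, losing 7 more. *)
  have hs : wlk e (d - j + 2 + 2 * rho) (v d) w'.
    apply: wlk_trans hww'; apply: wlk_trans hvw.
    by apply: wlk_sym => //; apply: (walk_fwd Hw).
  have h1 : hL h v (i1 - 50 + 7) (zlev l y + q).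
    by apply: (pivot_right hw' hwz hs); rewrite /rho /i1; lia.
  by apply: hR_mono (heavy_leftW Hw Hf h1) _ _; rewrite /i1; lia.
(* Now the ball around [w] is linked on level [y]. A root of level at least [y] near [v 0] exists
   because the heavy vertex [v j] forces one on the left side. *)
exfalso; apply: Hf.
have hLy : hL h v (i1 - 7) (y + q).
  by apply: heavy_right; exists j; split=> //; rewrite /i1; lia.
case: hLy => j0 [hj3 hj4].
have hj5 : 2 ^ y <= deg n e (v j0) by apply: leq_trans hj4; rewrite leq_exp2l //; lia.
have hj6 : j0 <= d by lia.
have [a [ha hay hva _]] := cl_pivot C (walk_lt Hw hj6) hj5.
have hs : wlk e (j0 + 2) (v 0) a.
  by apply: wlk_trans hva; rewrite -[X in wlk e X]subn0; apply: (walk_fwd Hw).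
have [u [u1 u2 u3 u4]] := via_pivot Hw ha hay hs.
have [X [m [HX Hm HXm Hc]]] := peak Hw Hf.
(* Position [h + i2] is [rho - 2] steps before [v j], hence within [rho] of [w]. Stopping there
   saves [3 * (rho - 2)] in [base_cross], while the way through [w] to [v j] costs [rho + 2]. The
   walk itself cannot replace this way: before [h + i] it may meet vertices that are heavy for level
   [y]. *)
pose i2 := i1 - rho + 2.
have hi2 : h + i2 <= d by rewrite /i2 /i1 /rho; lia.
have t1 := base_cross Hw HX Hm HXm Hc u3 hi2.
have hw2 : wlk e rho w (v (h + i2)).
  rewrite [X in wlk e X](_ : _ = 2 + (j - (h + i2))); last by rewrite /i2 /i1 /rho; lia.
  apply: wlk_trans (wlk_sym esym hvw) _; apply: wlk_sym => //.
  by apply: (walk_fwd Hw) => //; rewrite /i2 /i1 /rho; lia.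
have t2 := TT_wlk u1 t1 (hsmall _ _ (leqnn _) hw2).2.
have t3 := TT_wlk u1 t2 (hsmall 2 _ isT (wlk_sym esym hvw)).1.
have t4 : wlk (W y) (d - j) (v j) (v d).
  by apply: (walk_W Hw) => // t h1 h2; apply: hlight => //; lia.
have t5 := u4 _ _ (TT_wlk u1 t3 t4).
by apply: (cl_mono C) t5; rewrite /i2 /i1 /rho; lia.
Qed.

End Climb.

(** The value starts from [q] and the gap [l - x] has to come down to [q]. Both phases thus range
    over a factor of at most [2 ^ logk], since [l <= q * k], and a gap of at most [q] is closed by
    adding [q]. *)
Lemma zlev_iter k logk : k = 2 ^ logk -> l <= q * k ->
  l <= iter (2 * logk + 3) (fun x => maxn (x + q) (zlev l x)) 0.
Proof.
move=> hk hl; set f := fun x => _.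
have fq x : x + q <= f x by rewrite /f; lia.
have fz x : zlev l x <= f x by rewrite /f; lia.
have p1 m : minn (q * 2 ^ m) ((l + 2) %/ 3) <= iter m.+1 f 0.
  elim: m => [|m IH]; first by rewrite /= expn0; have := fq 0; lia.
  rewrite iterS; have := fz (iter m.+1 f 0); have := fq (iter m.+1 f 0).
  by rewrite /zlev expnS; move: IH; lia.
have p2 : (l + 2) %/ 3 <= iter logk.+1 f 0 by apply: leq_trans (p1 logk); lia.
have p3 m : m <= logk -> l - iter (m + logk.+1) f 0 <= q * 2 ^ (logk - m).
  elim: m => [|m IH] hm; first by rewrite subn0 -hk; lia.
  have {}IH := IH ltac:(lia); rewrite addSn iterS.
  have h1 : (l + 2) %/ 3 <= iter (m + logk.+1) f 0.
    elim: (m) => [|m' IH'] //; rewrite addSn iterS.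
    by have := fq (iter (m' + logk.+1) f 0); lia.
  have := fz (iter (m + logk.+1) f 0); rewrite /zlev.
  have h2 : 2 ^ (logk - m) = 2 * 2 ^ (logk - m.+1) by rewrite -expnS; congr (_ ^ _); lia.
  move: IH; rewrite h2 mulnCA; lia.
have := p3 logk (leqnn _); rewrite subnn expn0 => h1.
have -> : 2 * logk + 3 = (logk + logk.+1).+2 by lia.
rewrite !iterS; set y := iter _ _ _ in h1 *.
have := fq y; have := fq (f y); lia.
Qed.

(** Each of the [2 * logk + 3] rounds moves 50 steps towards the midpoint, so half of the walk must
    have at least [50 * (2 * logk + 3)] edges. After the last round a degree would be at least
    [2 ^ l], which is more than [n]. *)
Theorem closed_stretch k logk d v : k = 2 ^ logk -> l <= q * k ->
  50 * (4 * logk + 6) < d -> (forall i, i < d -> e (v i) (v i.+1)) ->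
  TT (2 * d) (v 0) (v d).
Proof.
move=> hk hl hd he; apply: boolp.contrapT => Hf.
have Hw : walk d d./2 v by split=> //; lia.
have key m : m <= 2 * logk + 3 ->
    hR d d./2 v (50 * (2 * logk + 3 - m)) (iter m (fun x => maxn (x + q) (zlev l x)) 0).
  elim: m => [|m IH] hm.
    (* The climb starts at the end of the walk, which has a neighbour and thus degree at least
       [2 ^ 0]. *)
    exists d; split=> //=; first lia.
    rewrite expn0 -has_count; apply/hasP; exists (v d.-1).
      by rewrite mem_iota; apply: (walk_lt Hw); lia.
    by rewrite esym; have := he d.-1; rewrite prednK; [apply; lia|lia].
  have {}IH := climb Hw Hf _ (IH ltac:(lia)).
  have := IH ltac:(lia) => h1; apply: hR_mono h1 _ _ => //; lia.
have [j [_ _ h1]] := key _ (leqnn _).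
have := leq_trans h1 (ltnW (deg_lt (v j))); rewrite leq_exp2l // => h2.
have h3 := zlev_iter hk hl.
have : 2 ^ l <= deg n e (v j) by apply: leq_trans h1; rewrite leq_exp2l.
by rewrite leqNgt deg_lt.
Qed.

End Core.

(** * Preprocessing of the input *)

(** Without additions at the top a value is a small constant, a stored value, a truth value or a
    difference below one of these. The bound [V] is then automatic, and only additions need an
    argument. *)
Fixpoint safe (e : expr) : bool :=
  match e with
  | Cst m => m <= 32
  | Reg _ | Arr _ _ | Leq _ _ => true
  | Add _ _ => false
  | Sub e1 _ => safe e1
  end.

Lemma eval_safe V st e : 32 <= V -> safe e -> bnd V st -> eval st e <= V.
Proof.
by move=> hV + [h1 h2]; elim: e => //=; lia.
Qed.

Lemma exec_seqE w p q st st' t : exec w (Seq p q) st st' t ->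
  exists st1 t1 t2, [/\ t = t1 + t2, exec w p st st1 t1 & exec w q st1 st' t2].
Proof.
move E: (Seq p q) => c h; case: h E => // p1 q1 st0 st1 st2 t1 t2 h1 h2 [-> ->].
by exists st1, t1, t2.
Qed.

Section SeqRules.
Variables (V : nat) (hV : 32 <= V).
Local Notation tri := (tri V).

Lemma tri_assign_seq x e q k (R : state -> Prop) st : small e -> 0 < k ->
  (bnd V st -> eval st e <= V) ->
  tri q k.-1 R (set_reg st x (eval st e)) -> tri (Seq (Assign x e) q) k R st.
Proof.
move=> h1 h2 h3 h4; apply: (tri_seq (k1 := 1) (k2 := k.-1)); last lia.
exact: tri_assign.
Qed.

Lemma tri_store_seq a e1 e2 q k (R : state -> Prop) st : small e1 -> small e2 -> 0 < k ->
  (bnd V st -> eval st e2 <= V) ->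
  tri q k.-1 R (set_arr st a (eval st e1) (eval st e2)) ->
  tri (Seq (Store a e1 e2) q) k R st.
Proof.
move=> h1 h2 h3 h4 h5; apply: (tri_seq (k1 := 1) (k2 := k.-1)); last lia.
exact: tri_store.
Qed.

Lemma tri_skip_seq q k (R : state -> Prop) st : 0 < k ->
  tri q k.-1 R st -> tri (Seq Skip q) k R st.
Proof.
move=> h1 h2; apply: (tri_seq (k1 := 1) (k2 := k.-1)); last lia.
exact: tri_skip.
Qed.

Lemma tri_assoc p q r k (R : state -> Prop) st :
  tri (Seq p (Seq q r)) k R st -> tri (Seq (Seq p q) r) k R st.
Proof.
move=> h hb; have [st' [t [h1 h2 h3 h4]]] := h hb; exists st', t; split=> // w.
have [s1 [t1 [t2 [-> hp /exec_seqE[s2 [t3 [t4 [-> hq hr]]]]]]]] := exec_seqE (h1 w).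
by rewrite addnA; apply: ExecSeq hr; apply: ExecSeq hq.
Qed.

(** The continuation is verified once per branch, so that no assertion for the point where the
    branches join has to be found. *)
Lemma tri_if_seq e p1 p2 q k (R : state -> Prop) st : small e -> 0 < k ->
  (eval st e <> 0 -> tri (Seq p1 q) k.-1 R st) ->
  (eval st e = 0 -> tri (Seq p2 q) k.-1 R st) ->
  tri (Seq (If e p1 p2) q) k R st.
Proof.
case: k => // k he _ h1 h2 hb /=.
have hc := small_cost hV he hb.
case: (eqVneq (eval st e) 0) => h.
  have [st1 [t1 [h3 h4 h5 h6]]] := h2 h hb.
  exists st1, (ecost st e + t1).+1; split=> //; last by move: h4 hc; rewrite /= /ucost; nia.
  move=> w; have [s1 [t2 [t3 [-> hp hq]]]] := exec_seqE (h3 w).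
  by rewrite addnA -addSn; apply: ExecSeq hq; apply: ExecIfFalse.
have [st1 [t1 [h3 h4 h5 h6]]] := h1 (elimN eqP h) hb.
exists st1, (ecost st e + t1).+1; split=> //; last by move: h4 hc; rewrite /= /ucost; nia.
move=> w; have [s1 [t2 [t3 [-> hp hq]]]] := exec_seqE (h3 w).
by rewrite addnA -addSn; apply: ExecSeq hq; apply: ExecIfTrue.
Qed.

End SeqRules.

(** * Symbolic execution of straight-line code *)

Ltac bound := let hb := fresh "hb" in
  intros hb; first [ by apply: eval_safe hb | rewrite /= /upd /=; try lia ].

Ltac stp := lazymatch goal with
  | |- tri _ (Seq (Seq _ _) _) _ _ _ => apply: tri_assoc
  | |- tri _ (Seq (Assign _ _) _) _ _ _ =>
      apply: tri_assign_seq; [ by [] | by [] | by [] || lia | bound | rewrite /= /upd /= ]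
  | |- tri _ (Seq (Store _ _ _) _) _ _ _ =>
      apply: tri_store_seq; [ by [] | by [] | by [] | by [] || lia | bound | rewrite /= /upd /= ]
  | |- tri _ (Seq Skip _) _ _ _ =>
      apply: tri_skip_seq; [ by [] | by [] || lia | rewrite /= /upd /= ]
  | |- tri _ (Seq (If _ _ _) _) _ _ _ =>
      apply: tri_if_seq; [ by [] | by [] | by [] || lia | rewrite /= /upd /= | rewrite /= /upd /= ]
  | |- tri _ (Assign _ _) _ _ _ =>
      apply: tri_assign; [ by [] | by [] | by [] || lia | bound | rewrite /= /upd /= ]
  | |- tri _ (Store _ _ _) _ _ _ =>
      apply: tri_store; [ by [] | by [] | by [] | by [] || lia | bound | rewrite /= /upd /= ]
  | |- tri _ Skip _ _ _ =>
      apply: tri_skip; [ by [] || lia | rewrite /= /upd /= ]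
  | |- tri _ (If _ _ _) _ _ _ =>
      apply: tri_if; [ by [] | by [] | by [] || lia | rewrite /= /upd /= | rewrite /= /upd /= ]
  end.

Notation "p ;; q" := (Seq p q) (at level 95, right associativity).

Notation rN := 0 (only parsing).
Notation rL := 1 (only parsing).
Notation rQ := 2 (only parsing).
Notation rI := 3 (only parsing).
Notation rJ := 4 (only parsing).
Notation rX := 5 (only parsing).
Notation rZ := 6 (only parsing).
Notation rV := 7 (only parsing).
Notation rB := 8 (only parsing).
Notation rM := 9 (only parsing).
Notation rC := 10 (only parsing).
Notation rD := 11 (only parsing).
Notation rK := 12 (only parsing).
Notation rF := 13 (only parsing).
Notation rS := 14 (only parsing).
Notation rR := 15 (only parsing).
Notation rY := 16 (only parsing).
Notation rP := 17 (only parsing).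
Notation rH := 18 (only parsing).
Notation rT := 19 (only parsing).
Notation rU := 20 (only parsing).
Notation rE := 21 (only parsing).

(* The arrays used below for pairs are stored row by row; since the machine cannot
   multiply, the offset [i * n] of a row is read off [aOff].  The entry of a pair
   of vertices in [aKl] is [x.+1] if it was linked on level [x], and 0 if it was
   not linked. *)
Notation aAdj := 0 (only parsing).
Notation aDig := 1 (only parsing).
Notation aEst := 2 (only parsing).
Notation aOff := 3 (only parsing).
Notation aDeg := 4 (only parsing).
Notation aPw := 5 (only parsing).
Notation aLev := 6 (only parsing).
Notation aMk := 7 (only parsing).
Notation aMb := 8 (only parsing).
Notation aKl := 9 (only parsing).
Notation aFd := 10 (only parsing).
Notation aF := 11 (only parsing).
Notation aVis := 12 (only parsing).
Notation aNb := 13 (only parsing).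
Notation aSt := 14 (only parsing).
Notation aEn := 15 (only parsing).
Notation aQu := 16 (only parsing).
Notation aQv := 17 (only parsing).
Notation aAl := 18 (only parsing).

Definition at2 (a : nat) (i j : expr) : expr := Arr a (Add (Arr aOff i) j).
Definition put2 (a : nat) (i j v : expr) : cmd := Store a (Add (Arr aOff i) j) v.
Definition inc (r : nat) : cmd := Assign r (Add (Reg r) (Cst 1)).

Definition p_off : cmd :=
  Store aOff (Cst 0) (Cst 0);;
  For rI (Reg rN) (Store aOff (Add (Reg rI) (Cst 1)) (Add (Arr aOff (Reg rI)) (Reg rN))).

(** The first loop finds the binary length of [n]. The table extends to the exponent [2 * l] because
    degrees are later compared with [2 ^ (x + q)], where [x < l] and [q <= l]. *)
Definition p_pow : cmd :=
  Store aPw (Cst 0) (Cst 1);;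
  Assign rL (Cst 0);;
  While (Leq (Arr aPw (Reg rL)) (Reg rN))
    (Store aPw (Add (Reg rL) (Cst 1)) (Add (Arr aPw (Reg rL)) (Arr aPw (Reg rL)));;
     inc rL);;
  For rI (Reg rL)
    (Store aPw (Add (Add (Reg rL) (Reg rI)) (Cst 1))
       (Add (Arr aPw (Add (Reg rL) (Reg rI))) (Arr aPw (Add (Reg rL) (Reg rI))))).

(* Every digit of [k] below the leading one halves [rQ], rounding up. *)
Definition p_q : cmd :=
  Assign rQ (Reg rL);;
  Assign rI (Cst 0);;
  While (Sub (Leq (Cst 2) (Reg rQ)) (Arr aDig (Reg rI)))
    (Assign rJ (Cst 0);;
     While (Leq (Add (Add (Reg rJ) (Reg rJ)) (Cst 1)) (Reg rQ)) (inc rJ);;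
     Assign rQ (Reg rJ);;
     inc rI).

Definition p_deg : cmd :=
  For rV (Reg rN)
    (For rB (Reg rN)
      (If (at2 aAdj (Reg rV) (Reg rB))
        (put2 aAl (Reg rV) (Arr aDeg (Reg rV)) (Reg rB);;
         Store aDeg (Reg rV) (Add (Arr aDeg (Reg rV)) (Cst 1)))
        Skip)).

Lemma index_lt n i j : i < n -> j < n -> i * n + j < n * n.
Proof.
move=> hi hj; have : i.+1 * n <= n * n by rewrite leq_mul2r hi orbT.
by rewrite mulSn; lia.
Qed.

Lemma index_inj n i j i' j' : j < n -> j' < n -> i * n + j = i' * n + j' -> i = i' /\ j = j'.
Proof.
move=> hj hj' h; have n_gt0 : 0 < n by lia.
have h1 : i = i'.
  by have := congr1 (fun m => m %/ n) h; rewrite !divnMDl // !divn_small // !addn0.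
by split=> //; move: h; rewrite h1 => /addnI.
Qed.

Lemma log_gt0 n l : n < 2 ^ l -> 0 < n -> 0 < l.
Proof. by case: l => //; rewrite expn0; lia. Qed.

Lemma log_le n l : n < 2 ^ l -> 2 ^ l <= 2 * n -> l <= n.
Proof.
case: l => // l _; rewrite expnS => h; have : l < 2 ^ l by apply: ltn_expl.
lia.
Qed.

Section Prep.
Variables (V n : nat) (n_gt0 : 0 < n) (HV : 64 * (n * n * n) <= V).

Lemma V32 : 32 <= V. Proof. by nia. Qed.
Lemma Vn2 : 64 * (n * n) <= V. Proof. by nia. Qed.
Lemma Vn1 : 64 * n <= V. Proof. by nia. Qed.
Hint Resolve V32 Vn2 Vn1 : core.

Lemma tri_off st : reg st rN = n ->
  tri V p_off (4 * n + 10) (fun st' => forall i, i <= n -> arr st' aOff i = i * n) st.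
Proof.
move=> hn; have h1 := Vn1; have h2 := Vn2; rewrite /p_off; stp.
apply: (tri_for V32 (N := n) (K := 1)
  (I := fun i st => forall j, j <= i -> arr st aOff j = j * n)) => //.
- lia.
- by move=> st1 hf /=; rewrite hf.1 // hn.
- by move=> j /=; rewrite leqn0 => /eqP ->; rewrite /upd.
- lia.
- by move=> st1 st2 ha hr i hi j hj; rewrite -ha hi.
- move=> i st1 hi hf hb hxi hI.
  have hN : reg st1 rN = n by rewrite hf.1.
  stp; first by rewrite hxi hI // hN; nia.
  move=> _ _ j hj; rewrite hxi hN addn1; case: eqP => [->|hne].
    by rewrite hI // mulSn addnC.
  by rewrite hI //; lia.
Qed.

Variables (l : nat) (nl : n < 2 ^ l) (ln : 2 ^ l <= 2 * n).

Lemma pow_bound i : i <= 2 * l -> 2 ^ i <= V.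
Proof.
move=> hi; apply: (@leq_trans (2 ^ (2 * l))); first by rewrite leq_exp2l.
by rewrite mul2n -addnn expnD; have := Vn2; nia.
Qed.

Lemma tri_pow st : reg st rN = n ->
  tri V p_pow (8 * n + 10) (fun st' => reg st' rL = l /\
    forall i, i <= 2 * l -> arr st' aPw i = 2 ^ i) st.
Proof.
move=> hn; have h1 := Vn1; have h2 := log_le nl ln; rewrite /p_pow; stp; stp.
apply: (tri_seq (k1 := l * 4 + 1) (k2 := 3 * n + 2)); last by lia.
apply: (tri_while V32
  (I := fun st => reg st rL <= l /\ forall i, i <= reg st rL -> arr st aPw i = 2 ^ i)
  (phi := fun st => (l - reg st rL) * 4)) => //.
- by split=> //= i; rewrite leqn0 => /eqP ->.
- by rewrite /=; lia.
- move=> st1 hf hb [hl hp] /=.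
  rewrite (hf.1 rN) //= /upd /= hn hp //; case: leqP => // hle _.
  have hlt : reg st1 rL < l.
    by rewrite ltnNge; apply/negP => h; have := leq_exp2l l (reg st1 rL) (isT : 1 < 2); rewrite h; lia.
  exists 3; stp; first by rewrite hp //; lia.
  rewrite /inc; stp.
  move=> _ _; rewrite addn1; split; last lia.
  split=> // i hi; case: eqP => [->|hne].
    by rewrite hp // expnS mul2n addnn.
  by apply: hp; lia.
- move=> st1 hf hb [hl hp] /=.
  rewrite (hf.1 rN) //= /upd /= hn hp //; case: leqP => // hlt _ hf1.
  have hL : reg st1 rL = l.
    apply/eqP; rewrite eqn_leq hl leqNgt /=; apply/negP => h.
    have : 2 * 2 ^ reg st1 rL <= 2 ^ l by rewrite -expnS leq_exp2l.
    lia.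
  apply: (tri_for V32 (N := l) (K := 1)
    (I := fun i st => reg st rL = l /\ forall j, j <= l + i -> arr st aPw j = 2 ^ j)) => //.
  + lia.
  + by move=> st2 hf2 /=; rewrite hf2.1.
  + by rewrite /= /upd /=; split=> // j hj; apply: hp; lia.
  + lia.
  + by move=> st2 st3 ha hr i [h3 h4]; rewrite -ha -hr.
  + move=> i st2 hi hf2 hb2 hxi [h3 h4].
    stp.
      rewrite h3 hxi h4 // addnn -mul2n -expnS; apply: pow_bound; lia.
    move=> _ _; split=> // j hj; rewrite h3 hxi addn1; case: eqP => [->|hne].
      by rewrite h4 // addnn -mul2n -expnS.
    by apply: h4; lia.
  + by move=> st2 _ _ _ [h3 h4]; split=> // i hi; apply: h4; lia.
Qed.

Variables (k logk : nat) (kE : k = 2 ^ logk).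

Lemma tri_q st : reg st rL = l -> (forall i, arr st aDig i = (i == logk)) ->
  tri V p_q (8 * (n * n) + 8 * n + 20) (fun st' =>
    [/\ 0 < reg st' rQ, (reg st' rQ).-1 * k < l & l <= reg st' rQ * k]) st.
Proof.
move=> hL hD; have h0 := log_gt0 nl n_gt0; have h1 := Vn1; have h2 := log_le nl ln; rewrite /p_q; stp; stp.
(* The last two clauses say that [rQ] is [l / 2 ^ rI] rounded up; halving with rounding up preserves
   this. *)
pose I st := [/\ 0 < reg st rQ, reg st rQ <= l, reg st rI <= logk,
  (reg st rQ).-1 * 2 ^ reg st rI < l & l <= reg st rQ * 2 ^ reg st rI].
apply: (tri_while V32 (I := I) (phi := fun st => reg st rQ * (2 * n + 8))) => //.
- by rewrite /I /= /upd /= hL expn0 !muln1; split=> //; lia.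
- have h3 : l * (2 * n + 8) <= n * (2 * n + 8) by rewrite leq_mul2r h2 orbT.
  by rewrite /= /upd /= hL; lia.
- move=> st1 hf hb [i1 i2 i3 i4 i5] /=.
  rewrite (hf.2 aDig) //= hD => hg.
  have {hg} [hq hi] : 2 <= reg st1 rQ /\ reg st1 rI <> logk.
    by move: hg; case: eqP; case: leqP; lia.
  exists (2 * n + 7); stp.
  set st2 := set_reg _ _ _.
  apply: (tri_seq (k1 := 2 * n + 3) (k2 := 2)); last lia.
  pose q := reg st1 rQ.
  apply: (tri_while V32 (I := fun st => reg st rJ <= (q.+1) %/ 2)
    (phi := fun st => ((q.+1) %/ 2 - reg st rJ) * 2)) => //.
  + by rewrite /= /upd /=; lia.
  + move=> st3 hf3 hb3 hI3 /=; rewrite (hf3.1 rQ) //= /upd /= -/q => hg.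
    have {}hg : 2 * reg st3 rJ < q by move: hg; case: leqP; lia.
    exists 1; rewrite /inc; stp.
    by move=> _ _; lia.
  + move=> st3 hf3 hb3 hI3 /=; rewrite (hf3.1 rQ) //= /upd /= -/q => hg hf4.
    have {}hg : reg st3 rJ = (q.+1) %/ 2 by move: hg; case: leqP; lia.
    stp; rewrite /inc; stp.
      have h5 : 2 ^ reg st1 rI < l by apply: leq_ltn_trans i4; rewrite leq_pmull //; lia.
      by rewrite (hf3.1 rI) //= /upd /=; have := ltn_expl (reg st1 rI) (isT : 1 < 2); lia.
    move=> _ _; rewrite /I /= /upd /= (hf3.1 rI) //= /upd /= hg; split; last first.
      have h6 : ((q.+1) %/ 2).+1 * (2 * n + 8) <= q * (2 * n + 8).
        by rewrite leq_mul2r; apply/orP; right; rewrite /q; lia.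
      by move: h6; rewrite mulSn /q; lia.
    have hh : 2 ^ (reg st1 rI + 1) = 2 * 2 ^ reg st1 rI by rewrite addn1 expnS.
    rewrite hh; split; rewrite /q; try lia.
      apply: leq_ltn_trans i4; rewrite mulnA leq_mul2r; apply/orP; right; lia.
    by apply: leq_trans i5 _; rewrite mulnA leq_mul2r; apply/orP; right; lia.
- move=> st1 hf hb [i1 i2 i3 i4 i5] /=.
  rewrite (hf.2 aDig) //= hD => hg.
  (* If the quotient is 1 before the leading digit is met, it is also 1 for the larger divisor [k],
     and the remaining digits need not be read. *)
  have {hg} [hq|hi] : reg st1 rQ = 1 \/ reg st1 rI = logk.
    by move: hg; case: eqP; case: leqP; lia.
  - rewrite hq in i5 *; split=> //; rewrite mul1n in i5 *.
    by apply: leq_trans i5 _; rewrite mul1n kE leq_exp2l.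
  - by rewrite kE -hi.
Qed.

Variable (e : rel nat).
Hypothesis (elt : forall i j, e i j -> i < n /\ j < n).

Definition nbrs (v : nat) : seq nat := seq.filter (e v) (iota 0 n).

Lemma size_nbrs v : size (nbrs v) = deg n e v.
Proof. by rewrite size_filter. Qed.

Lemma deg_le v : deg n e v <= n.
Proof. by rewrite -[X in _ <= X](size_iota 0) count_size. Qed.

Definition offs (st : state) : Prop := forall i, i <= n -> arr st aOff i = i * n.

Definition degs (st : state) : Prop := forall v, v < n ->
  arr st aDeg v = deg n e v /\
  forall j, j < deg n e v -> arr st aAl (v * n + j) = nth 0 (nbrs v) j.

Lemma tri_deg st : reg st rN = n -> offs st ->
  (forall i j, i < n -> j < n -> arr st aAdj (i * n + j) = e i j) ->
  (forall i, arr st aDeg i = 0) ->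
  tri V p_deg (16 * (n * n) + 8 * n + 10) degs st.
Proof.
move=> hn ho hA hd; have h1 := Vn1; have h2 := Vn2; rewrite /p_deg.
have hofr st1 : (forall a, a \notin aw p_deg -> arr st1 a = arr st a) -> offs st1.
  by move=> h i hi; rewrite h // ho.
have hAfr st1 : (forall a, a \notin aw p_deg -> arr st1 a = arr st a) ->
    forall i j, i < n -> j < n -> arr st1 aAdj (i * n + j) = e i j.
  by move=> h i j hi hj; rewrite h // hA.
pose I (v b : nat) st1 := forall u, arr st1 aDeg u =
    (if u < v then deg n e u else if u == v then count (e v) (iota 0 b) else 0) /\
  forall j, j < arr st1 aDeg u -> arr st1 aAl (u * n + j) = nth 0 (seq.filter (e u) (iota 0 (if u < v then n else b))) j.
apply: (tri_for V32 (N := n) (K := 8 * n + 4) (I := fun v => I v 0)) => //.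
- lia.
- by move=> st1 hf /=; rewrite hf.1 // hn.
- by move=> u; rewrite ltn0 /= hd; split=> //; case: eqP.
- lia.
- by move=> st1 st2 ha hr i hi u; rewrite -ha; apply: hi.
- move=> v st1 hv hf hb hxv hI.
  apply: (tri_for V32 (N := n) (K := 5) (I := I v)) => //.
  + lia.
  + by move=> st2 hf2 /=; rewrite hf2.1 //= /upd /= hf.1 // hn.
  + lia.
  + by move=> st2 st3 ha hr i hi u; rewrite -ha; apply: hi.
  + move=> b st2 hb' hf2 hb2 hxb hI2.
    have hV : reg st2 rV = v by rewrite hf2.1.
    have ho2 : offs st2 by apply: hofr => a ha; rewrite hf2.2 //= hf.2.
    have hA2 : forall i j, i < n -> j < n -> arr st2 aAdj (i * n + j) = e i j.
      by apply: hAfr => a ha; rewrite hf2.2 //= hf.2.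
    have [hdv hal] := hI2 v; rewrite ltnn eqxx in hdv.
    have hc : count (e v) (iota 0 b) <= b.
      by rewrite -[X in _ <= X](size_iota 0) count_size.
    have hS : iota 0 b.+1 = rcons (iota 0 b) b by rewrite -addn1 iotaD /= cats1.
    stp; rewrite /= hV hxb ho2 ?(ltnW hv) // hA2 //.
      case hE: (e v b) => // _; rewrite /put2; stp; stp.
        by rewrite hV hdv; lia.
      move=> _ _ u; rewrite /= /upd /= hV ho2 ?(ltnW hv) //.
      rewrite hdv hxb; have [h3 h4] := hI2 u.
      case: (ltngtP u v) => huv; rewrite ?huv ?eqxx.
      * split; first by rewrite h3 huv.
        move=> j hj; case: eqP => [he|_]; last by rewrite h4 // huv.
        exfalso; move: hj; rewrite h3 huv => hj; have := deg_le u => hd'.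
        by have [] := @index_inj n v (count (e v) (iota 0 b)) u j _ _ (esym he); lia.
      * have hu0 : arr st2 aDeg u = 0 by rewrite h3; case: (ltngtP u v) huv.
        by rewrite hu0.
      * rewrite -[e v 0 + _]/(count (e v) (iota 0 b.+1)) hS -cats1 count_cat /= hE addn0; split; first by rewrite addn1.
        move=> j hj; rewrite filter_cat /= hE nth_cat size_filter.
        case: eqP => [he|hne].
          have {he} he : j = count (e v) (iota 0 b) by lia.
          by rewrite he ltnn subnn.
        have hj' : j < count (e v) (iota 0 b) by lia.
        by rewrite hj' hal ?hdv // ltnn.
    case hE: (e v b) => // _; stp => _ u; have [h3 h4] := hI2 u.
    rewrite hS -cats1 count_cat /= hE !addn0; split=> // j hj; rewrite h4 //.
    move: hj; rewrite h3; case: (ltngtP u v) => // -> hj.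
    by rewrite hS -cats1 filter_cat /= hE cats0.
  + move=> st2 hf2 hb2 hxb hI2 _ u; have [h3 h4] := hI2 u.
    rewrite h3 ltnS; case: (ltngtP u v) => huv.
    * by split=> // j hj; rewrite h4 ?h3 huv.
    * have hu0 : arr st2 aDeg u = 0 by rewrite h3; case: (ltngtP u v) huv.
      by case: eqP.
    * rewrite huv; split=> // j hj.
      by have := h4 j; rewrite h3 huv ltnn eqxx; apply.
- move=> st1 hf hb hxn hI v hv; have [h3 h4] := hI v; rewrite hv in h3 h4.
  by rewrite h3; split=> // j hj; apply: h4; rewrite h3.
Qed.

End Prep.

(** * Breadth-first search on pairs *)

Lemma leq_sum_uniq (T : eqType) (s r : seq T) (f : T -> nat) :
  uniq s -> uniq r -> {subset s <= r} -> \sum_(c <- s) f c <= \sum_(c <- r) f c.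
Proof.
move=> us ur hs; have hp : perm_eq s [seq c <- r | c \in s].
  apply: uniq_perm => //; first exact: filter_uniq.
  by move=> c; rewrite mem_filter; case hc: (c \in s) => //=; rewrite hs.
by rewrite (perm_big _ hp) big_filter [X in _ <= X](bigID (mem s)) /= leq_addr.
Qed.

Section PairQueue.

Variables (n : nat) (e : rel nat) (lev : nat -> nat) (W : nat -> rel nat).
Hypothesis (elt : forall i j, e i j -> i < n /\ j < n) (esym : symmetric e).
Hypothesis (We : forall x b b', W x b b' -> e b b').

Local Notation p0 := (0, 0).

(* Breadth-first search on pairs of vertices: [g u v] is the successor of the
   estimate of the pair [(u, v)], or 0 if it has not been reached, [s] is the
   queue, including the entries already processed, and [h] is its head. *)
Record pairq (g : nat -> nat -> nat) (s : seq (nat * nat)) (h : nat) : Prop := Pairq {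
  pq_uniq : uniq s;
  pq_mem : forall u v, ((u, v) \in s) = [&& u < n, v < n & 0 < g u v];
  pq_sort : forall i j, i <= j -> j < size s ->
    g (nth p0 s i).1 (nth p0 s i).2 <= g (nth p0 s j).1 (nth p0 s j).2;
  pq_lim : forall j, j < size s -> h < size s ->
    g (nth p0 s j).1 (nth p0 s j).2 <= (g (nth p0 s h).1 (nth p0 s h).2).+1;
  pq_idx : forall j, j < size s -> g (nth p0 s j).1 (nth p0 s j).2 <= j.+1;
  pq_sym : forall u v, u < n -> v < n -> g u v = g v u;
  pq_sound : forall u v m, u < n -> v < n -> g u v = m.+1 -> wlk e m u v;
  pq_diag : forall u, u < n -> g u u = 1;
  pq_clo : forall i b, i < h -> i < size s ->
    W (lev (nth p0 s i).1) (nth p0 s i).2 b ->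
    0 < g (nth p0 s i).1 b <= (g (nth p0 s i).1 (nth p0 s i).2).+1 }.

Lemma pq_nth g s h i : pairq g s h -> i < size s ->
  [/\ (nth p0 s i).1 < n, (nth p0 s i).2 < n & 0 < g (nth p0 s i).1 (nth p0 s i).2].
Proof.
move=> hq hi; have := mem_nth p0 hi; case: (nth p0 s i) => u v.
by rewrite (pq_mem hq) => /and3P[].
Qed.

Lemma pq_size g s h : pairq g s h -> size s <= n * n.
Proof.
move=> hq; rewrite -[n * n](size_iota 0).
rewrite -(size_map (fun p => p.1 * n + p.2)); apply: uniq_leq_size.
  rewrite map_inj_in_uniq ?(pq_uniq hq) // => -[u v] [u' v'] /=.
  rewrite !(pq_mem hq) => /and3P[h1 h2 _] /and3P[h3 h4 _] he.
  by have [-> ->] := index_inj h2 h4 he.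
move=> c /mapP[[u v] + ->]; rewrite (pq_mem hq) => /and3P[h1 h2 _].
by rewrite mem_iota /= add0n index_lt.
Qed.

(** It is enough that all successors of the head have been reached. They are then in the queue, and
    no entry of the queue exceeds the value of the head by more than 1. *)
Lemma pairq_next g s h u v : pairq g s h -> h < size s -> nth p0 s h = (u, v) ->
  (forall b, W (lev u) v b -> 0 < g u b) -> pairq g s h.+1.
Proof.
move=> hq hh huv hW; have [h1 h2 h3 h4 h5 h6 h7 h8 h9] := hq; split=> //.
  by move=> j hj hj'; apply: leq_trans (h4 j hj hh) _; rewrite ltnS h3.
move=> i b; rewrite ltnS leq_eqVlt => /orP[/eqP ->|]; last exact: h9.
move=> hi; rewrite huv /= => hb; rewrite hW //=.
have hu : u < n by have [] := pq_nth hq hi; rewrite huv.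
have hbn : b < n by have [] := elt (We hb).
have : (u, b) \in s by rewrite h2 hu hbn hW.
case/(nthP p0) => j hj hj'; have := h4 j hj hh.
by rewrite hj' huv.
Qed.

(** Both orders of the pair enter together with the same value, which keeps the table symmetric. The
    two copies are later expanded with different first vertices and so with different levels. *)
Lemma pairq_push g g' s h u v b : pairq g s h -> h < size s -> nth p0 s h = (u, v) ->
  e v b -> g u b = 0 ->
  (forall u' v', u' < n -> v' < n -> g' u' v' =
    if ((u', v') == (u, b)) || ((u', v') == (b, u)) then (g u v).+1 else g u' v') ->
  pairq g' (s ++ [:: (u, b); (b, u)]) h.
Proof.
move=> hq hh huv evb hub hg'; have [h1 h2 h3 h4 h5 h6 h7 h8 h9] := hq.
have [hu hv huv0] := pq_nth hq hh; rewrite huv /= in hu hv huv0.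
have hb : b < n by have [] := elt evb.
(* Diagonal pairs are reached from the start, so the two new entries are distinct. *)
have hneq : u != b by apply/eqP => hE; have := h8 u hu; rewrite {2}hE hub.
have hbu : g b u = 0 by rewrite h6.
have old i : i < size s -> g' (nth p0 s i).1 (nth p0 s i).2 = g (nth p0 s i).1 (nth p0 s i).2.
  move=> hi; have [k1 k2 k3] := pq_nth hq hi.
  rewrite hg' //; case: (nth p0 s i) k3 => u' v' /= k3.
  by case: eqP => [[? ?]|_]; [subst; rewrite hub in k3|case: eqP => [[? ?]|//]; subst; rewrite hbu in k3].
have nu : g' u b = (g u v).+1 by rewrite hg' // eqxx.
have nb : g' b u = (g u v).+1 by rewrite hg' // eqxx orbT.
have sz : size (s ++ [:: (u, b); (b, u)]) = (size s).+2 by rewrite size_cat addn2.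
have new j : j < (size s).+2 -> size s <= j ->
    g' (nth p0 (s ++ [:: (u, b); (b, u)]) j).1 (nth p0 (s ++ [:: (u, b); (b, u)]) j).2 = (g u v).+1.
  move=> j1 j2; rewrite nth_cat ltnNge j2 /=.
  have : j - size s < 2 by lia.
  by case: (j - size s) => [|[|]].
have lim j : j < size s -> g' (nth p0 s j).1 (nth p0 s j).2 <= (g u v).+1.
  by move=> hj; rewrite old //; have := h4 j hj hh; rewrite huv.
split.
- rewrite cat_uniq h1 /= !inE /= !h2 hub hbu !andbF /= xpair_eqE.
  by rewrite (negPf hneq).
- move=> u' v'; rewrite mem_cat !inE h2.
  case: (boolP (u' < n)) => hu'; last first.
    by case: eqP => [[? _]|_]; [subst; rewrite hu in hu'|case: eqP => [[? _]|//]; subst; rewrite hb in hu'].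
  case: (boolP (v' < n)) => hv'; last first.
    by case: eqP => [[_ ?]|_]; [subst; rewrite hb in hv'|case: eqP => [[_ ?]|//]; subst; rewrite hu in hv'].
  by rewrite hg' //=; case: (_ == _) => /=; rewrite ?orbT //; case: (_ == _); rewrite ?orbT ?orbF.
- move=> i j hij; rewrite sz => hj.
  case: (ltnP j (size s)) => hjs.
    by rewrite !nth_cat hjs (leq_ltn_trans hij hjs) !old ?(leq_ltn_trans hij) // h3.
  rewrite (new j) //; case: (ltnP i (size s)) => his; last by rewrite new //; lia.
  by rewrite nth_cat his lim.
- move=> j; rewrite sz => hj _; rewrite (nth_cat _ _ _ h) hh old // huv /=.
  case: (ltnP j (size s)) => hjs; last by rewrite new.
  by rewrite nth_cat hjs lim.
- move=> j; rewrite sz => hj; case: (ltnP j (size s)) => hjs.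
    by rewrite nth_cat hjs old // h5.
  by rewrite new //; have := h5 h hh; rewrite huv /=; lia.
- move=> u' v' hu' hv'; rewrite !hg' // (h6 u' v') //; congr (if _ then _ else _).
  by rewrite !xpair_eqE orbC; congr (_ || _); rewrite andbC.
- move=> u' v' m hu' hv'; rewrite hg' //; case: ifP => [|_]; last exact: h7.
  have huv' : forall m, (g u v).+1 = m.+1 -> wlk e m u b.
    move=> m' [<-]; case E: (g u v) huv0 => [//|m''] _.
    by right; exists v => //; apply: h7.
  case/orP => /eqP[-> ->]; first exact: huv'.
  by move=> /huv' hw; apply: wlk_sym.
- move=> u' hu'; rewrite hg' // h8 //; case: ifP => // /orP[]/eqP[h10 h11]; subst u'.
    by rewrite h11 eqxx in hneq.
  by rewrite h11 eqxx in hneq.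
- move=> i b' hi; rewrite sz => _ hW.
  have his : i < size s by apply: ltn_trans hi hh.
  move: hW; rewrite nth_cat his => hW; rewrite old //.
  have [k1 k2 k3] := pq_nth hq his.
  have k4 : b' < n by have [] := elt (We hW).
  have /andP[k5 k6] := h9 i b' hi his hW.
  rewrite hg' //; case: ifP => [|_]; last by rewrite k5 k6.
  by case/orP => /eqP[k7 k8]; rewrite k7 k8 ?hub ?hbu in k5.
Qed.

Lemma pairq_init (g : nat -> nat -> nat) (s : seq (nat * nat)) : uniq s ->
  (forall u v, u < n -> v < n -> g u v = (u == v)) ->
  s = [seq (u, u) | u <- iota 0 n] -> pairq g s 0.
Proof.
move=> us hg hs.
have sz : size s = n by rewrite hs size_map size_iota.
have hn i : i < size s -> nth p0 s i = (i, i).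
  by rewrite sz => hi; rewrite hs (nth_map 0) ?size_iota // nth_iota.
have gi i : i < size s -> g (nth p0 s i).1 (nth p0 s i).2 = 1.
  by move=> hi; rewrite hn //= hg ?eqxx // -sz.
split=> //.
- move=> u v; apply/idP/idP.
    rewrite hs => /mapP[w]; rewrite mem_iota add0n => /= hw [-> ->].
    by rewrite hw hg // eqxx.
  case/and3P => hu hv; rewrite hg // lt0b => /eqP <-.
  by rewrite hs; apply/mapP; exists u => //; rewrite mem_iota.
- by move=> i j hij hj; rewrite !gi //; apply: leq_ltn_trans hj.
- by move=> j hj h0; rewrite !gi.
- by move=> j hj; rewrite gi.
- by move=> u v hu hv; rewrite !hg // eq_sym.
- by move=> u v m hu hv; rewrite hg //; case: eqP => // -> [<-]; apply: wlkxx.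
- by move=> u hu; rewrite hg // eqxx.
Qed.

End PairQueue.

Definition p_lists : cmd :=
  Assign rP (Cst 0);;
  For rX (Reg rL)
    (For rV (Reg rN)
      (put2 aSt (Reg rX) (Reg rV) (Reg rP);;
       For rB (Reg rN)
        (If (at2 aAdj (Reg rV) (Reg rB))
          (If (Add (Leq (Add (Arr aDeg (Reg rV)) (Cst 1)) (Arr aPw (Add (Reg rX) (Reg rQ))))
                 (Sub (Leq (Cst 1) (at2 aKl (Reg rV) (Reg rB)))
                      (Leq (Add (Reg rX) (Cst 2)) (at2 aKl (Reg rV) (Reg rB)))))
            (Store aNb (Reg rP) (Reg rB);; inc rP)
            Skip)
          Skip);;
       put2 aEn (Reg rX) (Reg rV) (Reg rP))).

Definition p_visit : cmd :=
  Assign rB (Arr aNb (Reg rK));;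
  If (at2 aEst (Reg rU) (Reg rB))
    Skip
    (put2 aEst (Reg rU) (Reg rB) (Reg rE);;
     put2 aEst (Reg rB) (Reg rU) (Reg rE);;
     Store aQu (Reg rT) (Reg rU);;
     Store aQv (Reg rT) (Reg rB);;
     Store aQu (Add (Reg rT) (Cst 1)) (Reg rB);;
     Store aQv (Add (Reg rT) (Cst 1)) (Reg rU);;
     Assign rT (Add (Reg rT) (Cst 2)));;
  inc rK.

Definition p_bfs : cmd :=
  Assign rT (Cst 0);;
  For rV (Reg rN)
    (put2 aEst (Reg rV) (Reg rV) (Cst 1);;
     Store aQu (Reg rT) (Reg rV);;
     Store aQv (Reg rT) (Reg rV);;
     inc rT);;
  Assign rH (Cst 0);;
  While (Leq (Add (Reg rH) (Cst 1)) (Reg rT))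
    (Assign rU (Arr aQu (Reg rH));;
     Assign rV (Arr aQv (Reg rH));;
     Assign rE (Add (at2 aEst (Reg rU) (Reg rV)) (Cst 1));;
     Assign rK (at2 aSt (Arr aLev (Reg rU)) (Reg rV));;
     While (Leq (Add (Reg rK) (Cst 1)) (at2 aEn (Arr aLev (Reg rU)) (Reg rV))) p_visit;;
     inc rH).

Section Search.
Variables (V n l q : nat) (e : rel nat).
Hypotheses (n_gt0 : 0 < n) (HV : 64 * (n * n * n) <= V).
Hypotheses (nl : n < 2 ^ l) (ln : 2 ^ l <= 2 * n) (q_gt0 : 0 < q) (q_le : q <= l).
Hypotheses (elt : forall i j, e i j -> i < n /\ j < n) (esym : symmetric e).

Let hV : 32 <= V. Proof. exact: V32 n_gt0 HV. Qed.
Let h1 : 64 * n <= V. Proof. exact: Vn1 n_gt0 HV. Qed.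
Let h2 : 64 * (n * n) <= V. Proof. exact: Vn2 n_gt0 HV. Qed.

Definition light_or (K : nat -> nat) (x v b : nat) : bool :=
  e v b && ((deg n e v < 2 ^ (x + q)) || (0 < K (v * n + b) <= x.+1)).

Definition lists (K lo hi nb : nat -> nat) (x v : nat) : Prop :=
  lo (x * n + v) <= hi (x * n + v) /\
  [seq nb j | j <- iota (lo (x * n + v)) (hi (x * n + v) - lo (x * n + v))] =
  seq.filter (light_or K x v) (iota 0 n).

Definition has_lists (st : state) : Prop := forall x v, x < l -> v < n ->
  lists (arr st aKl) (arr st aSt) (arr st aEn) (arr st aNb) x v.

Definition cnt (K lev : nat -> nat) (u v : nat) : nat :=
  count (light_or K (lev u) v) (iota 0 n).

(** The sum has one term for each ordered pair, as a pair enters the queue at most once. *)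
Definition bfs_cost (K lev : nat -> nat) : nat :=
  \sum_(c <- iota 0 (n * n)) (14 * cnt K lev (c %/ n) (c %% n) + 10).

Lemma tri_bfs (K lev : nat -> nat) st : arr st aKl = K -> arr st aLev = lev ->
  reg st rN = n -> offs n st -> has_lists st ->
  (forall u, u < n -> lev u < l) -> (forall i, arr st aEst i = 0) ->
  tri V p_bfs (bfs_cost K lev + 8 * n + 10) (fun st' => exists s,
    pairq n e lev (light_or K) (fun u v => arr st' aEst (u * n + v)) s (size s)) st.
Proof.
move=> hK hLev hN hO hL hlev hE.
have We x b b' : light_or K x b b' -> e b b' by case/andP.
rewrite /p_bfs; stp.
apply: (tri_seq (k1 := n * 6 + 2) (k2 := bfs_cost K lev + 2 * n + 7)); last lia.
pose I0 i st1 := [/\ reg st1 rT = i,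
  forall u v, u < n -> v < n -> arr st1 aEst (u * n + v) = ((u == v) && (u < i)) &
  forall j, j < i -> arr st1 aQu j = j /\ arr st1 aQv j = j].
apply: (tri_for hV (N := n) (K := 4) (I := I0)) => //.
- lia.
- by move=> st1 hf /=; rewrite hf.1.
- by split=> // u v _ _; rewrite /= hE andbF.
- lia.
- by move=> st1 st2 ha hr i [i1 i2 i3]; split; rewrite -?ha -?hr.
- move=> i st1 hi hf hb hxi [i1 i2 i3].
  have hO1 : arr st1 aOff = arr st aOff by rewrite hf.2.
  rewrite /put2; stp; stp; stp; rewrite /inc; stp.
  move=> _ _; rewrite i1 hxi hO1 hO ?(ltnW hi) // addn1; split=> //=; rewrite /upd /=.
    move=> u v hu hv; case: eqP => he.
      by have [-> ->] := index_inj hv hi he; rewrite eqxx ltnS leqnn.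
    rewrite i2 //; case: eqP => //= hE'; subst v; congr nat_of_bool.
    by rewrite ltnS [RHS]leq_eqVlt; case: eqP => // hE'; subst; case: he.
  move=> j; rewrite ltnS leq_eqVlt; case: eqP => [->|_] //=; exact: i3.
move=> st1 hf hb hxn [i1 i2 i3] hf1; stp.
pose f (p : nat * nat) := 14 * cnt K lev p.1 p.2 + 10.
pose g st2 u v := arr st2 aEst (u * n + v).
pose queue st2 (s : seq (nat * nat)) := size s = reg st2 rT /\
  forall i, i < size s -> (arr st2 aQu i, arr st2 aQv i) = nth (0, 0) s i.
have fsum s : uniq s -> (forall p, p \in s -> p.1 < n /\ p.2 < n) ->
    \sum_(p <- s) f p <= bfs_cost K lev.
  move=> us hs; have -> : \sum_(p <- s) f p =
      \sum_(c <- [seq p.1 * n + p.2 | p <- s]) (14 * cnt K lev (c %/ n) (c %% n) + 10).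
    rewrite big_map; apply: eq_big_seq => -[u v] /hs /= [hu hv].
    by rewrite divnMDl // modnMDl divn_small // modn_small // addn0.
  apply: leq_sum_uniq; last 1 first.
  - move=> c /mapP[p /hs[hu hv] ->]; rewrite mem_iota add0n /=; exact: index_lt.
  - rewrite map_inj_in_uniq // => -[u v] [u' v'] /hs[/= a1 a2] /hs[/= a3 a4] he.
    by have [-> ->] := index_inj a2 a4 he.
  - exact: iota_uniq.
pose phi st2 := bfs_cost K lev - \sum_(i < reg st2 rH) f (arr st2 aQu i, arr st2 aQv i).
have hphi st2 s : queue st2 s -> reg st2 rH <= size s ->
    \sum_(i < reg st2 rH) f (arr st2 aQu i, arr st2 aQv i) = \sum_(p <- take (reg st2 rH) s) f p.
  move=> [q1 q2] hs; rewrite (big_nth (0, 0)) size_takel // big_mkord.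
  by apply: eq_bigr => i _; rewrite nth_take // q2 //; apply: leq_trans hs.
pose I1 st2 := exists s, [/\ queue st2 s, reg st2 rH <= size s &
  pairq n e lev (light_or K) (g st2) s (reg st2 rH)].
apply: (tri_while hV (I := I1) (phi := phi)) => //.
- exists [seq (u, u) | u <- iota 0 n]; split=> //=.
    split=> /=; first by rewrite size_map size_iota /upd /= i1.
    move=> i; rewrite size_map size_iota => hi; rewrite (nth_map 0) ?size_iota // nth_iota //.
    by rewrite /upd /=; have [-> ->] := i3 i hi.
  rewrite /upd /=; apply: pairq_init => //.
    by rewrite map_inj_uniq ?iota_uniq // => u v [].
  by move=> u v hu hv; rewrite /g /= i2 // hu andbT.
- rewrite /phi /= /upd /=; lia.
- move=> st2 hf2 hb2 [s [[q1 q2] hs hq]] /=; case: leqP => // hle _.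
  have hh : reg st2 rH < size s by lia.
  have eO : arr st2 aOff = arr st aOff by rewrite hf2.2 //= hf.2.
  have eL : arr st2 aLev = lev by rewrite hf2.2 //= hf.2.
  have eK : arr st2 aKl = K by rewrite hf2.2 //= hf.2.
  have eS : arr st2 aSt = arr st aSt by rewrite hf2.2 //= hf.2.
  have eE : arr st2 aEn = arr st aEn by rewrite hf2.2 //= hf.2.
  have eN : arr st2 aNb = arr st aNb by rewrite hf2.2 //= hf.2.
  pose h := reg st2 rH; pose u := arr st2 aQu h; pose v := arr st2 aQv h.
  have huv : nth (0, 0) s h = (u, v) by rewrite -q2.
  have [hu hv hg0] := pq_nth hq hh; rewrite -/h huv /= in hu hv hg0.
  have hsz := pq_size hq.
  have hgb : g st2 u v <= n * n.
    by apply: leq_trans hsz; have := pq_idx hq hh; rewrite -/h huv /=; lia.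
  have hOl : arr st2 aOff (lev u) = lev u * n.
    by rewrite eO hO //; have := log_le nl ln; have := hlev u hu; lia.
  have hOu w : w < n -> arr st2 aOff w = w * n by move=> hw; rewrite eO hO // ltnW.
  have [ll1 ll2] := hL (lev u) v (hlev u hu) hv; rewrite hK in ll2.
  pose i0 := lev u * n + v; rewrite -/i0 in ll1 ll2.
  pose lo := arr st aSt i0; pose hi := arr st aEn i0.
  have hgE : g st2 u v = arr st2 aEst (u * n + v) by [].
  exists (14 * cnt K lev u v + 9); stp; stp; stp.
    by rewrite -/h -/u -/v hOu // -hgE; lia.
  rewrite -/h -/u -/v hOu //; stp.
  rewrite eL -/u hOl eS -/i0 -/lo.
  apply: (tri_seq (k1 := 14 * cnt K lev u v + 1) (k2 := 1)); last lia.
  have hcnt : hi - lo = cnt K lev u v.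
    by move/(congr1 size): ll2; rewrite size_map size_iota size_filter.
  (* Pushes only extend the queue. Its prefix up to the head stays fixed, so the current pair and
     the cost already charged do not change during an expansion. *)
  pose I2 st3 := exists s', [/\ queue st3 s', pairq n e lev (light_or K) (g st3) s' h,
    take h.+1 s' = take h.+1 s, size s <= size s' & [/\ lo <= reg st3 rK, reg st3 rK <= hi,
    forall j, lo <= j -> j < reg st3 rK -> 0 < g st3 u (arr st3 aNb j) &
    reg st3 rE = (g st3 u v).+1]].
  apply: (tri_while hV (I := I2) (phi := fun st3 => (hi - reg st3 rK) * 14)) => //.
  + exists s; split=> //; split=> //=.
    by move=> j; rewrite /upd /= => a1 a2; lia.
    by rewrite /upd /= addn1.
  + by rewrite /= /upd /= hcnt; lia.
  + move=> st3 hf3 hb3 [s' [[q3 q4] hq' htk hss [k1 k2 k3 k4]]] /=.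
    have gOu w : w < n -> arr st3 aOff w = w * n by move=> hw; rewrite hf3.2 //= /upd /= hOu.
    have rU3 : reg st3 rU = u by rewrite hf3.1.
    have rV3 : reg st3 rV = v by rewrite hf3.1.
    have eL3 : arr st3 aLev = lev by rewrite hf3.2.
    have eE3 : arr st3 aEn = arr st aEn by rewrite hf3.2.
    have eN3 : arr st3 aNb = arr st aNb by rewrite hf3.2.
    rewrite eL3 rU3 rV3 (_ : arr st3 aOff (lev u) = lev u * n); last by rewrite hf3.2.
    rewrite eE3 -/i0 -/hi addn1; case: ltnP => // hlt _.
    pose b := arr st aNb (reg st3 rK).
    have hbW : light_or K (lev u) v b && (b \in iota 0 n).
      rewrite -mem_filter -ll2; apply: map_f; rewrite mem_iota; lia.
    have hbn : b < n by case/andP: hbW; rewrite mem_iota.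
    have hbe : e v b by case/andP: hbW => /andP[].
    have hh' : h < size s' by apply: leq_trans hh hss.
    have huv' : nth (0, 0) s' h = (u, v).
      by rewrite -(nth_take (n0 := h.+1)) // htk nth_take.
    have hsz' := pq_size hq'.
    have hiV : hi <= V by rewrite /hi -eE3; apply: hb3.2.
    exists 12; rewrite /p_visit; stp; stp.
      rewrite rU3 gOu // => hne; stp.
      rewrite /inc; stp => _ _; split; last by lia.
      exists s'; split=> //; split=> //=; rewrite /upd /=; try lia.
      move=> j j1 j2; case: (ltnP j (reg st3 rK)) => j3; first exact: k3.
      have -> : j = reg st3 rK by lia.
      by rewrite /g /= lt0n; apply/eqP.
    rewrite rU3 gOu // eN3 -/b => hne.
    rewrite /put2; repeat stp.
    rewrite /inc; stp.
    rewrite rU3 !gOu // => _ _; split; last lia.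
    have hgg : forall u' v', u' < n -> v' < n ->
        (if u' * n + v' == b * n + u then reg st3 rE
         else if u' * n + v' == u * n + b then reg st3 rE else arr st3 aEst (u' * n + v')) =
        if ((u', v') == (u, b)) || ((u', v') == (b, u)) then (g st3 u v).+1 else g st3 u' v'.
      move=> u' v' hu' hv'; rewrite !xpair_eqE k4.
      have hix x y : x < n -> y < n -> (u' * n + v' == x * n + y) = (u' == x) && (v' == y).
        move=> hx hy; apply/eqP/andP => [|[/eqP -> /eqP ->] //].
        by move=> he; have [-> ->] := index_inj hv' hy he; rewrite !eqxx.
      by rewrite !hix // orbC; case: (_ && _) => //=; case: (_ && _).
    have hnew := pairq_push elt esym We hq' hh' huv' hbe hne hgg.
    exists (s' ++ [:: (u, b); (b, u)]); split=> //.
    * split=> /=; first by rewrite size_cat /= q3.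
      move=> i; rewrite size_cat /= /upd /= -q3 => hi'.
      rewrite nth_cat; case: (ltnP i (size s')) => his.
        have -> : (i == size s') = false by lia.
        have -> : (i == size s' + 1) = false by lia.
        exact: q4.
      case: (eqVneq i (size s')) => hi1.
        have -> : (i == size s' + 1) = false by lia.
        by rewrite hi1 subnn.
      have -> : i = size s' + 1 by lia.
      by rewrite eqxx addKn.
    * by rewrite takel_cat.
    * by rewrite size_cat; lia.
    * split=> //=; rewrite /upd /=; try lia.
        move=> j j1 j2; rewrite /g /= -/b hgg //; last first.
          have : arr st3 aNb j \in iota 0 n.
            have : arr st3 aNb j \in seq.filter (light_or K (lev u) v) (iota 0 n).
              by rewrite -ll2 eN3; apply: map_f; rewrite mem_iota; lia.
            by rewrite mem_filter => /andP[].
          by rewrite mem_iota.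
        case: ifP => // hnb; case: (ltnP j (reg st3 rK)) => j3; first exact: k3.
        have hj : j = reg st3 rK by lia.
        by move: hnb; rewrite hj eN3 -/b eqxx.
      have g3 : 0 < g st3 u v by have [] := pq_nth hq' hh'; rewrite huv'.
      rewrite /g /= hgg // k4; case: ifP => //; rewrite !xpair_eqE => /orP[]/andP[/eqP a1 /eqP a2].
        by move: g3; rewrite /g a2 hne.
      by move: g3; rewrite /g a2 {2}a1 hne.
  + move=> st3 hf3 hb3 [s' [[q3 q4] hq' htk hss [k1 k2 k3 k4]]] /=.
    have rU3 : reg st3 rU = u by rewrite hf3.1.
    have rV3 : reg st3 rV = v by rewrite hf3.1.
    have eL3 : arr st3 aLev = lev by rewrite hf3.2.
    have eE3 : arr st3 aEn = arr st aEn by rewrite hf3.2.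
    have eN3 : arr st3 aNb = arr st aNb by rewrite hf3.2.
    rewrite eL3 rU3 rV3 (_ : arr st3 aOff (lev u) = lev u * n); last by rewrite hf3.2.
    rewrite eE3 -/i0 -/hi addn1; case: ltnP => // hge _ _.
    have rH3 : reg st3 rH = h by rewrite hf3.1.
    have hh' : h < size s' by apply: leq_trans hh hss.
    have huv' : nth (0, 0) s' h = (u, v).
      by rewrite -(nth_take (n0 := h.+1)) // htk nth_take.
    have hsz' := pq_size hq'.
    have hq2 : pairq n e lev (light_or K) (g st3) s' h.+1.
      apply: (pairq_next elt We hq' hh' huv') => b hb'.
      have : b \in seq.filter (light_or K (lev u) v) (iota 0 n).
        by rewrite mem_filter hb' mem_iota /=; case/elt: (We _ _ _ hb').
      rewrite -ll2 => /mapP[j]; rewrite mem_iota => hj ->; rewrite -eN3.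
      by apply: k3; lia.
    rewrite /inc; stp => _ _; rewrite rH3 addn1; split.
      by exists s'; split; rewrite /= /upd.
    have hS := fsum (take h.+1 s) (take_uniq _ (pq_uniq hq)).
    have {}hS : \sum_(p <- take h.+1 s) f p <= bfs_cost K lev.
      apply: hS => -[u' v'] /mem_take; rewrite (pq_mem hq).
      by case/and3P.
    have e1 : \sum_(i < h.+1) f (arr st3 aQu i, arr st3 aQv i) = \sum_(p <- take h.+1 s) f p.
      rewrite -htk (big_nth (0, 0)) size_takel // big_mkord.
      by apply: eq_bigr => i _; rewrite nth_take // q4 //; apply: leq_trans hh'.
    rewrite /phi /= /upd /= e1 -/h (hphi st2 s) // -/h.
    move: hS; rewrite (take_nth (0, 0) hh) -cats1 big_cat big_seq1 /= huv /f /= -/h; lia.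
- move=> st2 hf2 hb2 [s [q1 hs hq]] /=; case: leqP => // hle _.
  have hh : reg st2 rH = size s by case: q1 => q1 _; lia.
  by exists s; rewrite -hh.
Qed.

End Search.

(** * Neighbour lists for all levels *)

Section Lists.
Variables (V n l q : nat) (e : rel nat).
Hypotheses (n_gt0 : 0 < n) (HV : 64 * (n * n * n) <= V).
Hypotheses (nl : n < 2 ^ l) (ln : 2 ^ l <= 2 * n) (q_gt0 : 0 < q) (q_le : q <= l).

Let hV : 32 <= V. Proof. exact: V32 n_gt0 HV. Qed.
Let h1 : 64 * n <= V. Proof. exact: Vn1 n_gt0 HV. Qed.
Let h2 : 64 * (n * n) <= V. Proof. exact: Vn2 n_gt0 HV. Qed.

Local Notation light_or := (light_or n q e).
Local Notation lists := (lists n q e).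
Local Notation has_lists := (has_lists n l q e).

Lemma lists_ext K lo lo' hi hi' nb nb' x v :
  lo' (x * n + v) = lo (x * n + v) -> hi' (x * n + v) = hi (x * n + v) ->
  (forall j, j < hi (x * n + v) -> nb' j = nb j) ->
  lists K lo hi nb x v -> lists K lo' hi' nb' x v.
Proof.
rewrite /lists => -> -> hj [a1 a2]; split=> //; rewrite -a2.
by apply/eq_in_map => j; rewrite mem_iota => hj'; apply: hj; lia.
Qed.

Lemma tri_lists (K : nat -> nat) st : arr st aKl = K -> reg st rN = n -> reg st rL = l ->
  reg st rQ = q -> offs n st -> (forall i, i <= 2 * l -> arr st aPw i = 2 ^ i) ->
  (forall i j, i < n -> j < n -> arr st aAdj (i * n + j) = e i j) ->
  (forall v, v < n -> arr st aDeg v = deg n e v) ->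
  tri V p_lists (l * (n * (n * 7 + 8) + 8) + 10) has_lists st.
Proof.
move=> hK hN hL hQ hO hP hA hD; have hln := log_le nl ln; rewrite /p_lists; stp.
pose G i st1 := forall x v, v < n -> x * n + v < i ->
  lists K (arr st1 aSt) (arr st1 aEn) (arr st1 aNb) x v /\ arr st1 aEn (x * n + v) <= reg st1 rP.
have GE i st1 st2 : arr st1 = arr st2 -> reg st1 rP = reg st2 rP -> G i st1 -> G i st2.
  by move=> ha hr hG x v; rewrite -ha -hr; apply: hG.
apply: (tri_for hV (N := l) (K := n * (n * 7 + 8) + 4)
  (I := fun x st1 => G (x * n) st1 /\ reg st1 rP <= x * n * n)) => //.
- lia.
- by move=> st1 hf /=; rewrite hf.1 //= /upd /= hL.
- lia.
- by move=> st1 st2 ha hr i [i1 i2]; rewrite -hr //; split=> //; apply: GE i1 => //; apply: hr.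
- move=> x st1 hx hf hb hxi [i1 i2].
  apply: (tri_for hV (N := n) (K := n * 7 + 5)
    (I := fun v st1 => G (x * n + v) st1 /\ reg st1 rP <= (x * n + v) * n)) => //.
  + lia.
  + by move=> st2 hf2 /=; rewrite hf2.1 //= /upd /= hf.1.
  + by rewrite addn0; split=> //; apply: GE i1.
  + lia.
  + by move=> st2 st3 ha hr i [j1 j2]; rewrite -hr //; split=> //; apply: GE j1 => //; apply: hr.
  + move=> v st2 hv hf2 hb2 hvi [j1 j2].
    have eX : reg st2 rX = x by rewrite hf2.1.
    have eO2 : arr st2 aOff = arr st aOff by rewrite hf2.2 //= /upd /= hf.2.
    have eO w : w < n -> arr st2 aOff w = w * n by move=> hw; rewrite eO2 hO // ltnW.
    have hxn : x < n by lia.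
    pose idx := x * n + v.
    (* Positions in [aNb] run through [l * n] lists of at most [n] entries. These are the stored
       values that require a cubic [V]. *)
    have hidx : idx.+1 * n <= n * n * n by rewrite leq_mul2r index_lt ?orbT.
    rewrite /put2; stp; rewrite eX eO // hvi -/idx.
    pose P0 := reg st2 rP.
    apply: (tri_seq (k1 := n * 7 + 2) (k2 := 1)); last lia.
    pose Ib b st3 := [/\ G idx st3, arr st3 aSt idx = P0, P0 <= reg st3 rP,
      [seq arr st3 aNb j | j <- iota P0 (reg st3 rP - P0)] = seq.filter (light_or K x v) (iota 0 b) &
      reg st3 rP <= idx * n + b].
    apply: (tri_for hV (N := n) (K := 5) (I := Ib)) => //.
    * lia.
    * by move=> st3 hf3 /=; rewrite hf3.1 //= /upd /= hf2.1 //= /upd /= hf.1.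
    * split=> //=; rewrite /upd /= ?subnn ?addn0 ?eqxx //.
      move=> x' v' hv' hlt /=; have [j3 j4] := j1 x' v' hv' hlt.
      split=> //; apply: lists_ext j3 => //=; rewrite /upd /=.
      by case: eqP => // he; move: hlt; rewrite he ltnn.
    * lia.
    * move=> st3 st4 ha hr i [b1 b2 b3 b4 b5]; split; rewrite -?ha -?hr //.
      by apply: GE b1 => //; apply: hr.
    * move=> b st3 hbn hf3 hb3 hbi [b1 b2 b3 b4 b5].
      have eX3 : reg st3 rX = x by rewrite hf3.1.
      have eV3 : reg st3 rV = v by rewrite hf3.1.
      have eQ3 : reg st3 rQ = q by rewrite hf3.1 //= /upd /= hf2.1 //= /upd /= hf.1.
      have eK3 : arr st3 aKl = K by rewrite hf3.2 //= /upd /= hf2.2 //= /upd /= hf.2.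
      have eO3 w : w < n -> arr st3 aOff w = w * n by move=> hw; rewrite hf3.2 //= /upd /= eO.
      have eA3 : arr st3 aAdj = arr st aAdj by rewrite hf3.2 //= /upd /= hf2.2 //= /upd /= hf.2.
      have eD3 : arr st3 aDeg = arr st aDeg by rewrite hf3.2 //= /upd /= hf2.2 //= /upd /= hf.2.
      have eP3 : arr st3 aPw = arr st aPw by rewrite hf3.2 //= /upd /= hf2.2 //= /upd /= hf.2.
      have hS : iota 0 b.+1 = iota 0 b ++ [:: b] by rewrite -addn1 iotaD.
      have skip st4 : light_or K x v b = false -> arr st4 = arr st3 -> reg st4 = reg st3 -> Ib b.+1 st4.
        move=> hl ha hr; split; rewrite ?ha ?hr //; try lia.
          by apply: GE b1; rewrite ?hr.
        by rewrite hS filter_cat /= hl cats0.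
      stp; rewrite eV3 hbi eO3 // eA3 hA //; last first.
        case hE: (e v b) => // _; stp => _; apply: skip => //.
        by rewrite /light_or hE.
      case hE: (e v b) => // _.
      have hcond : eval st3 (Add (Leq (Add (Arr aDeg (Reg rV)) (Cst 1)) (Arr aPw (Add (Reg rX) (Reg rQ))))
                 (Sub (Leq (Cst 1) (at2 aKl (Reg rV) (Reg rB)))
                      (Leq (Add (Reg rX) (Cst 2)) (at2 aKl (Reg rV) (Reg rB))))) <> 0 <-> light_or K x v b.
        rewrite /= eV3 hbi eO3 // eX3 eQ3 eD3 eP3 eK3 hD // hP; last lia.
        rewrite /light_or hE /= addn1 addn2.
        by case: (deg n e v < 2 ^ (x + q)); case: (ltnP 0 (K _)); case: (ltnP x.+1 (K _)); lia.
      apply: tri_if => //; last first.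
        move=> h0; stp => _; apply: skip => //.
        by apply/negbTE/negP => /hcond; apply.
      move/hcond => hl /=; stp; rewrite /inc; stp.
      move=> _ _; rewrite /Ib hS hbi; split=> //=; rewrite /upd /=; try lia.
      -- move=> x' v' hv' hlt /=; have [j3 j4] := b1 x' v' hv' hlt.
         rewrite /upd /=; split; last lia.
         apply: lists_ext j3 => //= j hj; case: eqP => // he; lia.
      -- rewrite filter_cat /= hl -b4.
         have -> : reg st3 rP + 1 - P0 = (reg st3 rP - P0) + 1 by lia.
         rewrite iotaD map_cat /= subnKC // eqxx; congr (_ ++ _).
         apply/eq_in_map => j; rewrite mem_iota subnKC // => /andP[_ hj].
         by rewrite ltn_eqF.
    * move=> st3 hf3 hb3 hbi [b1 b2 b3 b4 b5] _.
      have eX3 : reg st3 rX = x by rewrite hf3.1.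
      have eV3 : reg st3 rV = v by rewrite hf3.1.
      have eO3 w : w < n -> arr st3 aOff w = w * n by move=> hw; rewrite hf3.2 //= /upd /= eO.
      stp => _ _; rewrite eX3 eV3 eO3 // -/idx; split; rewrite /= /upd /=; last first.
        by rewrite addnS mulSn addnC -/idx.
      move=> x' v' hv'; rewrite addnS ltnS leq_eqVlt /= /upd /= => /orP[/eqP he|hlt].
        have [? ?] := index_inj hv' hv he; subst x' v'; rewrite eqxx; split=> //.
        by rewrite /lists -/idx /upd /= eqxx b2.
      have [j3 j4] := b1 x' v' hv' hlt.
      have hne : (x' * n + v' == idx) = false by rewrite ltn_eqF.
      by rewrite hne; split=> //; apply: lists_ext j3 => //=; rewrite hne.
  + move=> st2 hf2 hb2 hvi [j1 j2] _.
    by split; [rewrite mulSn addnC|rewrite mulSn [n + _]addnC].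
- move=> st1 hf hb hxi [i1 i2] x v hx hv; rewrite hf.2 //= /upd /= hK.
  have hi : x * n + v < l * n.
    by have : x.+1 * n <= l * n; [rewrite leq_mul2r hx orbT|rewrite mulSn; lia].
  by have [] := i1 x v hv hi.
Qed.

End Lists.

(** * Search forests *)

Lemma leq_count_upd (P : nat -> bool) (f : nat -> nat) i v (s : seq nat) : uniq s ->
  count (fun j => P (upd f i v j)) s <= count (fun j => P (f j)) s + 1.
Proof.
move=> us; have : count (fun j => P (upd f i v j)) s <=
    count (predU (fun j => P (f j)) (pred1 i)) s.
  by apply: sub_count => j /=; rewrite /upd; case: (j == i); rewrite ?orbT ?orbF.
move/leq_trans; apply; have := count_predUI (fun j => P (f j)) (pred1 i) s.
rewrite (count_uniq_mem i us); by case: (i \in s) => /=; lia.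
Qed.

(** The stamp [rX + 1] makes clearing [aVis] between levels unnecessary. Overwriting an entry of
    [aKl] by 1 only admits the edge on more levels. *)
Definition p_forest : cmd :=
  For rX (Reg rL)
    (Assign rT (Cst 0);;
     For rV (Reg rN)
      (If (Leq (Reg rX) (Arr aLev (Reg rV)))
        (Store aVis (Reg rV) (Add (Reg rX) (Cst 1));;
         Store aF (Reg rT) (Reg rV);;
         inc rT)
        Skip);;
     Assign rH (Cst 0);;
     While (Leq (Add (Reg rH) (Cst 1)) (Reg rT))
      (Assign rV (Arr aF (Reg rH));;
       For rB (Reg rN)
        (If (at2 aAdj (Reg rV) (Reg rB))
          (If (Leq (Add (Reg rX) (Cst 1)) (Arr aVis (Reg rB)))
            Skip
            (Store aVis (Reg rB) (Add (Reg rX) (Cst 1));;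
             Store aF (Reg rT) (Reg rB);;
             inc rT;;
             put2 aKl (Reg rV) (Reg rB) (Cst 1);;
             put2 aKl (Reg rB) (Reg rV) (Cst 1)))
          Skip);;
       inc rH)).

Section VertexQueue.

Variables (n : nat) (e : rel nat) (lev : nat -> nat) (x : nat).
Hypothesis (elt : forall i j, e i j -> i < n /\ j < n).

(* Breadth-first search from the set of vertices of level at least [x]; [D] is
   the distance, which is not stored by the program, and [H] contains the edges
   of the search forest. *)
Record vertexq (H : rel nat) (D : nat -> nat) (s : seq nat) (h : nat) : Prop := Vertexq {
  vq_uniq : uniq s;
  vq_lt : forall v, v \in s -> v < n;
  vq_sort : forall i j, i <= j -> j < size s -> D (nth 0 s i) <= D (nth 0 s j);
  vq_lim : forall j, j < size s -> h < size s -> D (nth 0 s j) <= (D (nth 0 s h)).+1;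
  vq_root : forall a, a < n -> x <= lev a -> a \in s /\ D a = 0;
  vq_path : forall v, v \in s ->
    exists p, [/\ x <= lev p, wlk H (D v) v p & wlk H (D v) p v];
  vq_clo : forall i b, i < h -> i < size s -> e (nth 0 s i) b ->
    b \in s /\ D b <= (D (nth 0 s i)).+1 }.

Lemma vq_size H D s h : vertexq H D s h -> size s <= n.
Proof.
move=> hq; rewrite -[X in _ <= X](size_iota 0); apply: uniq_leq_size (vq_uniq hq) _.
by move=> v /(vq_lt hq); rewrite mem_iota.
Qed.

Lemma vertexq_next H D s h : vertexq H D s h -> h < size s ->
  (forall b, e (nth 0 s h) b -> b \in s) -> vertexq H D s h.+1.
Proof.
move=> hq hh hb; have [h1 h2 h3 h4 h5 h6 h7] := hq; split=> //.
  by move=> j hj hj'; apply: leq_trans (h4 j hj hh) _; rewrite ltnS h3.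
move=> i b; rewrite ltnS leq_eqVlt => /orP[/eqP ->|]; last exact: h7.
move=> _ /hb hbs; split=> //.
by move: (hbs) => /(nthP 0)[j hj <-]; apply: h4.
Qed.

Lemma vertexq_push (H H' : rel nat) D s h b : vertexq H D s h -> h < size s ->
  e (nth 0 s h) b -> b \notin s -> (forall u v, H u v -> H' u v) ->
  H' (nth 0 s h) b -> H' b (nth 0 s h) ->
  vertexq H' (upd D b (D (nth 0 s h)).+1) (rcons s b) h.
Proof.
move=> hq hh heb hbs hH hb1 hb2; have [h1 h2 h3 h4 h5 h6 h7] := hq.
set v := nth 0 s h in heb hb1 hb2 *.
have hvs : v \in s by apply: mem_nth.
have old u : u \in s -> upd D b (D v).+1 u = D u.
  by move=> hu; rewrite /upd; case: eqP => // hE; move: hbs; rewrite -hE hu.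
have oldn i : i < size s -> upd D b (D v).+1 (nth 0 s i) = D (nth 0 s i).
  by move=> hi; rewrite old // mem_nth.
have new : upd D b (D v).+1 b = (D v).+1 by rewrite /upd eqxx.
split.
- by rewrite rcons_uniq hbs.
- by move=> u; rewrite mem_rcons inE => /orP[/eqP ->|/h2 //]; case/elt: heb.
- move=> i j hij; rewrite size_rcons ltnS !nth_rcons leq_eqVlt => /orP[/eqP hj|hj].
    rewrite hj ltnn eqxx new; case: ltngtP => hi; [|lia|by rewrite new].
    by rewrite oldn //; apply: h4.
  by rewrite hj (leq_ltn_trans hij hj) !oldn ?(leq_ltn_trans hij hj) // h3.
- move=> j; rewrite size_rcons ltnS => hj _; rewrite !nth_rcons hh (oldn h) //.
  move: hj; rewrite leq_eqVlt => /orP[/eqP ->|hj]; first by rewrite ltnn eqxx new.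
  by rewrite hj oldn // h4.
- move=> a ha hx; have [h8 h9] := h5 a ha hx.
  by rewrite mem_rcons inE h8 orbT old.
- move=> u; rewrite mem_rcons inE => /orP[/eqP ->|hu].
    rewrite new; have [p [p1 p2 p3]] := h6 v hvs; exists p; split=> //.
      rewrite -add1n; apply: (@wlk_trans _ _ _ _ v); first exact: wlk1.
      exact: wlk_sub p2.
    rewrite -addn1; apply: (@wlk_trans _ _ _ _ v); last exact: wlk1.
    exact: wlk_sub p3.
  rewrite old //; have [p [p1 p2 p3]] := h6 u hu; exists p.
  by split=> //; [apply: wlk_sub p2|apply: wlk_sub p3].
- move=> i c hi _; have his := ltn_trans hi hh; rewrite nth_rcons his oldn // => hc.
  have [h8 h9] := h7 i c hi his hc.
  by rewrite mem_rcons inE h8 orbT old.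
Qed.

Lemma vertexq_init (H : rel nat) : vertexq H (fun=> 0) [seq v <- iota 0 n | x <= lev v] 0.
Proof.
split=> //.
- by rewrite filter_uniq // iota_uniq.
- by move=> v; rewrite mem_filter mem_iota => /andP[_].
- by move=> a ha hx; rewrite mem_filter hx mem_iota.
- by move=> v; rewrite mem_filter => /andP[hx _]; exists v; split=> //=.
Qed.

(** The root [p] is one at distance [D u] from [u], and [D u <= r] because the completed search also
    accounts for the walk from [a]. The root [a] itself may lie in another tree. *)
Lemma vertexq_done H D s : symmetric e -> vertexq H D s (size s) ->
  forall u a r, a < n -> x <= lev a -> wlk e r u a ->
  exists p, [/\ x <= lev p, wlk H r u p & wlk H r p u].
Proof.
move=> esym hq u a r ha hx /(wlk_sym esym) hw.
suff [hu hD] : u \in s /\ D u <= r.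
  have [p [p1 p2 p3]] := vq_path hq hu; exists p.
  by split=> //; [apply: wlk_mono p2|apply: wlk_mono p3].
elim: r u hw => [|r IH] u /=; first by move=> <-; have [-> ->] := vq_root hq ha hx.
case=> [/IH[h1 h2]|[v /IH[h1 h2] hvu]]; first by split=> //; apply: leqW.
move: h1 => /(nthP 0)[i hi hv]; subst v.
have [h3 h4] := vq_clo hq hi hi hvu; split=> //.
by apply: leq_trans h4 _; rewrite ltnS.
Qed.

End VertexQueue.

Section Forest.
Variables (V n l : nat) (e : rel nat).
Hypotheses (n_gt0 : 0 < n) (HV : 64 * (n * n * n) <= V).
Hypotheses (nl : n < 2 ^ l) (ln : 2 ^ l <= 2 * n).
Hypotheses (elt : forall i j, e i j -> i < n /\ j < n) (esym : symmetric e).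

Let hV : 32 <= V. Proof. exact: V32 n_gt0 HV. Qed.
Let h1 : 64 * n <= V. Proof. exact: Vn1 n_gt0 HV. Qed.

Definition low (K : nat -> nat) (y : nat) : nat :=
  count (fun i => 0 < K i <= y.+1) (iota 0 (n * n)).

Definition base_edge (K : nat -> nat) : rel nat := fun u v => e u v && (K (u * n + v) == 1).

Definition forest (lev K : nat -> nat) (x : nat) : Prop :=
  forall u a r, a < n -> x <= lev a -> wlk e r u a ->
  exists p, [/\ x <= lev p, wlk (base_edge K) r u p & wlk (base_edge K) r p u].

Lemma low_upd K i y : low (upd K i 1) y <= low K y + 1.
Proof. exact: (@leq_count_upd (fun m => 0 < m <= y.+1) K i 1 _ (iota_uniq _ _)). Qed.

Lemma base_edge_upd K i u v : base_edge K u v -> base_edge (upd K i 1) u v.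
Proof. by rewrite /base_edge /upd; case: ifP => // _ /andP[-> _]. Qed.

Lemma forest_upd lev K i x : forest lev K x -> forest lev (upd K i 1) x.
Proof.
move=> hf u a r ha hx hw; have [p [p1 p2 p3]] := hf u a r ha hx hw.
by exists p; split=> //; [apply: wlk_sub p2|apply: wlk_sub p3] => ? ?; apply: base_edge_upd.
Qed.

(** At most [n] edges are linked in each forest, in both directions, so the [l] forests together add
    at most [2 * n * l] links. *)
Lemma tri_forest (K lev : nat -> nat) st : arr st aKl = K -> arr st aLev = lev ->
  reg st rN = n -> reg st rL = l -> offs n st -> (forall i, arr st aVis i = 0) ->
  (forall i j, i < n -> j < n -> arr st aAdj (i * n + j) = e i j) ->
  tri V p_forest (l * (n * (n * 12 + 20) + 14) + 10) (fun st' =>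
    [/\ forall i, arr st' aKl i = K i \/ arr st' aKl i = 1,
      forall y, low (arr st' aKl) y <= low K y + 2 * n * l &
      forall x, x < l -> forest lev (arr st' aKl) x]) st.
Proof.
move=> hK hLev hN hL hO hVis hA; have hln := log_le nl ln; rewrite /p_forest.
pose I x st1 := [/\ forall i, arr st1 aVis i <= x,
  forall i, arr st1 aKl i = K i \/ arr st1 aKl i = 1,
  forall y, low (arr st1 aKl) y <= low K y + 2 * n * x &
  forall x', x' < x -> forest lev (arr st1 aKl) x'].
apply: (tri_for hV (N := l) (K := n * (n * 12 + 20) + 10) (I := I)) => //;
  last by move=> st1 hf hb _ [i1 i2 i3 i4].
- lia.
- by move=> st1 hf /=; rewrite hf.1.
- split=> //= [i|i|y]; rewrite ?hVis ?hK ?muln0 ?addn0 //; by left.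
- lia.
- by move=> st1 st2 ha hr i; rewrite /I ha.
- move=> x st1 hx hf hb hxi [i1 i2 i3 i4].
have eN : reg st1 rN = n by rewrite hf.1.
have eO w : w < n -> arr st1 aOff w = w * n by move=> hw; rewrite hf.2 //= hO // ltnW.
have eA i j : i < n -> j < n -> arr st1 aAdj (i * n + j) = e i j.
  by move=> hi hj; rewrite hf.2 //= hA.
have eL : arr st1 aLev = lev by rewrite hf.2.
stp; apply: (tri_seq (k1 := n * 6 + 2) (k2 := n * (n * 12 + 14) + 7)); last lia.
pose Q st2 s := size s = reg st2 rT /\ forall i, i < size s -> arr st2 aF i = nth 0 s i.
pose S v := [seq u <- iota 0 v | x <= lev u].
apply: (tri_for hV (N := n) (K := 4) (I := fun v st2 =>
    [/\ forall i, arr st2 aVis i <= x.+1, Q st2 (S v) &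
      forall b, b < n -> (x < arr st2 aVis b) = (b \in S v)])) => //.
- lia.
- by move=> st2 hf2 /=; rewrite hf2.1.
- split=> //= [i|b hb']; first by apply: leqW.
  by rewrite ltnNge i1.
- lia.
- move=> st2 st3 ha hr i [j1 [j2 j3] j4]; split; rewrite -?ha //.
  by split; rewrite -?ha -?hr.
- move=> v st2 hv hf2 hb2 hvi [j1 [j2 j3] j4].
  have eX : reg st2 rX = x by rewrite hf2.1.
  have eL2 : arr st2 aLev = lev by rewrite hf2.2.
  have hS : S v.+1 = S v ++ [seq u <- [:: v] | x <= lev u].
    by rewrite /S -addn1 iotaD filter_cat.
  have hsz : size (S v) <= v.
    by rewrite -[X in _ <= X](size_iota 0) size_filter count_size.
  stp; rewrite eL2 eX hvi; last first.
    case: leqP => // hlt _; stp => _; rewrite hS /= leqNgt hlt /= cats0; by split.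
  case: leqP => // hle _; do 2 stp; rewrite /inc; stp.
  move=> _ _; rewrite eX hvi hS /= hle; split=> /=.
  + by move=> i; rewrite /upd /=; case: eqP => // _; lia.
  + split; first by rewrite /= /upd /= size_cat -j2.
    move=> i; rewrite size_cat /= /upd /= nth_cat -j2 => hi.
    case: ltngtP => hi'; [exact: j3|lia|by rewrite hi' subnn].
  + move=> b hbn; rewrite /upd /= mem_cat inE -j4 //; case: (eqVneq b v) => [->|hbv].
      by rewrite orbT addn1 ltnS leqnn.
    by rewrite orbF.
move=> st2 hf2 hb2 hvn [j1 [j2 j3] j4] hf2'; stp.
have eK2 : arr st2 aKl = arr st1 aKl by rewrite hf2.2.
have eX2 : reg st2 rX = x by rewrite hf2.1.
pose J st3 s D := [/\ forall i, arr st3 aVis i <= x.+1, Q st3 s,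
   forall b, b < n -> (x < arr st3 aVis b) = (b \in s),
   [/\ forall i, arr st3 aKl i = K i \/ arr st3 aKl i = 1,
    forall y, low (arr st3 aKl) y <= low K y + 2 * n * x + 2 * size s &
    forall x', x' < x -> forest lev (arr st3 aKl) x'] &
   vertexq n e lev x (base_edge (arr st3 aKl)) D s (reg st3 rH)].
apply: (tri_while hV (I := fun st3 => exists s D, J st3 s D /\ reg st3 rH <= size s)
   (phi := fun st3 => (n - reg st3 rH) * (n * 12 + 12))) => //.
- exists (S n), (fun=> 0); split=> //; split=> //=; rewrite ?eK2 //.
  + split=> // y; apply: leq_trans (i3 y) _; lia.
  + exact: vertexq_init.
- rewrite /= /upd /=; lia.
- move=> st3 hf3 hb3 [s [D [[k1 [k2 k3] k4 [k5 k6 k7] k8] hs]]] /=; case: leqP => // hle _.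
  have hh : reg st3 rH < size s by lia.
  have hsn := vq_size k8.
  have eX3 : reg st3 rX = x by rewrite hf3.1 //= /upd /= hf2.1 //= /upd /= hxi.
  pose v := nth 0 s (reg st3 rH).
  have hv : v < n by apply: (vq_lt k8); apply: mem_nth.
  have h3O w : w < n -> arr st3 aOff w = w * n.
    by move=> hw; rewrite hf3.2 //= /upd /= hf2.2 //= eO.
  have h3A : arr st3 aAdj = arr st1 aAdj by rewrite hf3.2 //= /upd /= hf2.2.
  have h3N : reg st3 rN = n by rewrite hf3.1 //= /upd /= hf2.1.
  exists (n * 12 + 10); stp; rewrite k3 // -/v.
  apply: (tri_seq (k1 := n * 11 + 2) (k2 := 1)); last lia.
  pose Jb b st4 := exists s D, [/\ J st4 s D, reg st4 rH < size s, nth 0 s (reg st4 rH) = v &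
    forall b', b' < b -> e v b' -> b' \in s].
  apply: (tri_for hV (N := n) (K := 9) (I := Jb)) => //.
  + lia.
  + by move=> st4 hf4 /=; rewrite hf4.1.
  + by exists s, D; split.
  + lia.
  + move=> st4 st5 ha hr b [s' [D' [[m1 [m2 m3] m4 [m5 m6 m7] m8] m9 m10 m11]]].
    exists s', D'; rewrite -hr //; split=> //; split; rewrite -?ha //; first by split; rewrite -?ha -?hr.
    by rewrite -hr.
  + move=> b st4 hbn hf4 hb4 hbi [s' [D' [[m1 [m2 m3] m4 [m5 m6 m7] m8] m9 m10 m11]]].
    have eV4 : reg st4 rV = v by rewrite hf4.1 //= /upd.
    have eX4 : reg st4 rX = x by rewrite hf4.1 //= /upd.
    have eA4 : arr st4 aAdj = arr st1 aAdj by rewrite hf4.2.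
    have eO4 w : w < n -> arr st4 aOff w = w * n by move=> hw; rewrite hf4.2 //= h3O.
    have hsn' := vq_size m8.
    have skip st5 : (e v b -> b \in s') -> arr st5 = arr st4 -> reg st5 = reg st4 -> Jb b.+1 st5.
      move=> hvb ha hr; exists s', D'; rewrite /J /Q ha hr; split=> //.
      by move=> b'; rewrite ltnS leq_eqVlt => /orP[/eqP ->|] //; apply: m11.
    stp; rewrite eV4 hbi eO4 // eA4 eA //; last first.
      by case hE: (e v b) => // _; stp => _; apply: skip; rewrite ?hE.
    case hE: (e v b) => // _; stp; rewrite eX4 hbi addn1 m4 //.
      case hbs: (b \in s') => // _; stp => _; apply: skip => //.
    case hbs: (b \in s') => // _; repeat stp.
    rewrite /inc /put2; repeat stp; rewrite eX4 eV4 hbi !eO4 //.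
    move=> _ _; set K' := upd (upd (arr st4 aKl) (v * n + b) 1) (b * n + v) 1.
    have hrS : size (rcons s' b) = reg st4 rT + 1 by rewrite size_rcons m2 addn1.
    exists (rcons s' b), (upd D' b (D' v).+1); rewrite /= /upd /=; split=> //.
    * split; rewrite /= /upd /=.
      -- by move=> i; case: eqP => // _; rewrite addn1.
      -- split=> //= i; rewrite size_rcons nth_rcons -m2 /= /upd /= => hi.
         case: ltngtP => hi'; [exact: m3|lia|by []].
      -- move=> b' hb'; rewrite mem_rcons inE; case: eqP => [->|_]; first by rewrite addn1 leqnn.
         exact: m4.
      -- split.
         ++ move=> i; case: eqP => _; first by right.
            by case: eqP => _; [right|apply: m5].
         ++ move=> y; change (low K' y <= low K y + 2 * n * x + 2 * size (rcons s' b)).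
            have := low_upd (upd (arr st4 aKl) (v * n + b) 1) (b * n + v) y.
            have := low_upd (arr st4 aKl) (v * n + b) y; have := m6 y.
            by rewrite size_rcons -/K'; lia.
         ++ by move=> x' hx'; change (forest lev K' x'); do 2 apply: forest_upd; apply: m7.
      -- have hpush := @vertexq_push n e lev x elt _ (base_edge K') D' s' _ b m8 m9.
         rewrite m10 in hpush; apply: hpush => //; first by rewrite hbs.
         ** by move=> u w hu; do 2 apply: base_edge_upd.
         ** by rewrite /base_edge hE /K' /upd eqxx; case: ifP.
         ** by rewrite /base_edge esym hE /K' /upd eqxx.
    * by rewrite size_rcons; apply: leqW.
    * by rewrite nth_rcons m9.
    * move=> b'; rewrite ltnS leq_eqVlt => /orP[/eqP -> _|hlt /(m11 _ hlt) h'].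
        by rewrite mem_rcons inE eqxx.
      by rewrite mem_rcons inE h' orbT.
  + move=> st4 hf4 hb4 hbi [s' [D' [[m1 [m2 m3] m4 [m5 m6 m7] m8] m9 m10 m11]]] _.
    have hH4 : reg st4 rH = reg st3 rH by rewrite hf4.1.
    have hsn' := vq_size m8.
    rewrite /inc; stp => _ _; rewrite hH4 addn1; split; last first.
      have -> : n - reg st3 rH = (n - (reg st3 rH).+1).+1 by lia.
      by rewrite mulSn; lia.
    exists s', D'; split; last by rewrite -hH4.
    split=> //; rewrite /= /upd /= -hH4; apply: vertexq_next => // b'; rewrite m10 => hb'.
    by apply: m11 => //; case/elt: hb'.
- move=> st3 hf3 hb3 [s [D [[k1 [k2 k3] k4 [k5 k6 k7] k8] hs]]] /=; case: leqP => // hlt _.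
  have hh : reg st3 rH = size s by lia.
  have hsn := vq_size k8.
  rewrite hh in k8; move=> _; split=> //.
    move=> y; apply: leq_trans (k6 y) _; rewrite mulnS; lia.
  move=> x'; rewrite ltnS leq_eqVlt => /orP[/eqP ->|] //; last exact: k7.
  move=> u a r ha hxa hw; exact: (vertexq_done esym k8 ha hxa hw).
Qed.

End Forest.

(** * Levels and explored balls *)

Arguments wlk : simpl never.

Definition p_link (a b : nat) : cmd :=
  If (at2 aKl (Reg a) (Reg b)) Skip (put2 aKl (Reg a) (Reg b) (Add (Reg rX) (Cst 1))).

Definition p_scan : cmd :=
  Assign rJ (Cst 0);;
  While (Sub (Leq (Add (Reg rJ) (Cst 1)) (Arr aDeg (Reg rY))) (Leq (Reg rM) (Reg rC)))
    (Assign rB (at2 aAl (Reg rY) (Reg rJ));;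
     If (Leq (Reg rS) (Arr aFd (Reg rB)))
       Skip
       (Store aFd (Reg rB) (Reg rS);;
        Store aF (Reg rC) (Reg rB);;
        inc rC;;
        p_link rY rB;;
        p_link rB rY);;
     inc rJ).

(* Breadth-first search from [rV], stopped at radius [rho] or as soon as [rM]
   vertices have been found; its edges are linked on level [rX].  The vertices
   found by the current search are those with the value [rS] in [aFd]. *)
Definition p_explore : cmd :=
  inc rS;;
  Store aF (Cst 0) (Reg rV);;
  Store aFd (Reg rV) (Reg rS);;
  Assign rC (Cst 1);;
  Assign rR (Cst 0);;
  While (Sub (Leq (Add (Reg rR) (Cst 1)) (Cst rho)) (Leq (Reg rM) (Reg rC)))
    (Assign rD (Reg rC);;
     Assign rI (Cst 0);;
     While (Sub (Leq (Add (Reg rI) (Cst 1)) (Reg rD)) (Leq (Reg rM) (Reg rC)))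
       (Assign rY (Arr aF (Reg rI));;
        p_scan;;
        inc rI);;
     inc rR).

Section Levels.
Variables (V n l : nat) (e : rel nat).
Hypotheses (n_gt0 : 0 < n) (HV : 64 * (n * n * n) <= V).
Hypotheses (nl : n < 2 ^ l) (ln : 2 ^ l <= 2 * n).
Hypotheses (elt : forall i j, e i j -> i < n /\ j < n) (esym : symmetric e).

Let hV : 32 <= V. Proof. exact: V32 n_gt0 HV. Qed.
Let h1 : 64 * n <= V. Proof. exact: Vn1 n_gt0 HV. Qed.
Let h2 : 64 * (n * n) <= V. Proof. exact: Vn2 n_gt0 HV. Qed.

Local Notation low := (low n).

Definition link (K : nat -> nat) (x : nat) : rel nat :=
  fun u v => e u v && (0 < K (u * n + v) <= x.+1).

(** Levels are treated in increasing order. An older link therefore has level at most [x], still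
    serves for level [x], and is kept; the counts for smaller levels are final. *)
Record kext (x c : nat) (K K' : nat -> nat) : Prop := Kext {
  kx_old : forall i, 0 < K i -> K' i = K i;
  kx_le : forall i, K' i <= x.+1;
  kx_low : forall y, y < x -> low K' y <= low K y;
  kx_cnt : forall y, low K' y <= low K y + c }.

Lemma kext_refl x K : (forall i, K i <= x.+1) -> kext x 0 K K.
Proof. by move=> h; split=> // y; rewrite addn0. Qed.

Lemma kext_mono x c c' K K' : c <= c' -> kext x c K K' -> kext x c' K K'.
Proof. by move=> hc [k1 k2 k3 k4]; split=> // y; have := k4 y; lia. Qed.

Lemma kext_trans x c c' K K' K'' : kext x c K K' -> kext x c' K' K'' -> kext x (c + c') K K''.
Proof.
move=> [a1 a2 a3 a4] [b1 b2 b3 b4]; split=> //.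
- by move=> i hi; rewrite b1 a1.
- by move=> y hy; apply: leq_trans (b3 y hy) (a3 y hy).
- by move=> y; have := a4 y; have := b4 y; lia.
Qed.

Lemma kext_upd x c K K' i : K' i = 0 -> kext x c K K' -> kext x c.+1 K (upd K' i x.+1).
Proof.
move=> h0 [k1 k2 k3 k4]; split.
- by move=> j hj; rewrite /upd; case: eqP => [hE|_]; [move: (hj); rewrite -(k1 j hj) hE h0|apply: k1].
- by move=> j; rewrite /upd; case: ifP.
- move=> y hy; apply: leq_trans (k3 y hy); apply: sub_count => j; rewrite /upd.
  by case: ifP => // _; lia.
- move=> y; have := @leq_count_upd (fun m => 0 < m <= y.+1) K' i x.+1 _ (iota_uniq 0 (n * n)).
  by have := k4 y; rewrite /low; lia.
Qed.

Lemma link_ext x c x' K K' u v : kext x c K K' -> link K x' u v -> link K' x' u v.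
Proof. by move=> hk /andP[he /andP[h3 h4]]; rewrite /link (kx_old hk h3) he h3. Qed.

Definition mklink (x : nat) (K : nat -> nat) (i : nat) : nat -> nat :=
  if K i == 0 then upd K i x.+1 else K.

Lemma kext_mklink x K i : (forall j, K j <= x.+1) -> kext x 1 K (mklink x K i).
Proof.
move=> hK; rewrite /mklink; case: eqP => h0; last exact: kext_mono (kext_refl hK).
by apply: kext_upd => //; apply: kext_refl.
Qed.

Lemma mklink_ok x K i : (forall j, K j <= x.+1) -> 0 < mklink x K i i <= x.+1.
Proof.
move=> hK; rewrite /mklink; case: eqP => h0; first by rewrite /upd eqxx leqnn.
by rewrite hK lt0n andbT; apply/eqP.
Qed.

Lemma tri_link a b u v x k (R : state -> Prop) st : reg st rX = x -> x < n ->
  reg st a = u -> reg st b = v -> arr st aOff u = u * n -> 1 < k ->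
  (forall st', reg st' = reg st -> (forall c, c != aKl -> arr st' c = arr st c) ->
     arr st' aKl = mklink x (arr st aKl) (u * n + v) -> R st') ->
  tri V (p_link a b) k R st.
Proof.
move=> hx hxn ha hb ho hk hR; rewrite /p_link; stp; rewrite ha hb ho => h0.
  by stp; apply: hR => //; rewrite /mklink; case: eqP.
rewrite /put2; stp => _; apply: hR => //=.
  by move=> c hc; rewrite /upd (negPf hc).
by rewrite /upd /= ha hb ho hx addn1 /mklink h0 eqxx.
Qed.

(** * Truncated search around a center *)

Section Explore.
Variables (w x M : nat) (K0 : nat -> nat).
Hypotheses (hw : w < n) (hxn : x < n) (hM : M <= V).

(** The links have to realise the graph distance from [w] and not merely to connect [v], hence the
    quantification over all [m]. *)
Definition tree (K : nat -> nat) (r v : nat) : Prop := wlk e r w v /\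
  forall m, wlk e m w v -> wlk (link K x) m w v /\ wlk (link K x) m v w.

Record found (st : state) (s : seq nat) : Prop := Found {
  fd_size : size s = reg st rC;
  fd_nth : forall i, i < size s -> arr st aF i = nth 0 s i;
  fd_uniq : uniq s;
  fd_lt : forall v, v \in s -> v < n;
  fd_mem : forall b, b < n -> (reg st rS <= arr st aFd b) = (b \in s);
  fd_le : forall b, arr st aFd b <= reg st rS;
  fd_M : size s <= maxn M 1;
  fd_K : kext x (2 * size s) K0 (arr st aKl) }.

Lemma found_size st s : found st s -> size s <= n.
Proof.
move=> hq; rewrite -[X in _ <= X](size_iota 0); apply: uniq_leq_size (fd_uniq hq) _.
by move=> v /(fd_lt hq); rewrite mem_iota.
Qed.

Lemma tree_ext c K K' r v : kext x c K K' -> tree K r v -> tree K' r v.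
Proof.
move=> hk [t1 t2]; split=> // m /t2[t3 t4].
by split; [apply: wlk_sub t3|apply: wlk_sub t4] => ? ?; apply: link_ext hk.
Qed.

Lemma tri_scan st s r y : reg st rX = x -> reg st rM = M -> reg st rY = y ->
  offs n st -> degs n e st -> found st s ->
  (forall v, v \in s -> tree (arr st aKl) r.+1 v) ->
  (forall v m, m <= r -> wlk e m w v -> v \in s) -> y \in s -> wlk e r w y ->
  tri V p_scan (M * 15 + 3) (fun st' => exists t,
    [/\ found st' (s ++ t), forall v, v \in s ++ t -> tree (arr st' aKl) r.+1 v,
      exists c, kext x c (arr st aKl) (arr st' aKl) &
      reg st' rC < M -> forall b, e y b -> b \in s ++ t]) st.
Proof.
move=> hX hMr hY hO hD hf ht hc hy hwy.
have hyn := fd_lt hf hy.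
have [hdy hal] := hD y hyn.
rewrite /p_scan; stp.
pose J st1 t := [/\ found st1 (s ++ t), forall v, v \in s ++ t -> tree (arr st1 aKl) r.+1 v,
  exists c, kext x c (arr st aKl) (arr st1 aKl), reg st1 rJ <= deg n e y &
  forall b, b \in take (reg st1 rJ) (nbrs n e y) -> b \in s ++ t].
apply: (tri_while hV (I := fun st1 => exists t, J st1 t) (phi := fun st1 => (M - reg st1 rJ) * 15)) => //.
- exists [::]; rewrite /J cats0; split=> //=.
  + by case: hf => *; split.
  + by exists 0; apply: kext_refl; apply: (kx_le (fd_K hf)).
  + by rewrite /upd /= take0.
- by rewrite /= /upd /= subn0; lia.
- move=> st1 hf1 hb1 [t [j1 j2 [c0 j3] j4 j5]].
  have eY : reg st1 rY = y by rewrite hf1.1.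
  have eM : reg st1 rM = M by rewrite hf1.1.
  have eX : reg st1 rX = x by rewrite hf1.1.
  have eD : arr st1 aDeg y = deg n e y by rewrite hf1.2.
  have eO u : u < n -> arr st1 aOff u = u * n by move=> hu; rewrite hf1.2 //= hO // ltnW.
  rewrite /= eY eM eD -(fd_size j1) addn1 => hg.
  have [hlt hcM] : reg st1 rJ < deg n e y /\ size (s ++ t) < M.
    by move: hg; case: leqP => //; case: leqP => //; lia.
  (* All entries scanned so far are found vertices, and fewer than [M] are found. The scan thus ends
     within [M] passes however large the degree of [y] is. *)
  have hjM : reg st1 rJ < M.
    apply: leq_ltn_trans hcM; rewrite -[X in X <= _](size_takel (s := nbrs n e y)).
      by apply: uniq_leq_size => //; apply: take_uniq; apply: filter_uniq; apply: iota_uniq.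
    by rewrite size_nbrs; apply: ltnW.
  pose b := nth 0 (nbrs n e y) (reg st1 rJ).
  have hbn : b \in nbrs n e y by apply: mem_nth; rewrite size_nbrs.
  have [heb hbl] : e y b /\ b < n by move: hbn; rewrite mem_filter mem_iota => /andP[].
  have htake : take (reg st1 rJ).+1 (nbrs n e y) = rcons (take (reg st1 rJ) (nbrs n e y)) b.
    by rewrite (take_nth 0) // size_nbrs.
  have hsn := found_size j1.
  have eA : arr st1 aAl (y * n + reg st1 rJ) = b by rewrite hf1.2 //= hal.
  have hS : reg st1 rS <= V by apply: hb1.1.
  exists 13; stp; rewrite eY eO // eA; stp; rewrite (fd_mem j1) //.
    case hbs: (b \in s ++ t) => // _; stp; rewrite /inc; stp => _ _; split; last by lia.
    exists t; split=> //=; rewrite /upd /=; [by case: j1 => *; split|by exists c0|lia|].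
    move=> b'; rewrite addn1 htake mem_rcons inE => /orP[/eqP ->|] //; exact: j5.
  have hC := fd_size j1; have hdn := deg_le n e y.
  case hbs: (b \in s ++ t) => // _; repeat stp; rewrite /inc; repeat stp.
  apply: (tri_seq (k1 := 2) (k2 := 4)) => //.
  apply: tri_link; rewrite /= /upd /=; rewrite ?eX ?eY ?eO //.
  move=> st2 r2 a2 K2; rewrite /= /upd /= in r2 a2 K2; move=> _.
  apply: (tri_seq (k1 := 2) (k2 := 1)) => //.
  apply: tri_link; rewrite ?(a2 aOff isT) ?r2 /upd /= ?eX ?eY ?eO //.
  move=> st3 r3 a3 K3 _; rewrite K2 in K3.
  stp; first by rewrite r3 /=; lia.
  move=> _ _; rewrite r3 /= addn1; split; last lia.
  have hKle := kx_le (fd_K j1).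
  have e1 := kext_mklink (y * n + b) hKle.
  have e2 := kext_mklink (b * n + y) (kx_le e1).
  have o1 := mklink_ok (y * n + b) hKle.
  have o2 := mklink_ok (b * n + y) (kx_le e1).
  have e3 := kext_trans e1 e2; rewrite -K3 in e2 e3 o2.
  have lk1 : link (arr st3 aKl) x y b by rewrite /link heb (kx_old e2) //; case/andP: o1.
  have lk2 : link (arr st3 aKl) x b y by rewrite /link esym heb.
  exists (rcons t b); rewrite /J -rcons_cat; split=> //=; rewrite ?/upd /=.
  + split; rewrite /= ?/upd /= ?r3 /= ?(a3 aF isT) ?(a3 aFd isT) ?(a2 aF isT) ?(a2 aFd isT) //=.
    * by rewrite size_rcons hC addn1.
    * move=> i; rewrite size_rcons nth_rcons -hC => hi.
      case: ltngtP => hi'; [exact: (fd_nth j1)|lia|by []].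
    * by rewrite rcons_uniq hbs (fd_uniq j1).
    * by move=> v'; rewrite mem_rcons inE => /orP[/eqP ->|/(fd_lt j1)].
    * move=> b' hb'; rewrite mem_rcons inE; case: eqP => [->|_]; first by rewrite leqnn.
      exact: (fd_mem j1).
    * by move=> b'; case: eqP => // _; apply: (fd_le j1).
    * by rewrite size_rcons; lia.
    * by apply: kext_mono (kext_trans (fd_K j1) e3); rewrite size_rcons; lia.
  + move=> v'; rewrite mem_rcons inE => /orP[/eqP ->|/j2 hv']; last exact: tree_ext e3 hv'.
    have [t1 t2] := tree_ext e3 (j2 y ltac:(by rewrite mem_cat hy)).
    split; first by right; exists y.
    (* All vertices within distance [r] of [w] were found before, and [b] is new. *)
    move=> m hm; have hrm : r < m.
      rewrite ltnNge; apply/negP => hmr; have := hc _ _ hmr hm.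
      by move=> hbs'; move: hbs; rewrite mem_cat hbs'.
    have [t3 t4] := t2 r hwy.
    split; apply: (@wlk_mono _ r.+1) => //; first by right; exists y.
    by apply: (@wlk_trans _ 1 r _ y) => //; apply: wlk1.
  + by exists (c0 + 2); apply: kext_trans j3 e3.
  + move=> b'; rewrite htake mem_rcons inE => /orP[/eqP ->|/j5]; first by rewrite mem_rcons inE eqxx.
    by rewrite mem_rcons inE => ->; rewrite orbT.
- move=> st1 hf1 hb1 [t [j1 j2 [c0 j3] j4 j5]].
  have eY : reg st1 rY = y by rewrite hf1.1.
  have eM : reg st1 rM = M by rewrite hf1.1.
  have eD : arr st1 aDeg y = deg n e y by rewrite hf1.2.
  rewrite /= eY eM eD -(fd_size j1) addn1 => hg.
  exists t; split=> //; first by exists c0.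
  move=> hlt b heb; apply: j5.
  have -> : reg st1 rJ = deg n e y by move: hg; case: leqP; case: leqP => //; lia.
  rewrite -size_nbrs take_size mem_filter heb mem_iota.
  by case/elt: heb.
Qed.

Lemma tri_explore k st : 0 < M -> 700 * (M * M) <= k -> reg st rX = x -> reg st rM = M -> reg st rV = w ->
  offs n st -> degs n e st -> (forall b, arr st aFd b <= reg st rS) -> reg st rS < V ->
  arr st aKl = K0 -> (forall i, K0 i <= x.+1) ->
  tri V p_explore k (fun st' => exists s,
    [/\ found st' s, w \in s, forall v, v \in s -> wlk e rho w v,
      reg st' rS = (reg st rS).+1 &
      reg st' rC < M -> forall m v, m <= rho -> wlk e m w v ->
        wlk (link (arr st' aKl) x) m w v /\ wlk (link (arr st' aKl) x) m v w]) st.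
Proof.
move=> M0 hk hX hMr hW hO hD hfd hS hK0 hK0x.
have hMM : M <= M * M by rewrite leq_pmulr.
(* The factor 18 is [rho]. Each round goes again through the vertices found before it, at most [M]
   of them with at most [M] scanned entries each. *)
have {}hk : 18 * (M * (M * 15 + 8) + 8) + 10 <= k by lia.
rewrite /p_explore /inc; repeat stp.
rewrite hW addn1; set st0 := set_reg _ rR 0.
pose I st1 := exists s, [/\ found st1 s, w \in s, reg st1 rR <= rho,
  forall v, v \in s -> tree (arr st1 aKl) (reg st1 rR) v &
  reg st1 rC < M -> forall v m, m <= reg st1 rR -> wlk e m w v -> v \in s].
apply: (tri_while hV (I := I) (phi := fun st1 => (rho - reg st1 rR) * (M * (M * 15 + 8) + 8))) => //.
- exists [:: w]; split=> //.
  + split=> //; rewrite /= /upd /=.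
    * by case.
    * by move=> v; rewrite inE => /eqP ->.
    * move=> b _; rewrite inE; case: eqP => // _; have := hfd b; lia.
    * by move=> b; case: eqP => // _; apply: leqW.
    * by rewrite leq_maxr.
    * by rewrite hK0; apply: kext_mono (kext_refl hK0x).
  + by rewrite inE.
  + move=> v; rewrite inE => /eqP ->; split=> [|m _]; first exact: wlkxx.
    by split; apply: wlkxx.
  + move=> _ v m; rewrite /= /upd /= leqn0 => /eqP -> hv; have <- : w = v by [].
    by rewrite inE.
- by rewrite /st0 /= /upd /= subn0 /rho; lia.
- move=> st1 hf1 hb1 [s [i1 i2 i3 i4 i5]] /=.
  have eM : reg st1 rM = M by rewrite hf1.1.
  have eX : reg st1 rX = x by rewrite hf1.1.
  rewrite eM addn1 => hg.
  have [hr hcM] : reg st1 rR < rho /\ reg st1 rC < M.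
    by move: hg; case: leqP => //; case: leqP => //; lia.
  pose r := reg st1 rR.
  have hC := fd_size i1; have hsn := found_size i1.
  have hO1 : offs n st1 by move=> i hi; rewrite hf1.2 //= /upd /= hO.
  have hD1 : degs n e st1 by move=> v hv; rewrite !hf1.2 //= /upd /=; apply: hD.
  exists (M * (M * 15 + 8) + 7); stp; stp.
  apply: (tri_seq (k1 := M * (M * 15 + 8) + 1) (k2 := 1)); last lia.
  pose J st2 := exists t, [/\ found st2 (s ++ t), reg st2 rI <= size s,
    forall v, v \in s ++ t -> tree (arr st2 aKl) r.+1 v &
    reg st2 rC < M -> forall i b, i < reg st2 rI -> e (nth 0 s i) b -> b \in s ++ t].
  apply: (tri_while hV (I := J) (phi := fun st2 => (M - reg st2 rI) * (M * 15 + 8))) => //.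
  + exists [::]; rewrite cats0; split=> //; first by case: i1 => *; split.
    by move=> v /i4[t1 t2]; split=> //; apply: wlk_mono t1; rewrite /r.
  + by rewrite /= /upd /= subn0; lia.
  + move=> st2 hf2 hb2 [t [j1 j2 j3 j4]] /=.
    have eM2 : reg st2 rM = M by rewrite hf2.1.
    have eX2 : reg st2 rX = x by rewrite hf2.1.
    have eD2 : reg st2 rD = size s by rewrite hf2.1 //= /upd /= hC.
    rewrite eM2 eD2 addn1 => hg2.
    have [hi hcM2] : reg st2 rI < size s /\ reg st2 rC < M.
      by move: hg2; case: leqP => //; case: leqP => //; lia.
    pose y := nth 0 s (reg st2 rI).
    have hys : y \in s by apply: mem_nth.
    have hO2 : offs n st2 by move=> i hi'; rewrite hf2.2 //= hO1.
    have hD2 : degs n e st2 by move=> v hv; rewrite !hf2.2 //=; apply: hD1.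
    have hiM : reg st2 rI < M by have := fd_M i1; lia.
    exists (M * 15 + 6); stp.
    rewrite (fd_nth j1) ?size_cat ?nth_cat ?hi -/y; last by lia.
    apply: (tri_seq (k1 := M * 15 + 3) (k2 := 1)); last lia.
    apply: tri_weak (tri_scan (s := s ++ t) (r := r) (y := y) _ _ _ _ _ _ _ _ _ _) _ _ => //.
    * by case: j1 => *; split.
    * by move=> v m hm hv; rewrite mem_cat (i5 hcM v m hm hv).
    * by rewrite mem_cat hys.
    * by have [] := i4 y hys.
    move=> st3 hf3 [t' [k1 k2 [c k3] k4]] _.
    have hI3 : reg st3 rI = reg st2 rI by rewrite hf3.1.
    rewrite /inc; stp => _ _; rewrite hI3 addn1; split; last first.
      have -> : M - reg st2 rI = (M - (reg st2 rI).+1).+1 by lia.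
      by rewrite mulSn; lia.
    exists (t ++ t'); rewrite catA; split=> //=; rewrite /upd /= ?addn1 //.
      by case: k1 => *; split.
    move=> hlt i b; rewrite ltnS leq_eqVlt => /orP[/eqP ->|hi']; first exact: k4.
    have hlt2 : reg st2 rC < M by [].
    by move=> hb; rewrite mem_cat (j4 hlt2 i b hi' hb).
  + move=> st2 hf2 hb2 [t [j1 j2 j3 j4]] /=.
    have eM2 : reg st2 rM = M by rewrite hf2.1.
    have eD2 : reg st2 rD = size s by rewrite hf2.1 //= /upd /= hC.
    have eR2 : reg st2 rR = r by rewrite hf2.1.
    rewrite eM2 eD2 addn1 => hg2.
    have {}hg2 : reg st2 rC < M -> reg st2 rI = size s.
      by move: hg2; case: leqP => //; case: leqP => //; lia.
    move=> _; rewrite /inc; stp; first by rewrite eR2 /r; have := i3; rewrite /rho; lia.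
    move=> _ _; rewrite eR2 addn1; split; last first.
      have -> : rho - r = (rho - r.+1).+1 by rewrite -subnSK.
      by rewrite mulSn; lia.
    exists (s ++ t); split=> //=; rewrite /upd /= ?eR2 ?addn1 //.
    * by case: j1 => *; split.
    * by rewrite mem_cat i2.
    * move=> hlt v m; rewrite leq_eqVlt => /orP[/eqP ->|]; last first.
        by rewrite ltnS => hm hv; rewrite mem_cat (i5 hcM v m hm hv).
      case=> [hv|[z hz hzv]]; first by rewrite mem_cat (i5 hcM v r (leqnn _) hv).
      have /(nthP 0)[i hi hiz] := i5 hcM z r (leqnn _) hz.
      by apply: (j4 hlt i v); rewrite ?hg2 ?hiz.
- move=> st1 hf1 hb1 [s [i1 i2 i3 i4 i5]] /=.
  have eM : reg st1 rM = M by rewrite hf1.1.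
  rewrite eM addn1 => hg.
  have {}hg : reg st1 rC < M -> reg st1 rR = rho.
    by move: hg; case: leqP => //; case: leqP => //; lia.
  exists s; split=> //.
  + by move=> v /i4[t1 _]; apply: wlk_mono t1.
  + by rewrite hf1.1.
  + move=> hlt m v hm hv; have hmr : m <= reg st1 rR by rewrite hg.
    by have [_] := i4 v (i5 hlt v m hmr hv); apply.
Qed.

End Explore.
End Levels.

(** * Greedy packing of centers and of full balls *)

Definition p_zlev : cmd :=
  Assign rZ (Cst 0);;
  While (Leq (Cst 2) (Add (Leq (Add (Add (Reg rZ) (Reg rZ)) (Cst 2)) (Add (Reg rL) (Reg rX)))
                          (Leq (Add (Reg rZ) (Cst 1)) (Add (Reg rX) (Reg rX)))))
    (inc rZ);;
  Assign rM (Arr aPw (Reg rZ)).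

Definition p_raise (a : nat) : cmd :=
  If (Leq (Arr aLev (Reg rV)) (Reg a)) (Store aLev (Reg rV) (Reg a)) Skip.

Definition p_big : cmd :=
  If (Leq (Reg rM) (Reg rC))
    (Assign rF (Cst 0);;
     For rI (Reg rC)
       (If (Leq (Add (Reg rX) (Cst 1)) (Arr aMb (Arr aF (Reg rI)))) (Assign rF (Cst 1)) Skip);;
     If (Reg rF) Skip
       (For rI (Reg rC) (Store aMb (Arr aF (Reg rI)) (Add (Reg rX) (Cst 1)));;
        p_raise rZ))
    Skip.

Definition p_vertex : cmd :=
  If (Leq (Arr aPw (Reg rX)) (Arr aDeg (Reg rV)))
    (Assign rF (Cst 0);;
     For rB (Reg rN)
       (If (at2 aAdj (Reg rV) (Reg rB))
         (If (Leq (Add (Reg rX) (Cst 1)) (Arr aMk (Reg rB))) (Assign rF (Cst 1)) Skip)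
         Skip);;
     If (Reg rF) Skip
       (For rB (Reg rN)
          (If (at2 aAdj (Reg rV) (Reg rB)) (Store aMk (Reg rB) (Add (Reg rX) (Cst 1))) Skip);;
        p_raise rX;;
        p_explore;;
        p_big))
    Skip.

Definition p_levels : cmd :=
  For rX (Reg rL) (p_zlev;; For rV (Reg rN) p_vertex).

Section Counting.
Variable n : nat.

Definition wsum (lev : nat -> nat) : nat := \sum_(u <- iota 0 n) 2 ^ lev u.
(** Marks set on level [x] have the value [x.+1], so the count restarts at 0 on the next level
    without clearing the array. *)
Definition mcount (mk : nat -> nat) (x : nat) : nat := count (fun b => x < mk b) (iota 0 n).

Lemma mcount_le mk x : mcount mk x <= n.
Proof. by rewrite -[X in _ <= X](size_iota 0) count_size. Qed.

Lemma mcount0 mk x : (forall b, mk b <= x) -> mcount mk x = 0.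
Proof.
move=> h; apply/eqP; rewrite -leqn0 leqNgt -has_count; apply/hasPn => b _.
by rewrite -leqNgt.
Qed.

Lemma mcount_mark (mk mk' : nat -> nat) x (s : seq nat) : uniq s -> (forall b, b \in s -> b < n) ->
  (forall b, b \in s -> mk b <= x) -> (forall b, b \in s -> x < mk' b) ->
  (forall b, b \notin s -> mk' b = mk b) -> mcount mk' x = mcount mk x + size s.
Proof.
move=> us hs h3 h4 h5; rewrite /mcount.
have := count_predUI (fun b => x < mk b) (mem s) (iota 0 n).
have -> : count (predI (fun b => x < mk b) (mem s)) (iota 0 n) = 0.
  apply/eqP; rewrite -leqn0 leqNgt -has_count; apply/hasPn => b _ /=.
  by case hb: (b \in s); rewrite ?andbF // ltnNge h3.
have -> : count (mem s) (iota 0 n) = size s.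
  rewrite -size_filter; apply: perm_size; apply: uniq_perm => //.
    by rewrite filter_uniq // iota_uniq.
  move=> b; rewrite mem_filter mem_iota /=; case hb: (b \in s) => //=; exact: hs.
rewrite addn0 => <-; apply: eq_count => b /=.
case hb: (b \in s); first by rewrite orbT h4.
by rewrite orbF h5 // hb.
Qed.

Definition raised (lev : nat -> nat) (w z : nat) (lev' : nat -> nat) : Prop :=
  forall u, lev' u = if u == w then maxn (lev w) z else lev u.

Lemma wsum_raised lev w z lev' : raised lev w z lev' -> wsum lev' <= wsum lev + 2 ^ z.
Proof.
move=> hr; have h3 : forall s, uniq s ->
    \sum_(u <- s) 2 ^ lev' u <= \sum_(u <- s) 2 ^ lev u + (w \in s) * 2 ^ z.
  elim=> [|u s IH] /=; first by rewrite !big_nil.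
  move=> /andP[hu us]; rewrite !big_cons inE hr [w == u]eq_sym.
  have := IH us; case: (eqVneq u w) => [hE|_] /=; last by lia.
  subst u; rewrite (negPf hu) mul0n mul1n addn0.
  by case: (leqP (lev w) z) => _; [have := expn_gt0 2 (lev w)|have := expn_gt0 2 z]; lia.
apply: leq_trans (h3 _ (iota_uniq _ _)) _; rewrite leq_add2l.
by case: (_ \in _); rewrite ?mul1n.
Qed.

End Counting.

Section Levels.
Variables (V n l : nat) (e : rel nat).
Hypotheses (n_gt0 : 0 < n) (HV : 64 * (n * n * n) <= V).
Hypotheses (nl : n < 2 ^ l) (ln : 2 ^ l <= 2 * n).
Hypotheses (elt : forall i j, e i j -> i < n /\ j < n) (esym : symmetric e).

Let hV : 32 <= V. Proof. exact: V32 n_gt0 HV. Qed.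
Let h1 : 64 * n <= V. Proof. exact: Vn1 n_gt0 HV. Qed.
Let h2 : 64 * (n * n) <= V. Proof. exact: Vn2 n_gt0 HV. Qed.
Let hln : l <= n. Proof. exact: log_le nl ln. Qed.

Local Notation low := (low n).
Local Notation link := (link n e).
Local Notation wsum := (wsum n).
Local Notation mcount := (mcount n).

Lemma tri_raise a w z k (R : state -> Prop) st : reg st a = z -> reg st rV = w -> 1 < k ->
  (forall st', reg st' = reg st -> (forall c, c != aLev -> arr st' c = arr st c) ->
     raised (arr st aLev) w z (arr st' aLev) -> R st') ->
  tri V (p_raise a) k R st.
Proof.
move=> ha hw hk hR; rewrite /p_raise; stp; rewrite ha hw => h0; stp.
- move=> _; apply: hR => //=; first by move=> c hc; rewrite /upd (negPf hc).
  move=> u; rewrite /upd /= ha hw; case: eqP => // _.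
  by move: h0; case: leqP => //; rewrite /maxn; case: ltnP; lia.
- apply: hR => // u; case: eqP => // ->.
  by move: h0; case: leqP => //; rewrite /maxn; case: ltnP; lia.
Qed.

Lemma tri_zlev x st : reg st rL = l -> reg st rX = x -> x < l ->
  (forall i, i <= 2 * l -> arr st aPw i = 2 ^ i) ->
  tri V p_zlev (2 * n + 5) (fun st' => reg st' rZ = zlev l x /\ reg st' rM = 2 ^ zlev l x) st.
Proof.
move=> hL hX hx hP; rewrite /p_zlev; stp.
have hz : zlev l x <= l by rewrite /zlev; lia.
apply: (tri_seq (k1 := 2 * n + 1) (k2 := 1)); last lia.
apply: (tri_while hV (I := fun st1 => reg st1 rZ <= zlev l x) (phi := fun st1 => 2 * (zlev l x - reg st1 rZ))) => //.
- by rewrite /= /upd /=; lia.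
- move=> st1 hf hb hI /=; rewrite (hf.1 rL) // (hf.1 rX) //= /upd /= hL hX => hg.
  have hz1 : reg st1 rZ < zlev l x.
    by move: hg; rewrite /zlev; case: (leqP (_ + 2)); case: (leqP (_ + 1)); lia.
  exists 1; rewrite /inc; stp => _ _; lia.
- move=> st1 hf hb hI /=; rewrite (hf.1 rL) // (hf.1 rX) //= /upd /= hL hX => hg _.
  have hz1 : reg st1 rZ = zlev l x.
    by move: hI hg; rewrite /zlev; case: (leqP (_ + 2)); case: (leqP (_ + 1)); lia.
  stp => _; split=> //.
  by rewrite hz1 hf.2 //= hP //; lia.
Qed.

Definition ballmarks (lev mb : nat -> nat) (x : nat) : Prop := forall b, b < n -> x < mb b ->
  exists w', [/\ w' < n, zlev l x <= lev w' & wlk e rho w' b].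

(** The last clause is the payment for a raised level: it adds at most [2 ^ zlev l x = M] to [wsum],
    and a full ball brings at least [M] new marks. *)
Lemma tri_big x M w (s : seq nat) k st : reg st rX = x -> reg st rM = M -> M = 2 ^ zlev l x ->
  reg st rZ = zlev l x -> reg st rV = w -> w < n -> x < n ->
  size s = reg st rC -> (forall i, i < size s -> arr st aF i = nth 0 s i) -> uniq s ->
  (forall v, v \in s -> v < n) -> size s <= M -> 0 < M ->
  (forall v, v \in s -> wlk e rho w v) ->
  (forall b, arr st aMb b <= x.+1) -> ballmarks (arr st aLev) (arr st aMb) x ->
  10 * M + 12 <= k ->
  tri V p_big k (fun st' => [/\ forall b, arr st' aMb b <= x.+1,
    ballmarks (arr st' aLev) (arr st' aMb) x,
    exists y, y <= zlev l x /\ raised (arr st aLev) w y (arr st' aLev),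
    M <= size s -> exists w', [/\ w' < n, zlev l x <= arr st' aLev w' & wlk e (2 * rho) w w'] &
    wsum (arr st' aLev) + mcount (arr st aMb) x <= wsum (arr st aLev) + mcount (arr st' aMb) x]) st.
Proof.
move=> hX hMr hM hZ hW hw hxn hC hF us hs hsM M0 hball hmb hbm hk.
have hsn : size s <= n.
  rewrite -[X in _ <= X](size_iota 0); apply: uniq_leq_size us _.
  by move=> v /hs; rewrite mem_iota.
have same st' : arr st' = arr st -> (M <= size s -> exists w', [/\ w' < n, zlev l x <= arr st' aLev w' & wlk e (2 * rho) w w']) ->
  [/\ forall b, arr st' aMb b <= x.+1,
    ballmarks (arr st' aLev) (arr st' aMb) x,
    exists y, y <= zlev l x /\ raised (arr st aLev) w y (arr st' aLev),
    M <= size s -> exists w', [/\ w' < n, zlev l x <= arr st' aLev w' & wlk e (2 * rho) w w'] &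
    wsum (arr st' aLev) + mcount (arr st aMb) x <= wsum (arr st aLev) + mcount (arr st' aMb) x].
  move=> ha hbig; rewrite ha in hbig *; split=> //; exists 0; split=> // u.
  by case: eqP => // ->; rewrite maxn0.
rewrite /p_big; stp; rewrite hMr -hC => hg; last first.
  have hlt : size s < M by move: hg; case: leqP.
  by stp; apply: same => // h; move: hlt; rewrite ltnNge h.
have {hg} hMs : M <= size s by move: hg; case: leqP.
stp.
apply: (tri_seq (k1 := size s * 4 + 2) (k2 := size s * 3 + 6)); last lia.
apply: (tri_for hV (N := size s) (K := 2) (I := fun i st1 =>
   reg st1 rF = has (fun v => x < arr st aMb v) (take i s))) => //.
- lia.
- by move=> st1 hf /=; rewrite hf.1.
- by rewrite take0.
- lia.
- by move=> st1 st2 _ hr i; rewrite hr.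
- move=> i st1 hi hf hb hxi hI.
  have eX : reg st1 rX = x by rewrite hf.1.
  have eF : arr st1 aF i = nth 0 s i by rewrite hf.2 //= hF.
  have eM : arr st1 aMb = arr st aMb by rewrite hf.2.
  stp; rewrite eX hxi eF eM addn1 (take_nth 0 hi) has_rcons.
    by case: leqP => // hlt _; stp => _ _; rewrite /upd.
  case: leqP => // hlt _; stp => _; exact: hI.
move=> st1 hf hb hxi hI _; rewrite take_size in hI.
have eX : reg st1 rX = x by rewrite hf.1.
have eZ : reg st1 rZ = zlev l x by rewrite hf.1.
have eV : reg st1 rV = w by rewrite hf.1.
have eA : arr st1 = arr st by apply: boolp.funext => a; rewrite hf.2.
have eC : reg st1 rC = size s by rewrite hf.1.
stp; rewrite hI.
  case hh: (has _ _) => // _; stp; apply: same => // _.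
  move/hasP: hh => [b hbs hb1]; have [w' [w1 w2 w3]] := hbm b (hs b hbs) hb1.
  exists w'; rewrite eA; split=> //.
  (* The vertex [b] lies in both balls, which puts their centers at most [2 * rho] apart. *)
  rewrite mul2n -addnn; apply: wlk_trans (hball b hbs) _; exact: wlk_sym.
case hh: (has _ _) => // _.
have hun b : b \in s -> arr st aMb b <= x by move=> hbs; rewrite leqNgt; apply: (hasPn (negbT hh)).
apply: (tri_seq (k1 := size s * 3 + 2) (k2 := 2)); last lia.
apply: (tri_for hV (N := size s) (K := 1) (I := fun i st1 => forall b,
   arr st1 aMb b = if b \in take i s then x.+1 else arr st aMb b)) => //.
- lia.
- by move=> st2 hf2 /=; rewrite hf2.1.
- by move=> b; rewrite take0 /= eA.
- lia.
- by move=> st2 st3 ha _ i; rewrite ha.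
- move=> i st2 hi hf2 hb2 hxi2 hI2.
  have eX2 : reg st2 rX = x by rewrite hf2.1.
  have eF2 : arr st2 aF i = nth 0 s i by rewrite hf2.2 //= eA hF.
  stp => _ _ b; rewrite hxi2 eF2 eX2 addn1 (take_nth 0 hi) mem_rcons inE.
  by case: eqP => //= _; apply: hI2.
move=> st2 hf2 hb2 hxi2 hI2 _; rewrite take_size in hI2.
have eL2 : arr st2 aLev = arr st aLev by rewrite hf2.2 //= eA.
apply: (tri_raise (w := w) (z := zlev l x)) => //; try by rewrite hf2.1.
move=> st3 r3 a3 l3; rewrite eL2 in l3.
have eM3 b : arr st3 aMb b = if b \in s then x.+1 else arr st aMb b by rewrite a3.
have hle u : arr st aLev u <= arr st3 aLev u.
  by rewrite l3; case: eqP => // ->; rewrite leq_maxl.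
have hw3 : zlev l x <= arr st3 aLev w by rewrite l3 eqxx leq_maxr.
split.
- by move=> b; rewrite eM3; case: ifP.
- move=> b hbn; rewrite eM3; case: ifP => [hbs _|_ hlt].
    by exists w; split=> //; apply: hball.
  have [w' [w1 w2 w3]] := hbm b hbn hlt; exists w'; split=> //.
  exact: leq_trans w2 (hle w').
- by exists (zlev l x).
- by move=> _; exists w; split=> //; apply: wlkxx.
- rewrite (mcount_mark (mk := arr st aMb) (mk' := arr st3 aMb) (s := s)) //.
  + by have := wsum_raised n l3; rewrite -hM; lia.
  + by move=> b hbs; rewrite eM3 hbs.
  + by move=> b hbs; rewrite eM3 (negPf hbs).
Qed.

End Levels.

Section Levels.
Variables (V n l : nat) (e : rel nat).
Hypotheses (n_gt0 : 0 < n) (HV : 64 * (n * n * n) <= V).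
Hypotheses (nl : n < 2 ^ l) (ln : 2 ^ l <= 2 * n).
Hypotheses (elt : forall i j, e i j -> i < n /\ j < n) (esym : symmetric e).

Let hV : 32 <= V. Proof. exact: V32 n_gt0 HV. Qed.
Let h1 : 64 * n <= V. Proof. exact: Vn1 n_gt0 HV. Qed.
Let h2 : 64 * (n * n) <= V. Proof. exact: Vn2 n_gt0 HV. Qed.
Let hln : l <= n. Proof. exact: log_le nl ln. Qed.

Local Notation low := (low n).
Local Notation link := (link n e).
Local Notation wsum := (wsum n).
Local Notation mcount := (mcount n).
Local Notation deg := (deg n e).
Local Notation ballmarks := (ballmarks n l e).

Definition center (lev K : nat -> nat) (x a : nat) : Prop := [/\ a < n, x <= lev a &
  (exists w', [/\ w' < n, zlev l x <= lev w' & wlk e (2 * rho) a w']) \/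
  (forall m v, m <= rho -> wlk e m a v -> wlk (link K x) m a v /\ wlk (link K x) m v a)].

Lemma center_mono lev lev' x1 c K K' x a : (forall u, lev u <= lev' u) -> kext n x1 c K K' ->
  center lev K x a -> center lev' K' x a.
Proof.
move=> hl hk [c1 c2 c3]; split=> //; first exact: leq_trans c2 (hl a).
case: c3 => [[w' [w1 w2 w3]]|hs]; [left|right].
  by exists w'; split=> //; apply: leq_trans w2 (hl w').
move=> m v hm hv; have [s1 s2] := hs m v hm hv.
by split; [apply: wlk_sub s1|apply: wlk_sub s2] => ? ?; apply: link_ext hk.
Qed.

(* Invariant of the construction: the vertices [u < v] have been processed on
   level [x].  Every marked vertex pays for [2 ^ x] explored vertices. *)
Record linv (x v : nat) (lev K mk mb : nat -> nat) : Prop := Linv {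
  li_lev : forall u, u < n -> lev u < l;
  li_K : forall i, K i <= x.+1;
  li_mk : forall b, mk b <= x.+1;
  li_mb : forall b, mb b <= x.+1;
  li_low : forall y, low K y <= 2 * (n * 2 ^ x) + 2 * (2 ^ x * mcount mk x);
  li_low' : forall y, y < x -> low K y <= 4 * (n * 2 ^ y);
  li_sum : wsum lev <= n * (2 * x + 1) + mcount mk x + mcount mb x;
  li_mkc : forall b, b < n -> x < mk b -> exists2 a, e a b & center lev K x a;
  li_mbc : ballmarks lev mb x;
  li_piv : forall y u, y < x -> u < n -> 2 ^ y <= deg u ->
    exists2 w, center lev K y w & wlk e 2 u w;
  li_cur : forall u, u < v -> u < n -> 2 ^ x <= deg u ->
    exists2 w, center lev K x w & wlk e 2 u w }.

Lemma linv_init : 0 < l -> linv 0 0 (fun=> 0) (fun=> 0) (fun=> 0) (fun=> 0).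
Proof.
move=> l0; split=> //.
- move=> y; rewrite /low (eq_count (a2 := pred0)) // count_pred0; lia.
- rewrite /wsum (eq_bigr (fun=> 1)) // big_const_seq count_predT size_iota iter_addn_0; lia.
Qed.

(** At the end of a level there are at most [n] marks of either kind. Substituting this turns
    [li_low] into the final bound [li_low'] for [x] and into [li_low] for [x.+1]. *)
Lemma linv_next x lev K mk mb : linv x n lev K mk mb -> linv x.+1 0 lev K mk mb.
Proof.
move=> [i1 i2 i3 i4 i5 i6 i7 i8 i9 i10 i11].
have m1 := mcount0 n i3; have m2 := mcount0 n i4.
have m3 := mcount_le n mk x; have m4 := mcount_le n mb x.
have h3 : 2 ^ x * mcount mk x <= n * 2 ^ x by rewrite mulnC leq_mul2r m3 orbT.
split=> //.
- by move=> i; apply: leqW.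
- by move=> i; apply: leqW.
- by move=> i; apply: leqW.
- by move=> y; have := i5 y; rewrite m1 muln0 expnS; lia.
- by move=> y; rewrite ltnS leq_eqVlt => /orP[/eqP ->|/i6 //]; have := i5 x; lia.
- by rewrite m1 m2; move: i7; rewrite !mulnDr mulnS; lia.
- by move=> b _; rewrite ltnNge i3.
- by move=> b _; rewrite ltnNge i4.
- by move=> y u; rewrite ltnS leq_eqVlt => /orP[/eqP -> hu|]; [apply: i11|apply: i10].
Qed.

Definition lv (x v : nat) (st : state) : Prop :=
  [/\ linv x v (arr st aLev) (arr st aKl) (arr st aMk) (arr st aMb),
    forall b, arr st aFd b <= reg st rS & reg st rS <= n * x + v].

Definition fresh (mk : nat -> nat) (x v : nat) : bool :=
  (2 ^ x <= deg v) && ~~ has (fun b => e v b && (x < mk b)) (iota 0 n).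

Lemma tri_vertex x v k st : x < l -> v < n ->
  reg st rN = n -> reg st rX = x -> reg st rV = v -> reg st rZ = zlev l x ->
  reg st rM = 2 ^ zlev l x -> offs n st -> degs n e st ->
  (forall i, i <= 2 * l -> arr st aPw i = 2 ^ i) ->
  (forall i j, i < n -> j < n -> arr st aAdj (i * n + j) = e i j) ->
  lv x v st ->
  12 * n + 40 + (if fresh (arr st aMk) x v then 720 * (2 ^ zlev l x * 2 ^ zlev l x) else 0) <= k ->
  tri V p_vertex k (fun st' => lv x v.+1 st' /\ mcount (arr st' aMk) x =
    mcount (arr st aMk) x + (if fresh (arr st aMk) x v then deg v else 0)) st.
Proof.
move=> hx hv hN hX hVv hZ hMr hO hD hP hA [hli hfd hS] hk.
have [dv _] := hD v hv.
have hxn : x < n by lia.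
have skip st' : fresh (arr st aMk) x v = false ->
    (2 ^ x <= deg v -> exists2 w, center (arr st aLev) (arr st aKl) x w & wlk e 2 v w) ->
    arr st' = arr st -> reg st' rS = reg st rS ->
    lv x v.+1 st' /\ mcount (arr st' aMk) x = mcount (arr st aMk) x +
      (if fresh (arr st aMk) x v then deg v else 0).
  move=> hf hc ha hr; rewrite hf addn0 ha; split=> //; rewrite /lv ha hr; split=> //; last lia.
  case: hli => *; split=> // u; rewrite ltnS leq_eqVlt => /orP[/eqP ->|] //.
  by auto.
have eP : arr st aPw x = 2 ^ x by rewrite hP //; lia.
rewrite /p_vertex; stp; rewrite hVv dv hX eP => hg; last first.
  have hlt : deg v < 2 ^ x by move: hg; case: leqP.
  stp; apply: skip => //; first by rewrite /fresh leqNgt hlt.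
  by rewrite leqNgt hlt.
have hheavy : 2 ^ x <= deg v by move: hg; case: leqP.
stp; apply: (tri_seq (k1 := n * 5 + 2) (k2 := k.-1.-1 - (n * 5 + 2))); last lia.
pose P b := e v b && (x < arr st aMk b).
pose hm i := has P (iota 0 i).
apply: (tri_for hV (N := n) (K := 3) (I := fun i st1 => reg st1 rF = hm i)) => //.
- lia.
- by move=> st1 hf /=; rewrite hf.1.
- lia.
- by move=> st1 st2 _ hr i; rewrite hr.
- move=> b st1 hb hf hb1 hbi hI.
  have eX : reg st1 rX = x by rewrite hf.1.
  have eV : reg st1 rV = v by rewrite hf.1.
  have eO : arr st1 aOff v = v * n by rewrite hf.2 //= hO // ltnW.
  have eA : arr st1 aAdj (v * n + b) = e v b by rewrite hf.2 //= hA.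
  have eM : arr st1 aMk = arr st aMk by rewrite hf.2.
  have hS1 : hm b.+1 = hm b || P b.
    by rewrite /hm -addn1 iotaD has_cat /= orbF.
  stp; rewrite eV hbi eO eA hS1 /P; case: (e v b) => // _ /=.
    stp; rewrite eX hbi eM addn1; case: leqP => // hlt _.
      by stp => _ _; rewrite orbT /upd.
    by stp => _; rewrite orbF hI.
  by stp => _; rewrite orbF hI.
move=> st1 hf hb1 hbi hI _; rewrite /hm in hI.
have hfr : fresh (arr st aMk) x v = ~~ has P (iota 0 n) by rewrite /fresh hheavy.
have eA1 : arr st1 = arr st by apply: boolp.funext => a; rewrite hf.2.
have eX1 : reg st1 rX = x by rewrite hf.1.
have eV1 : reg st1 rV = v by rewrite hf.1.
have eN1 : reg st1 rN = n by rewrite hf.1.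
have eS1 : reg st1 rS = reg st rS by rewrite hf.1.
stp; rewrite hI => hh.
  have {}hh : has P (iota 0 n) by move: hh; case: (has _ _).
  stp; apply: skip => //; first by rewrite hfr hh.
  move=> _; case/hasP: hh => b; rewrite mem_iota => hbn /andP[hvb hb].
  (* The marked neighbour [b] of [v] is also a neighbour of the center [a] that marked it. *)
  have [a hab ha] := li_mkc hli hbn hb; exists a => //.
  by right; exists b; [apply: wlk1|rewrite esym].
have {}hh : has P (iota 0 n) = false by move: hh; case: (has _ _).
rewrite hfr hh /= in hk *.
have MM0 : 0 < 2 ^ zlev l x by rewrite expn_gt0.
have MM1 : 2 ^ zlev l x <= 2 ^ zlev l x * 2 ^ zlev l x by rewrite leq_pmulr.
apply: (tri_seq (k1 := n * 4 + 2) (k2 := 700 * (2 ^ zlev l x * 2 ^ zlev l x) + 10 * 2 ^ zlev l x + 14)); last lia.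
apply: (tri_for hV (N := n) (K := 2) (I := fun i st2 => forall b,
   arr st2 aMk b = if (b < i) && e v b then x.+1 else arr st aMk b)) => //.
- lia.
- by move=> st2 hf2 /=; rewrite hf2.1.
- by move=> b; rewrite ltn0 /= eA1.
- lia.
- by move=> st2 st3 ha _ i; rewrite ha.
- move=> b st2 hb hf2 hb2 hbi2 hI2.
  have eX : reg st2 rX = x by rewrite hf2.1.
  have eV : reg st2 rV = v by rewrite hf2.1.
  have eO : arr st2 aOff v = v * n by rewrite hf2.2 //= eA1 hO // ltnW.
  have eA : arr st2 aAdj (v * n + b) = e v b by rewrite hf2.2 //= eA1 hA.
  stp; rewrite eV hbi2 eO eA.
    case hE: (e v b) => // _; stp => _ _ b'; rewrite hbi2 eX addn1 ltnS leq_eqVlt.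
    case: eqP => [->|_] /=; first by rewrite hE.
    exact: hI2.
  case hE: (e v b) => // _; stp => _ b'; rewrite hI2 [b' < b.+1]ltnS [b' <= b]leq_eqVlt.
  by case: eqP => [->|_] //=; rewrite hE andbF.
move=> st2 hf2 hb2 hbi2 hI2 _.
pose s0 := nbrs n e v.
have eM2 b : arr st2 aMk b = if b \in s0 then x.+1 else arr st aMk b.
  by rewrite hI2 mem_filter mem_iota andbC.
have us0 : uniq s0 by rewrite filter_uniq // iota_uniq.
have hun b : b \in s0 -> arr st aMk b <= x.
  rewrite mem_filter mem_iota => /andP[hvb hbn]; rewrite leqNgt; apply/negP => hlt.
  have : has P (iota 0 n) by apply/hasP; exists b; rewrite ?mem_iota // /P hvb hlt.
  by rewrite hh.
have mk2 : mcount (arr st2 aMk) x = mcount (arr st aMk) x + deg v.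
  rewrite (mcount_mark (mk := arr st aMk) (s := s0)) // ?size_nbrs //.
  - by move=> b; rewrite mem_filter mem_iota => /andP[].
  - by move=> b hb; rewrite eM2 hb.
  - by move=> b hb; rewrite eM2 (negPf hb).
have eX2 : reg st2 rX = x by rewrite hf2.1.
have eV2 : reg st2 rV = v by rewrite hf2.1.
apply: (tri_seq (k1 := 2) (k2 := 700 * (2 ^ zlev l x * 2 ^ zlev l x) + 10 * 2 ^ zlev l x + 12)); last lia.
apply: (tri_raise n_gt0 HV nl ln (w := v) (z := x)) => //.
move=> st3 r3 a3 l3 _.
have eA3 a : a != aLev -> a != aMk -> arr st3 a = arr st a.
  by move=> c1 c2; rewrite a3 // hf2.2 ?eA1 //= inE.
have eL2 : arr st2 aLev = arr st aLev by rewrite hf2.2 //= eA1.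
rewrite eL2 in l3.
have hnn : n * x.+1 <= n * n by rewrite leq_mul2l; apply/orP; right.
apply: (tri_seq (k1 := 700 * (2 ^ zlev l x * 2 ^ zlev l x)) (k2 := 10 * 2 ^ zlev l x + 12)); last lia.
set M := 2 ^ zlev l x in hMr hk MM0 MM1 *.
have hzl : zlev l x < l by rewrite /zlev; lia.
have hMn : M <= 2 * n by apply: leq_trans ln; rewrite leq_exp2l // ltnW.
have hMV : M <= V by lia.
have eX3 : reg st3 rX = x by rewrite r3.
have eV3 : reg st3 rV = v by rewrite r3.
have eM3 : reg st3 rM = M by rewrite r3 hf2.1 //= hf.1.
have eZ3 : reg st3 rZ = zlev l x by rewrite r3 hf2.1 //= hf.1.
have eS3 : reg st3 rS = reg st rS by rewrite r3 hf2.1.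
have eK3 : arr st3 aKl = arr st aKl by rewrite eA3.
apply: tri_weak (tri_explore n_gt0 HV nl ln elt esym hv hxn hMV (K0 := arr st aKl) MM0
  (leqnn _) _ _ _ _ _ _ _ _ _) (leqnn _) _ => //.
- by move=> i hi; rewrite eA3 // hO.
- by move=> u hu; rewrite !eA3 //; apply: hD.
- by move=> b; rewrite eA3 // eS3.
- by rewrite eS3; move: hS hnn h2; rewrite mulnS; lia.
- exact: li_K hli.
move=> st4 hf4 [s [f4 hws hball hS4 hsmall]] _.
have eL4 : arr st4 aLev = arr st3 aLev by rewrite hf4.2.
have eMb4 : arr st4 aMb = arr st aMb by rewrite hf4.2 //= eA3.
have hsM : size s <= M by have := fd_M f4; rewrite /maxn; case: ltnP; lia.
have hLe u : arr st aLev u <= arr st3 aLev u.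
  by rewrite l3; case: eqP => // ->; rewrite leq_maxl.
apply: tri_weak (tri_big n_gt0 HV nl ln esym (x := x) (M := M) (w := v) (s := s) _ _ _ _ _ _ _ _ _ _ _ _ _ _ _ _ (leqnn _)) (leqnn _) _ => //;
  try by rewrite hf4.1.
- exact: fd_size f4.
- exact: fd_nth f4.
- exact: fd_uniq f4.
- exact: fd_lt f4.
- by move=> b; rewrite eMb4; apply: li_mb hli b.
- rewrite eL4 eMb4 => b hb hlt; have [w' [w1 w2 w3]] := li_mbc hli hb hlt.
  by exists w'; split=> //; apply: leq_trans w2 (hLe w').
move=> st5 hf5 [b1 b2 [y [y1 y2]] b4 b5].
rewrite eL4 in y2 b5; rewrite eMb4 in b5.
have eK5 : arr st5 aKl = arr st4 aKl by rewrite hf5.2.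
have eMk5 : arr st5 aMk = arr st2 aMk by rewrite hf5.2 //= hf4.2 //= a3.
have eFd5 : arr st5 aFd = arr st4 aFd by rewrite hf5.2.
have eS5 : reg st5 rS = reg st4 rS by rewrite hf5.1.
have hK := fd_K f4.
have hL5 u : arr st aLev u <= arr st5 aLev u.
  by rewrite y2; case: eqP => // ->; apply: leq_trans (hLe v) _; rewrite leq_maxl.
have hcv : center (arr st5 aLev) (arr st4 aKl) x v.
  split=> //; first by rewrite y2 eqxx l3 eqxx; lia.
  case: (leqP M (size s)) => hMs; first by left; apply: b4.
  by right; apply: hsmall; rewrite -(fd_size f4).
have hmono z a : center (arr st aLev) (arr st aKl) z a -> center (arr st5 aLev) (arr st4 aKl) z a.
  exact: center_mono hL5 hK.
have [i1 i2 i3 i4 i5 i6 i7 i8 i9 i10 i11] := hli.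
split; last by rewrite eMk5.
rewrite /lv eK5 eMk5 eFd5 eS5; split.
- split=> //.
  + move=> u hu; rewrite y2 !l3; have := i1 u hu; have := i1 v hv.
    by case: (u == v); rewrite ?eqxx; lia.
  + exact: kx_le hK.
  + by move=> b; rewrite eM2; case: ifP.
  + move=> z; rewrite mk2 mulnDr; have := kx_cnt hK z; have := i5 z.
    (* At most [M] explored vertices give at most [2 * M] links. As [M <= 2 ^ (2 * x)], the [deg v]
       new marks pay for them with [2 * 2 ^ x] each. *)
    have hp : 2 ^ x * 2 ^ x <= 2 ^ x * deg v by rewrite leq_mul2l hheavy orbT.
    have hp2 : M <= 2 ^ x * 2 ^ x by rewrite -expnD leq_exp2l //; rewrite /zlev; lia.
    by move: hp hp2 hsM; clear; lia.
  + by move=> z hz; apply: leq_trans (kx_low hK hz) (i6 z hz).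
  (* Raising [v] to level [x] adds at most [2 ^ x <= deg v], covered by the new neighbour marks;
     raising it to [zlev l x] is covered by the ball marks. *)
  + have := wsum_raised n l3; rewrite mk2.
    by move: i7 b5 hheavy; clear; lia.
  + move=> b hb; rewrite eM2; case: ifP => [hbs _|_ hlt].
      by exists v => //; move: hbs; rewrite mem_filter => /andP[].
    by have [a ha1 ha2] := i8 b hb hlt; exists a => //; apply: hmono.
  + move=> z u hz hu hd; have [w w1 w2] := i10 z u hz hu hd.
    by exists w => //; apply: hmono.
  + move=> u; rewrite ltnS leq_eqVlt => /orP[/eqP ->|hlt] hu hd.
      by exists v => //; apply: wlkxx.
    have [w w1 w2] := i11 u hlt hu hd.
    by exists w => //; apply: hmono.
- exact: fd_le f4.
- by rewrite hS4 eS3; lia.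
Qed.

Lemma linv_fun x v lev K mk mb lev' K' mk' mb' : lev =1 lev' -> K =1 K' -> mk =1 mk' ->
  mb =1 mb' -> linv x v lev K mk mb -> linv x v lev' K' mk' mb'.
Proof. by move=> /boolp.funext -> /boolp.funext -> /boolp.funext -> /boolp.funext ->. Qed.

(** The costly vertices are the centers. The potential grants [720 * 2 ^ l] for each vertex not yet
    marked on the current level, hence at most [720 * 2 ^ l * n] on each level. *)
Lemma tri_levels k st : reg st rN = n -> reg st rL = l -> offs n st -> degs n e st ->
  (forall i, i <= 2 * l -> arr st aPw i = 2 ^ i) ->
  (forall i j, i < n -> j < n -> arr st aAdj (i * n + j) = e i j) ->
  (forall i, [/\ arr st aLev i = 0, arr st aKl i = 0, arr st aMk i = 0, arr st aMb i = 0 &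
    arr st aFd i = 0]) -> reg st rS = 0 ->
  l * (n * (12 * n + 42) + 720 * 2 ^ l * n + 2 * n + 12) + 10 <= k ->
  tri V p_levels k (fun st' => exists mk mb, linv l 0 (arr st' aLev) (arr st' aKl) mk mb) st.
Proof.
move=> hN hL hO hD hP hA h0 hS hk; rewrite /p_levels.
have [B hB] : {B | B = 720 * 2 ^ l} by exists (720 * 2 ^ l).
rewrite -hB in hk.
apply: (tri_for hV (N := l) (K := n * (12 * n + 42) + B * n + 2 * n + 8)
  (I := fun x => lv x 0)) => //.
- lia.
- by move=> st1 hf /=; rewrite hf.1.
- split=> /=; last by rewrite /upd /= hS.
    apply: linv_fun (linv_init (log_gt0 nl n_gt0)) => i;
      by have [a1 a2 a3 a4 _] := h0 i; rewrite /= ?a1 ?a2 ?a3 ?a4.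
  by move=> b; have [_ _ _ _ ->] := h0 b.
- by move: hk; clear; lia.
- by move=> st1 st2 ha hr i; rewrite /lv ha hr.
- move=> x st1 hx hf hb hxi hlv.
  have eN : reg st1 rN = n by rewrite hf.1.
  have eL : reg st1 rL = l by rewrite hf.1.
  have eO : offs n st1 by move=> i hi; rewrite hf.2 //= hO.
  have eD : degs n e st1 by move=> v hv; rewrite !hf.2 //=; apply: hD.
  have eP i : i <= 2 * l -> arr st1 aPw i = 2 ^ i by move=> hi; rewrite hf.2 //= hP.
  have eA i j : i < n -> j < n -> arr st1 aAdj (i * n + j) = e i j.
    by move=> hi hj; rewrite hf.2 //= hA.
  apply: (tri_seq (k1 := 2 * n + 5) (k2 := n * (12 * n + 42) + B * n + 3)); last by clear; lia.
  apply: tri_weak (tri_zlev n_gt0 HV nl ln eL hxi hx eP) (leqnn _) _ => st2 hf2 [z1 z2] _.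
  have eM2 : arr st2 = arr st1 by apply: boolp.funext => a; rewrite hf2.2.
  have hlv2 : lv x 0 st2 by rewrite /lv eM2 hf2.1.
  (* Here the bound [(l + x) / 2] in [zlev] is used: a center of degree at least [2 ^ x] releases
     enough potential for a search quadratic in the ball size. *)
  have hM : 2 ^ zlev l x * 2 ^ zlev l x <= 2 ^ l * 2 ^ x.
    by rewrite -!expnD leq_exp2l // /zlev; lia.
  apply: (tri_for_pot hV (N := n) (K := 12 * n + 40) (I := fun v => lv x v)
    (phi := fun st3 => B * (n - mcount (arr st3 aMk) x))) => //.
  + lia.
  + by move=> st3 hf3 /=; rewrite hf3.1 //= hf2.1.
  + have : B * (n - mcount (arr (set_reg st2 rV 0) aMk) x) <= B * n by rewrite leq_mul2l leq_subr orbT.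
    by rewrite -addnA; clear; lia.
  + by move=> st3 st4 ha hr; rewrite ha; split=> // v; rewrite /lv ha hr.
  + move=> v st3 hv hf3 hb3 hvi hlv3.
    have eX3 : reg st3 rX = x by rewrite hf3.1 //= hf2.1.
    pose F := fresh (arr st3 aMk) x v.
    exists (12 * n + 40 + (if F then 720 * (2 ^ zlev l x * 2 ^ zlev l x) else 0)).
    apply: tri_weak (tri_vertex hx hv _ eX3 hvi _ _ _ _ _ _ hlv3 (leqnn _)) (leqnn _) _.
    * by rewrite hf3.1 //= hf2.1.
    * by rewrite hf3.1.
    * by rewrite hf3.1.
    * by move=> i hi; rewrite hf3.2 //= eM2 eO.
    * by move=> u hu; rewrite !hf3.2 //= eM2; apply: eD.
    * by move=> i hi; rewrite hf3.2 //= eM2 eP.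
    * by move=> i j hi hj; rewrite hf3.2 //= eM2 eA.
    move=> st4 hf4 [hlv4 hmc] _; split=> //; rewrite hmc -/F; rewrite -/F in hmc.
    case hfr: F; rewrite ?addn0 ?leqnn //.
    have hdeg : 2 ^ x <= deg v by case/andP: hfr.
    have hle := mcount_le n (arr st4 aMk) x; rewrite hmc hfr in hle.
    have h3 : 720 * (2 ^ zlev l x * 2 ^ zlev l x) <= B * deg v.
      rewrite hB -mulnA leq_mul2l /=; apply: leq_trans hM _.
      by rewrite leq_mul2l hdeg orbT.
    have -> : n - mcount (arr st3 aMk) x = (n - (mcount (arr st3 aMk) x + deg v)) + deg v by lia.
    by rewrite mulnDr -addnA leq_add2l addnC leq_add2l.
  + move=> st3 hf3 hb3 hvn [k1 k2 k3] _; split=> //; first exact: linv_next k1.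
    by rewrite addn0 mulnS addnC.
- by move=> st1 hf hb hxi [k1 _ _]; exists (arr st1 aMk), (arr st1 aMb).
Qed.

End Levels.

(** * Running time and correctness *)

Definition p_main : cmd :=
  p_off;; p_pow;; p_q;; p_deg;; p_levels;; p_forest;; p_lists;; p_bfs.

Lemma sum_flat n m (F : nat -> nat) : \sum_(c <- iota 0 (m * n)) F c =
  \sum_(u <- iota 0 m) \sum_(v <- iota 0 n) F (u * n + v).
Proof.
elim: m => [|m IH]; first by rewrite mul0n !big_nil.
rewrite mulSn addnC iotaD big_cat IH -addn1 iotaD big_cat big_seq1 /=; congr (_ + _).
by rewrite !add0n -[X in iota X n]addn0 iotaDl big_map.
Qed.

Lemma count_sum (P : pred nat) s : count P s = \sum_(i <- s) P i.
Proof. by elim: s => [|i s IH]; rewrite ?big_nil // big_cons /= IH. Qed.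

(** * Cost of the search on pairs *)

Section Cost.
Variables (n l q : nat) (e : rel nat) (K lev : nat -> nat).
Hypothesis (hlow : forall y, y < l -> low n K y <= 4 * (n * 2 ^ y) + 2 * n * l).
Hypothesis (hlev : forall u, u < n -> lev u < l).

Lemma row_cost y : y < l ->
  \sum_(v <- iota 0 n) count (light_or n q e K y v) (iota 0 n) <=
  2 ^ y * (n * (2 ^ q + 2 * l + 4)).
Proof.
move=> hy; apply: (@leq_trans (\sum_(v <- iota 0 n) (2 ^ (y + q) +
    \sum_(b <- iota 0 n) (0 < K (v * n + b) <= y.+1)))).
  apply: leq_sum => v _.
  apply: (@leq_trans (count (fun b => e v b && (deg n e v < 2 ^ (y + q))) (iota 0 n) +
      count (fun b => 0 < K (v * n + b) <= y.+1) (iota 0 n))).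
    rewrite -count_predUI; apply: leq_trans (leq_addr _ _); apply: sub_count => b.
    by rewrite /light_or /= andb_orr => /orP[->|/andP[_ ->]]; rewrite ?orbT.
  apply: leq_add; last by rewrite count_sum.
  case: (ltnP (deg n e v) (2 ^ (y + q))) => h.
    by rewrite (eq_count (a2 := e v)) => [|b]; [apply: ltnW|rewrite andbT].
  by rewrite (eq_count (a2 := pred0)) ?count_pred0 // => b; rewrite andbF.
rewrite big_split /= big_const_seq count_predT size_iota iter_addn_0.
have -> : \sum_(v <- iota 0 n) \sum_(b <- iota 0 n) (0 < K (v * n + b) <= y.+1) = low n K y.
  by rewrite /low count_sum sum_flat.
have h1 := hlow hy; have h2 : 0 < 2 ^ y by rewrite expn_gt0.
have h3 : 2 * n * l <= 2 ^ y * (n * (2 * l)) by rewrite (_ : 2 * n * l = n * (2 * l)) ?leq_pmull //; lia.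
by move: h1 h3; rewrite expnD !mulnDr; clear; lia.
Qed.

Lemma bfs_cost_le : wsum n lev <= n * (2 * l + 3) ->
  bfs_cost n q e K lev <= 14 * (n * n * (2 * l + 3) * (2 ^ q + 2 * l + 4)) + 10 * (n * n).
Proof.
move=> hw; rewrite /bfs_cost big_split /= -big_distrr /= big_const_seq count_predT size_iota iter_addn_0.
rewrite leq_add2r leq_mul2l /= sum_flat.
apply: (@leq_trans (\sum_(u <- iota 0 n) 2 ^ lev u * (n * (2 ^ q + 2 * l + 4)))).
  rewrite big_seq [X in _ <= X]big_seq; apply: leq_sum => u; rewrite mem_iota => hu.
  rewrite (eq_big_seq (fun v => count (light_or n q e K (lev u) v) (iota 0 n))).
    exact/row_cost/hlev.
  move=> v; rewrite mem_iota => hv; have n0 : 0 < n by lia.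
  by rewrite /cnt divnMDl // modnMDl divn_small // modn_small // addn0.
rewrite -big_distrl /= -/(wsum n lev).
apply: leq_trans (leq_mul hw (leqnn _)) _.
by rewrite mulnACA !mulnA.
Qed.

End Cost.

Definition lg (n : nat) : nat := (trunc_log 2 n).+1.
(** For positive [k] this is [lg n / k] rounded up, the form that [qexp_uniq] identifies with the
    result of [p_q]. *)
Definition qexp (n k : nat) : nat := ((lg n).-1 %/ k).+1.
Definition steps (n k : nat) : nat := 2 ^ 11 * (n * n * (lg n).+1 ^ 2 * 2 ^ qexp n k).
Definition vmax (n : nat) : nat := 64 * (n * n * n).

Lemma lg_gt n : n < 2 ^ lg n.
Proof. exact: trunc_log_ltn. Qed.

Lemma lg_le n : 0 < n -> 2 ^ lg n <= 2 * n.
Proof. by move=> h; rewrite expnS leq_mul2l trunc_logP. Qed.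

Lemma qexp_uniq n k r : 0 < r -> r.-1 * k < lg n -> lg n <= r * k -> r = qexp n k.
Proof.
move=> r0 h1 h2; rewrite /qexp; case: k h1 h2 => [|k] h1 h2; first by move: h2; rewrite muln0.
suff -> : (lg n).-1 %/ k.+1 = r.-1 by rewrite prednK.
apply/eqP; rewrite eqn_leq leq_divRL // -ltnS (prednK r0) ltn_divLR //.
by move: h1 h2; rewrite /lg /= => h1 h2; rewrite h2 -ltnS.
Qed.

(** * The whole program *)

Section Main.
Variables (n k logk : nat) (E : rel 'I_n).
Hypotheses (n_gt0 : 0 < n) (kE : k = 2 ^ logk) (Esym : symmetric E).

Local Notation V := (vmax n).
Local Notation l := (lg n).
Local Notation q := (qexp n k).

Definition adj (i j : nat) : bool :=
  [exists a : 'I_n, exists b : 'I_n, [&& a == i :> nat, b == j :> nat & E a b]].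

Lemma adjP i j : reflect (exists a b : 'I_n, [/\ a = i :> nat, b = j :> nat & E a b]) (adj i j).
Proof.
apply: (iffP existsP) => [[a /existsP[b /and3P[/eqP h1 /eqP h2 h3]]]|[a [b [h1 h2 h3]]]].
  by exists a, b.
by exists a; apply/existsP; exists b; rewrite h1 h2 h3 !eqxx.
Qed.

Lemma adj_lt i j : adj i j -> i < n /\ j < n.
Proof. by move/adjP => [a [b [<- <- _]]]; split; apply: ltn_ord. Qed.

Lemma adj_sym : symmetric adj.
Proof.
suff h i j : adj i j -> adj j i by move=> i j; apply/idP/idP; apply: h.
by move/adjP => [a [b [h1 h2 h3]]]; apply/adjP; exists b, a; rewrite Esym.
Qed.

Lemma adj_input i j : i < n -> j < n -> arr (input E k) aAdj (i * n + j) = adj i j.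
Proof.
move=> hi hj /=; congr nat_of_bool; apply: eq_existsb => a; apply: eq_existsb => b.
case: (E a b); rewrite ?andbF // !andbT.
apply/eqP/andP => [h|[/eqP -> /eqP ->] //].
by have [-> ->] := index_inj hj (ltn_ord b) h; rewrite !eqxx.
Qed.

Lemma dig_input i : arr (input E k) aDig i = (i == logk).
Proof.
rewrite /= kE; congr nat_of_bool; case: (ltngtP i logk) => h.
- have -> : 2 ^ logk %/ 2 ^ i = 2 ^ (logk - i) by rewrite expnB // ltnW.
  by rewrite oddX orbF subn_eq0 leqNgt h.
- by rewrite divn_small // ltn_exp2l.
- by rewrite h divnn expn_gt0.
Qed.

Lemma bnd_input : bnd V (input E k).
Proof.
have hV : n <= V by rewrite /vmax; nia.
split=> [r|a i] /=; first by rewrite /upd; case: ifP.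
by case: a => [|[|a]] //; apply: leq_trans hV; [case: [exists _, _]|case: odd].
Qed.

Definition estT (st : state) (m u v : nat) : Prop :=
  [/\ u < n, v < n, 0 < arr st aEst (u * n + v) & arr st aEst (u * n + v) <= m.+1].

Lemma q_gt0 : 0 < q. Proof. by []. Qed.

Lemma l_gt0 : 0 < l. Proof. by []. Qed.

Lemma q_le : q <= l.
Proof. by rewrite /q /qexp ltnS leq_div. Qed.

Lemma l_le : l <= q * k.
Proof.
rewrite /qexp -[X in X <= _](prednK l_gt0) ltn_ceil //; last by rewrite kE expn_gt0.
Qed.

Lemma steps_le N : 0 < n -> N = n * n * l.+1 ^ 2 * 2 ^ q ->
  n * n * l <= N /\ n * n * (2 * l + 3) * (2 ^ q + 2 * l + 4) <= 6 * N.
Proof.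
move=> _ ->; have : 2 <= 2 ^ q by rewrite -{1}(expn1 2) leq_exp2l.
have := l_gt0; move: (2 ^ q) (n * n) l => Q m x hx hQ; split.
  rewrite -mulnA leq_mul2l; apply/orP; right; rewrite -mulnn; nia.
have h : (2 * x + 3) * (Q + 2 * x + 4) <= 6 * (x.+1 ^ 2 * Q) by rewrite -mulnn; nia.
by have := leq_mul (leqnn m) h; rewrite [m * (6 * _)]mulnCA !mulnA.
Qed.

Lemma budget (c1 c2 c3 c4 c5 c6 c7 c8 : nat) :
  c1 <= 4 * n + 10 -> c2 <= 8 * n + 10 -> c3 <= 8 * (n * n) + 8 * n + 20 ->
  c4 <= 16 * (n * n) + 8 * n + 10 ->
  c5 <= l * (n * (12 * n + 42) + 720 * 2 ^ l * n + 2 * n + 12) + 10 ->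
  c6 <= l * (n * (n * 12 + 20) + 14) + 10 -> c7 <= l * (n * (n * 7 + 8) + 8) + 10 ->
  c8 <= 14 * (n * n * (2 * l + 3) * (2 ^ q + 2 * l + 4)) + 10 * (n * n) + 8 * n + 10 ->
  c1 + (c2 + (c3 + (c4 + (c5 + (c6 + (c7 + c8)))))) <= steps n k.
Proof.
rewrite /steps; have [] := steps_le n_gt0 erefl.
have := lg_le n_gt0; have := l_gt0; move: (2 ^ q) l (2 ^ l) => Q x P hx hP.
set N := n * n * x.+1 ^ 2 * Q; set M := n * n * _ * _ => h1 h2.
have hnn : n <= n * n by rewrite leq_pmull.
have hxn : n * n <= n * n * x by rewrite leq_pmulr.
have hxn' : n * x <= n * n * x by rewrite leq_mul2r hnn orbT.
have hxx : x <= n * x by rewrite leq_pmull.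
have hPn : x * (P * n) <= 2 * (n * n * x).
  by apply: leq_trans (leq_mul (leqnn x) (leq_mul hP (leqnn n))) _; rewrite -!mulnA; lia.
have -> : x * (n * (12 * n + 42) + 720 * P * n + 2 * n + 12) + 10 =
  12 * (n * n * x) + 44 * (n * x) + 720 * (x * (P * n)) + 12 * x + 10 by lia.
have -> : x * (n * (n * 12 + 20) + 14) + 10 = 12 * (n * n * x) + 20 * (n * x) + 14 * x + 10 by lia.
have -> : x * (n * (n * 7 + 8) + 8) + 10 = 7 * (n * n * x) + 8 * (n * x) + 8 * x + 10 by lia.
move=> *; apply: (@leq_trans (2000 * N)).
  by clearbody N M; lia.
by rewrite leq_mul2r; apply/orP; right.
Qed.

Lemma closed_est K1 K2 lev mk mb g s : linv n l adj l 0 lev K1 mk mb ->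
  (forall i, K2 i = K1 i \/ K2 i = 1) ->
  (forall x, x < l -> forest n adj lev K2 x) ->
  pairq n adj lev (light_or n q adj K2) g s (size s) ->
  closed n l q adj lev (light_or n q adj K2)
    (fun m u v => [/\ u < n, v < n, 0 < g u v & g u v <= m.+1]).
Proof.
move=> hL hK hF hP; split.
- by move=> a ha; rewrite (pq_diag hP).
- by move=> m u v [hu hv h1 h2]; rewrite (pq_sym hP hv hu).
- by move=> m m' u v hm [hu hv h1 h2]; split=> //; apply: leq_trans h2 _.
- move=> m u b b' [hu hb h1 h2] hW.
  have hs : (u, b) \in s by rewrite (pq_mem hP) hu hb.
  have hi : index (u, b) s < size s by rewrite index_mem.
  have := pq_clo hP (b := b') hi hi; rewrite nth_index //= => /(_ hW)/andP[h3 h4].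
  have [_ hb'] : b < n /\ b' < n by apply: adj_lt; case/andP: hW.
  by split=> //; apply: leq_trans h4 _.
- move=> x y b b' hxy /andP[h /orP[h1|/andP[h1 h2]]]; apply/andP; split=> //; apply/orP.
    by left; apply: leq_trans h1 _; rewrite leq_exp2l // leq_add2r.
  by right; rewrite h1; apply: leq_trans h2 _.
- by move=> x b b' h h'; rewrite /light_or h h'.
- move=> x u a r ha hx hr.
  have hxl : x < l by apply: leq_ltn_trans hx (li_lev hL ha).
  have [p [h1 h2 h3]] := hF x hxl u a r ha hx hr.
  have hs i j : base_edge n adj K2 i j -> light_or n q adj K2 0 i j.
    by case/andP=> h /eqP hk; rewrite /light_or h hk orbT.
  by exists p; split=> //; [apply: wlk_sub h2|apply: wlk_sub h3].
- move=> x v hv hd.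
  have hxl : x < l.
    have : 2 ^ x < 2 ^ l by apply: leq_ltn_trans (lg_gt n); apply: leq_trans hd (deg_le _ _ _).
    by rewrite ltn_exp2l.
  have [w [hw hxw hc] hvw] := li_piv hL hxl hv hd.
  exists w; split=> //; case: hc => [hc|hc]; [by left|right=> m v' hm hwv].
  have hs i j : link n adj K1 x i j -> light_or n q adj K2 x i j.
    move=> /and3P[h h1 h2]; rewrite /light_or h /=; apply/orP; right.
    by case: (hK (i * n + j)) => ->; rewrite ?h1.
  by have [h1 h2] := hc _ _ hm hwv; split; [apply: wlk_sub h1|apply: wlk_sub h2].
Qed.

Lemma tri_main : tri V p_main (steps n k) (fun st => exists K lev,
  closed n l q adj lev (light_or n q adj K) (estT st) /\
  forall m u v, u < n -> v < n -> arr st aEst (u * n + v) = m.+1 -> wlk adj m u v) (input E k).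
Proof.
have nl := lg_gt n; have ln := lg_le n_gt0; have HV : 64 * (n * n * n) <= V by [].
apply: tri_seq (budget (leqnn _) (leqnn _) (leqnn _) (leqnn _) (leqnn _) (leqnn _) (leqnn _) (leqnn _)).
apply: tri_weak (tri_off n_gt0 HV _) (leqnn _) _ => // st1 hf1 o1 _.
apply: tri_seq (leqnn _).
apply: tri_weak (tri_pow n_gt0 HV nl ln _) (leqnn _) _ => [|st2 hf2 [l2 w2] _].
  by rewrite hf1.1.
apply: tri_seq (leqnn _).
apply: tri_weak (tri_q n_gt0 HV nl ln kE l2 _) (leqnn _) _ => [i|st3 hf3 [q3 q3' q3''] _].
  by rewrite hf2.2 // hf1.2 // dig_input.
have {q3 q3' q3''} q3 := qexp_uniq q3 q3' q3''.
apply: tri_seq (leqnn _).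
have o3 : offs n st3 by move=> i hi; rewrite hf3.2 // hf2.2 // o1.
have A3 i j : i < n -> j < n -> arr st3 aAdj (i * n + j) = adj i j.
  by move=> hi hj; rewrite hf3.2 // hf2.2 // hf1.2 // adj_input.
have N3 : reg st3 rN = n by rewrite hf3.1 // hf2.1 // hf1.1.
apply: tri_weak (tri_deg n_gt0 HV nl ln kE N3 o3 A3 _) (leqnn _) _ => [i|st4 hf4 d4 _].
  by rewrite hf3.2 // hf2.2 // hf1.2.
apply: tri_seq (leqnn _).
have N4 : reg st4 rN = n by rewrite hf4.1.
have L4 : reg st4 rL = l by rewrite hf4.1 // hf3.1.
have o4 : offs n st4 by move=> i hi; rewrite hf4.2 // o3.
have A4 i j : i < n -> j < n -> arr st4 aAdj (i * n + j) = adj i j.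
  by move=> hi hj; rewrite hf4.2 // A3.
have w4 i : i <= 2 * l -> arr st4 aPw i = 2 ^ i by move=> hi; rewrite hf4.2 // hf3.2 // w2.
have Z4 a : a \notin [:: 0; 1; 3; 5; 18; 4] -> arr st4 a = fun=> 0.
  rewrite !inE !negb_or => /and5P[/eqP h0 /eqP h1 h3 h5 /andP[h18 h4]].
  rewrite hf4.2 ?hf3.2 ?hf2.2 ?hf1.2 //= ?inE ?negb_or ?h3 ?h5 ?h18 ?h4 //.
  by case: a h0 h1 {h3 h5 h18 h4} => [|[|a]].
apply: tri_weak (tri_levels n_gt0 HV nl ln adj_lt adj_sym N4 L4 o4 d4 w4 A4 _ _ (leqnn _)) (leqnn _) _.
- by move=> i; rewrite !Z4.
- by rewrite hf4.1 // hf3.1 // hf2.1 // hf1.1.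
move=> st5 hf5 [mk [mb hL]] _.
have N5 : reg st5 rN = n by rewrite hf5.1.
have L5 : reg st5 rL = l by rewrite hf5.1.
have o5 : offs n st5 by move=> i hi; rewrite hf5.2 // o4.
have A5 i j : i < n -> j < n -> arr st5 aAdj (i * n + j) = adj i j.
  by move=> hi hj; rewrite hf5.2 // A4.
apply: tri_seq (leqnn _).
apply: tri_weak (tri_forest n_gt0 HV nl ln adj_lt adj_sym erefl erefl N5 L5 o5 _ A5) (leqnn _) _.
  by move=> i; rewrite hf5.2 // Z4.
move=> st6 hf6 [hK hlow hF] _.
have N6 : reg st6 rN = n by rewrite hf6.1.
have L6 : reg st6 rL = l by rewrite hf6.1.
have Q6 : reg st6 rQ = q by rewrite hf6.1 // hf5.1 // hf4.1.
have o6 : offs n st6 by move=> i hi; rewrite hf6.2 // o5.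
have A6 i j : i < n -> j < n -> arr st6 aAdj (i * n + j) = adj i j.
  by move=> hi hj; rewrite hf6.2 // A5.
have w6 i : i <= 2 * l -> arr st6 aPw i = 2 ^ i by move=> hi; rewrite hf6.2 // hf5.2 // w4.
have d6 v : v < n -> arr st6 aDeg v = deg n adj v.
  by move=> hv; rewrite hf6.2 // hf5.2 //; case: (d4 v hv).
apply: tri_seq (leqnn _).
apply: tri_weak (tri_lists n_gt0 HV nl ln q_gt0 q_le erefl N6 L6 Q6 o6 w6 A6 d6) (leqnn _) _.
move=> st7 hf7 h7 _.
have K7 : arr st7 aKl = arr st6 aKl by rewrite hf7.2.
have lev7 : arr st7 aLev = arr st5 aLev by rewrite hf7.2 // hf6.2.
have N7 : reg st7 rN = n by rewrite hf7.1.
have o7 : offs n st7 by move=> i hi; rewrite hf7.2 // o6.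
apply: tri_weak (tri_bfs n_gt0 HV nl ln q_gt0 q_le adj_lt adj_sym K7 lev7 N7 o7 h7 (li_lev hL) _) _ _.
- by move=> i; rewrite hf7.2 // hf6.2 // hf5.2 // Z4.
- rewrite !leq_add2r; apply: bfs_cost_le (li_lev hL) _ => [y hy|].
    by apply: leq_trans (hlow y) _; rewrite leq_add2r (li_low' hL).
  apply: leq_trans (li_sum hL) _.
  have hm f : mcount n f l <= n by rewrite -[X in _ <= X](size_iota 0) count_size.
  by have := hm mk; have := hm mb; lia.
move=> st8 _ [s hs]; exists (arr st6 aKl), (arr st5 aLev); split.
  exact: closed_est hL hK hF hs.
by move=> m u v hu hv; apply: (pq_sound hs).
Qed.

Lemma main_run : exists st t, [/\ forall w, exec w p_main (input E k) st t,
  t <= steps n k * ucost V,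
  forall m u v, u < n -> v < n -> arr st aEst (u * n + v) = m.+1 -> wlk adj m u v &
  forall d v, 50 * (4 * logk + 6) < d -> (forall i, i < d -> adj (v i) (v i.+1)) ->
    estT st (2 * d) (v 0) (v d)].
Proof.
have [st [t [h1 h2 _ [K [lev [hC hs]]]]]] := tri_main bnd_input.
exists st, t; split=> // d v hd hv.
exact: (closed_stretch hC q_gt0 adj_sym adj_lt (lg_gt n) kE l_le hd hv).
Qed.

End Main.

Import Order.TTheory GRing.Theory Num.Theory.
Local Open Scope ring_scope.

Lemma lg_le1 n : (0 < n)%N -> (2 ^ (lg n).-1 <= n)%N.
Proof. exact: trunc_logP. Qed.

Lemma trunc_log_lt m j : (0 < m)%N -> (m < 2 ^ j)%N -> (trunc_log 2 m < j)%N.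
Proof. by move=> h1 h2; rewrite -(@ltn_exp2l 2) //; apply: leq_ltn_trans h2; apply: trunc_logP. Qed.

Lemma ucost_le n : (0 < n)%N -> (ucost (vmax n) <= 2 ^ 10 * (lg n).+1)%N.
Proof.
move=> n0; have h : (trunc_log 2 (32 * vmax n) < 3 * lg n + 11)%N.
  apply: trunc_log_lt; first by rewrite /vmax !muln_gt0 n0.
  have -> : (32 * vmax n = 2 ^ 11 * (n * n * n))%N by rewrite /vmax mulnA.
  rewrite addnC expnD ltn_pmul2l // [(3 * _)%N]mulnC expnM.
  by rewrite (_ : (n * n * n = n ^ 3)%N) ?ltn_exp2r ?lg_gt // !expnS expn0 muln1 mulnA.
by rewrite /ucost /bits (_ : (2 ^ 10 = 1024)%N) //; lia.
Qed.

(** * Real bounds and distances *)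

Section Final.
Variables (R : realType).

(** From [1 + x <= expR x] at [x = - ln 2]. *)
Lemma ln2_ge : 2^-1 <= ln 2 :> R.
Proof.
have := expR_ge1Dx (- ln (2 : R)); rewrite expRN lnK ?posrE //.
by move=> h; rewrite -lerN2 -(lerD2l 1); apply: le_trans h _; lra.
Qed.

Lemma lg_ln n : (0 < n)%N -> (lg n).+1%:R <= 2 * (1 + ln n%:R) :> R.
Proof.
move=> n0; have : ln (2 ^+ (lg n).-1) <= ln n%:R :> R.
  by rewrite ler_ln ?posrE ?exprn_gt0 ?ltr0n // -natrX ler_nat lg_le1.
rewrite lnXn // -[ln 2 *+ _]mulr_natr => h; have h2 := ln2_ge.
have : ln 2 * (lg n).-1%:R >= 2^-1 * (lg n).-1%:R :> R by rewrite ler_wpM2r.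
have -> : (lg n).+1%:R = (lg n).-1%:R + 2 :> R by rewrite -natrD addn2 /lg.
lra.
Qed.

Lemma qexp_powR n k : (0 < n)%N -> (0 < k)%N ->
  (2 ^ qexp n k)%:R <= 2 * n%:R `^ k%:R^-1 :> R.
Proof.
move=> n0 k0; rewrite expnS natrM ler_pM2l //.
have -> : (2 ^ ((lg n).-1 %/ k))%:R = ((2 ^ ((lg n).-1 %/ k))%:R `^ k%:R) `^ k%:R^-1 :> R.
  by rewrite -powRrM mulfV ?powRr1 // pnatr_eq0 -lt0n.
apply: ge0_ler_powR; rewrite ?nnegrE ?powR_ge0 ?invr_ge0 //.
rewrite powR_mulrn // -natrX ler_nat -expnM; apply: leq_trans (lg_le1 n0).
by rewrite leq_exp2l // leq_divM.
Qed.

(** The factor [2 ^ 25] collects [2 ^ 11] from [steps], [2 ^ 10] from [ucost], [2 ^ 3] from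
    replacing [lg n] by the natural logarithm in a cube, and 2 from rounding [q] up. The cube
    consists of two factors from [steps] and the word length. *)
Lemma time_le n k : (0 < n)%N -> (0 < k)%N ->
  (steps n k * ucost (vmax n))%:R <=
    2 ^+ 25 * (1 + ln (n%:R : R)) ^+ 3 * (n%:R : R) `^ (2 + k%:R^-1).
Proof.
move=> n0 k0; apply: (@le_trans _ _ (2 ^ 21 * (n * n * (lg n).+1 ^ 3 * 2 ^ qexp n k))%:R).
  rewrite ler_nat; apply: leq_trans (leq_mul (leqnn _) (ucost_le n0)) _.
  by rewrite /steps mulnACA -expnD leq_mul2l /= mulnAC -[X in (X * _)%N]mulnA -expnSr.
rewrite powRD; last by rewrite pnatr_eq0 -lt0n n0 implybT.
rewrite (_ : n%:R `^ 2 = n%:R ^+ 2); last by rewrite -powR_mulrn.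
have ha : (lg n).+1%:R ^+ 3 <= (2 * (1 + ln n%:R)) ^+ 3 :> R.
  by rewrite lerXn2r ?nnegrE ?lg_ln //; apply: le_trans (lg_ln n0).
have h := ler_pM (exprn_ge0 3 (ler0n R _)) (ler0n R _) ha (qexp_powR n0 k0).
rewrite (_ : _ * _ * (_ * _) = 2 ^+ 21 * (n%:R * n%:R * ((2 * (1 + ln n%:R)) ^+ 3 *
  (2 * n%:R `^ k%:R^-1)))); last by ring.
by rewrite natrM natrX ler_pM2l ?exprn_gt0 // -mulnA !natrM ler_pM2l ?mulr_gt0 ?ltr0n // natrX.
Qed.

Lemma prob1 T (P : (nat -> bool) -> Prop) : (forall w, P w) -> prob R T P = 1.
Proof.
move=> h; rewrite /prob (_ : [set u | _] = [set: T.-tuple bool]).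
  by rewrite cardsT card_tuple card_bool natrX divff // expf_eq0 pnatr_eq0 andbF.
by apply/setP => u; rewrite !inE; apply/asboolP.
Qed.

Section Dist.
Variables (n : nat) (E : rel 'I_n).
Local Notation adj := (adj E).

Lemma wlk_path m (s t : 'I_n) : wlk adj m s t ->
  exists q, [/\ path E s q, last s q = t & (size q <= m)%N].
Proof.
elim: m t => [|m IH] t /=; first by move=> /val_inj ->; exists [::].
case=> [/IH[q [h1 h2 h3]]|[z hz /adjP[a [b [ha /val_inj hb hab]]]]].
  by exists q; split=> //; apply: leqW.
move: hz; rewrite -ha => /IH[q [h1 h2 h3]]; exists (rcons q t).
by rewrite rcons_path last_rcons size_rcons h1 h2 -hb.
Qed.

Lemma dist_le s q : path E s q -> (dist R E s (last s q) <= (size q)%:R%:E)%E.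
Proof. by move=> h; apply: ereal_inf_lbound; exists q. Qed.

(** The infimum is over natural numbers, so it is attained as soon as some path exists. *)
Lemma distP (s t : 'I_n) : dist R E s t = +oo%E \/
  exists q, [/\ path E s q, last s q = t & dist R E s t = (size q)%:R%:E].
Proof.
have [[q0 [h1 h2]]|hn] := pselect (exists q, path E s q /\ last s q = t); last first.
  left; rewrite /dist (_ : [set _ | _ in _]%classic = set0) ?ereal_inf0 //.
  by rewrite -subset0 => r [q hq _]; apply: hn; exists q.
right; pose P m := `[< exists q, [/\ path E s q, last s q = t & size q = m] >].
have hP : exists m, P m by exists (size q0); apply/asboolP; exists q0.
case: (ex_minnP hP) => m /asboolP[q [h3 h4 h5]] hm; exists q; split=> //.
apply/eqP; rewrite eq_le -{1}h4 dist_le //=; apply: le_ereal_inf_tmp => _ [q' [h6 h7] <-].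
by rewrite lee_fin ler_nat h5 hm //; apply/asboolP; exists q'.
Qed.

Lemma dist_le_est st (s t : 'I_n) :
  (forall m u v, (u < n)%N -> (v < n)%N -> arr st 2 (u * n + v)%N = m.+1 -> wlk adj m u v) ->
  (dist R E s t <= est R st s t)%E.
Proof.
move=> h; rewrite /est; case hv: (arr st 2 _) => [|v]; first exact: leey.
have /wlk_path[q [h1 <- h3]] := h _ _ _ (ltn_ord s) (ltn_ord t) hv.
by apply: le_trans (dist_le h1) _; rewrite lee_fin ler_nat.
Qed.

Lemma est_le_dist st (s t : 'I_n) logk : (1 <= logk)%N ->
  (forall d v, (50 * (4 * logk + 6) < d)%N -> (forall i, (i < d)%N -> adj (v i) (v i.+1)) ->
    estT n st (2 * d) (v 0%N) (v d)) ->
  ((600 * logk%:R)%:E <= dist R E s t)%E -> (est R st s t <= 2%:R%:E * dist R E s t)%E.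
Proof.
move=> hk h; have [->|[q [h1 h2 ->]]] := distP s t.
  by move=> _; rewrite gt0_muley ?lte_fin ?ltr0n // leey.
rewrite lee_fin -natrM ler_nat => hd.
have [||_ _] := h (size q) (fun i => val (nth s (s :: q) i)).
(* For [logk >= 1] the threshold [50 * (4 * logk + 6)] is at most [500 * logk], below the distance
   [600 * logk] that is assumed. *)
- by lia.
- move=> i hi; apply/adjP; exists (nth s (s :: q) i), (nth s q i); split=> //.
  exact: (pathP s h1).
rewrite -(last_nth s s q) h2 /est /=.
case: (arr st 2 _) => // v _ hv.
by rewrite -EFinM lee_fin -natrM ler_nat.
Qed.

End Dist.

End Final.

Theorem theorem1 (R : realType) :
  exists (alg : cmd) (c c' C : R) (d : nat), 0 < c /\ 0 < c' /\
  forall (n k logk : nat) (E : rel 'I_n),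
    (0 < n)%N -> (1 <= logk)%N -> k = (2 ^ logk)%N -> symmetric E ->
  exists T : nat,
    (* running time *)
    T%:R <= C * (1 + ln (n%:R : R)) ^+ d * (n%:R : R) `^ (2 + k%:R^-1) /\
    (* every run halts within the time bound, with est >= dist *)
    (forall w : nat -> bool, exists (st : state) (t : nat),
       exec w alg (input E k) st t /\ (t <= T)%N /\
       forall x y : 'I_n, (dist R E x y <= est R st x y)%E) /\
    (* with high probability, est <= 2 dist for all far enough pairs *)
    1 - ((n%:R : R) `^ c')^-1 <=
      prob R T (fun w => exists (st : state) (t : nat),
        exec w alg (input E k) st t /\
        forall x y : 'I_n, ((c * logk%:R)%:E <= dist R E x y)%E ->
          (est R st x y <= 2%:R%:E * dist R E x y)%E).
Proof.
exists p_main, 600, 1, (2 ^+ 25), 3; split; first by rewrite ltr0n.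
split=> [|n k logk E n0 hk kE Esym]; first exact: ltr01.
have [st [t [h1 h2 h3 h4]]] := main_run n0 kE Esym.
exists (steps n k * ucost (vmax n))%N; split; first by apply: time_le => //; rewrite kE expn_gt0.
split=> [w|].
  by exists st, t; split=> //; split=> // x y; apply: dist_le_est.
(* The bound holds for every coin sequence, so the event has probability 1 and any exponent [c']
   would do. *)
rewrite prob1 => [|w]; first by rewrite gerBl invr_ge0 powR_ge0.
by exists st, t; split=> // x y; apply: est_le_dist.
Qed.
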